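(* Let $(M^{2d+1},\Omega,\alpha)$ be an shs manifold. Then there exist SMAT connections suitably adapted to the distributions $\ell_\Omega=\ker\Omega$ and $\ell_\alpha=\ker\alpha$: there exist a Riemannian metric $g$ on $M^{2d+1}$ compatible with $(\Omega,\alpha)$ and a pair $(\nabla,\nabla^* )$ of linear connections dual with respect to $g$, with $\nabla$ torsion-free, such that $\ell_\Omega$ is parallel with respect to $\nabla$ and $\ell_\alpha$ is parallel with respect to $\nabla^*$.
   Context: A stable Hamiltonian structure (shs) on a smooth manifold $M^{2d+1}$ is a pair $(\Omega,\alpha)$ with $\Omega$ a closed 2-form and $\alpha$ a 1-form such that $\alpha\wedge\Omega^{d}$ is nowhere zero and $\ker\Omega\subset\ker d\alpha$. Its Reeb vector field $E$ is defined by $i_E\Omega=0$, $i_E\alpha=1$. A Riemannian metric $g$ is compatible with $(\Omega,\alpha)$ (co-Hermitian) if there is an endomorphism field $\Theta$ of $TM$ with $\Theta^2=-I+\alpha\otimes E$, $\Theta E=0$, $\alpha\circ\Theta=0$, $\alpha=g(\cdot,E)$, $g=\Omega(\cdot,\Theta\cdot)+\alpha\otimes\alpha$. The dual connection is defined by $X\,g(Y,Z)=g(\nabla_XY,Z)+g(Y,\nabla^*_XZ)$; $(M,g,\nabla,\nabla^* )$ is a SMAT (statistical manifold admitting torsion) if $\nabla$ is torsion-free. A distribution $H$ is parallel with respect to (adapted to) a linear connection $\nabla$ if $\nabla_YS\in\Gamma(H)$ for all $Y\in\Gamma(TM)$ and $S\in\Gamma(H)$. *)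

(* Defs.v *)
From HB Require Import structures.
From mathcomp Require Import all_boot all_order all_algebra all_fingroup.
From mathcomp Require Import all_classical all_reals all_analysis.
Set Implicit Arguments.
Unset Strict Implicit.
Unset Printing Implicit Defensive.
Import Order.TTheory GRing.Theory Num.Theory.
Import numFieldNormedType.Exports.

Local Open Scope classical_set_scope.
Local Open Scope ring_scope.

Section Euclidean.
Variables (R : realType) (n : nat).

(* [iter_partial [:: i1; ..; ik] f] is d/dx_i1 ( .. (d/dx_ik f)). *)
Definition iter_partial (s : seq 'I_n) (f : 'rV[R]_n -> R) : 'rV[R]_n -> R :=
  foldr (fun (i : 'I_n) (h : 'rV[R]_n -> R) x => 'D_(delta_mx 0 i) h x) f s.

(* C^oo on U, where U is meant to be open: derivatives only see germs of f. *)
Definition smooth_on (U : set 'rV[R]_n) (f : 'rV[R]_n -> R) : Prop :=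
  forall (s : seq 'I_n) (x : 'rV[R]_n), U x ->
    {for x, continuous (iter_partial s f)} /\
    (forall i : 'I_n, derivable (iter_partial s f) x (delta_mx 0 i)).

Definition smooth_mx_on (m k : nat) (U : set 'rV[R]_n)
    (F : 'rV[R]_n -> 'M[R]_(m, k)) : Prop :=
  forall i j, smooth_on U (fun x => F x i j).

End Euclidean.

(* A smooth n-manifold without boundary, given by an atlas [phi c] with inverse
   charts [psi c]. The field [chart_at] selects, for every point, one chart of
   the atlas around it; this is how the charts are required to cover. *)
Record smooth_manifold (R : realType) (n : nat) := SmoothManifold {
  carrier :> topologicalType;
  chart_index : Type;
  chart_at : carrier -> chart_index;
  dom : chart_index -> set carrier;
  phi : chart_index -> carrier -> 'rV[R]_n;
  psi : chart_index -> 'rV[R]_n -> carrier;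
  manifold_hausdorff : hausdorff_space carrier;
  manifold_second_countable : @second_countable carrier;
  dom_chart_at : forall p, dom (chart_at p) p;
  dom_open : forall c, open (dom c);
  phi_open : forall c, open (phi c @` dom c);
  phiK : forall c p, dom c p -> psi c (phi c p) = p;
  phi_continuous : forall c p, dom c p -> {for p, continuous (phi c)};
  psi_continuous : forall c x, (phi c @` dom c) x -> {for x, continuous (psi c)};
  transition_smooth : forall c c',
    smooth_mx_on (phi c @` (dom c `&` dom c')) (phi c' \o psi c)
}.

(* The tangent space at p is R^n, a tangent vector being represented by its
   components in the chart [chart_at p]; covectors, bilinear forms and
   endomorphisms of the tangent space at p are then a column, a matrix with
   B(v, w) = v B w^T, and a matrix acting by v |-> v A. Since [chart_at] need
   not be locally constant, smoothness and derivatives of a tensor field are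
   always taken on its components in one fixed chart. *)
Section Tensors.
Variables (R : realType) (n : nat) (M : smooth_manifold R n).

Definition vfield := M -> 'rV[R]_n.
Definition covfield := M -> 'cV[R]_n.
Definition bifield := M -> 'M[R]_n.
Definition endfield := M -> 'M[R]_n.

Definition chart_image (c : chart_index M) : set 'rV[R]_n := phi c @` dom c.

(* Change of components at p: v (components in c) |-> v *m trans c c' p. *)
Definition trans (c c' : chart_index M) (p : M) : 'M[R]_n :=
  'J (phi c' \o psi c) (phi c p).

Definition loc_fun (f : M -> R) c : 'rV[R]_n -> R := f \o psi c.

Definition loc_vec (X : vfield) c (x : 'rV[R]_n) : 'rV[R]_n :=
  let p := psi c x in X p *m trans (chart_at p) c p.

Definition loc_cov (a : covfield) c (x : 'rV[R]_n) : 'cV[R]_n :=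
  let p := psi c x in trans c (chart_at p) p *m a p.

Definition loc_bi (B : bifield) c (x : 'rV[R]_n) : 'M[R]_n :=
  let p := psi c x in
  trans c (chart_at p) p *m B p *m (trans c (chart_at p) p)^T.

Definition loc_end (A : endfield) c (x : 'rV[R]_n) : 'M[R]_n :=
  let p := psi c x in
  trans c (chart_at p) p *m A p *m trans (chart_at p) c p.

Definition smooth_fun (f : M -> R) : Prop :=
  forall c, smooth_on (chart_image c) (loc_fun f c).
Definition smooth_vec (X : vfield) : Prop :=
  forall c, smooth_mx_on (chart_image c) (loc_vec X c).
Definition smooth_cov (a : covfield) : Prop :=
  forall c, smooth_mx_on (chart_image c) (loc_cov a c).
Definition smooth_bi (B : bifield) : Prop :=
  forall c, smooth_mx_on (chart_image c) (loc_bi B c).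
Definition smooth_end (A : endfield) : Prop :=
  forall c, smooth_mx_on (chart_image c) (loc_end A c).

Definition ev1 (a : covfield) (p : M) (v : 'rV[R]_n) : R := (v *m a p) 0 0.
Definition ev2 (B : bifield) (p : M) (v w : 'rV[R]_n) : R :=
  (v *m B p *m w^T) 0 0.

(* X f and [X, Y] at p, computed in [chart_at p], where the components of the
   vector X p are X p itself; likewise for the exterior derivatives below. *)
Definition vder (X : vfield) (f : M -> R) (p : M) : R :=
  let c := chart_at p in 'D_(X p) (loc_fun f c) (phi c p).

Definition lie_bracket (X Y : vfield) : vfield := fun p =>
  let c := chart_at p in
  'D_(X p) (loc_vec Y c) (phi c p) - 'D_(Y p) (loc_vec X c) (phi c p).

(* Exterior derivative of a 1-form: (da)_jk = d_j a_k - d_k a_j. *)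
Definition ext_d1 (a : covfield) : bifield := fun p =>
  let c := chart_at p in
  let pd (j k : 'I_n) : R :=
    'D_(delta_mx 0 j) (fun x => loc_cov a c x k 0) (phi c p) in
  \matrix_(j, k) (pd j k - pd k j).

(* Components of the exterior derivative of a 2-form:
   (dB)_ijk = d_i B_jk + d_j B_ki + d_k B_ij. *)
Definition ext_d2 (B : bifield) (p : M) (i j k : 'I_n) : R :=
  let c := chart_at p in
  let pd (a b e : 'I_n) : R :=
    'D_(delta_mx 0 a) (fun x => loc_bi B c x b e) (phi c p) in
  pd i j k + pd j k i + pd k i j.

Definition one_form (a : covfield) : Prop := smooth_cov a.
Definition two_form (B : bifield) : Prop :=
  smooth_bi B /\ forall p v w, ev2 B p v w = - ev2 B p w v.
Definition closed_two_form (B : bifield) : Prop :=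
  two_form B /\ forall p i j k, ext_d2 B p i j k = 0.

Definition ker1 (a : covfield) (p : M) : set 'rV[R]_n :=
  [set v | ev1 a p v = 0].
Definition ker2 (B : bifield) (p : M) : set 'rV[R]_n :=
  [set v | forall w, ev2 B p v w = 0].

Definition riemannian (g : bifield) : Prop :=
  [/\ smooth_bi g,
      forall p v w, ev2 g p v w = ev2 g p w v
    & forall p v, v != 0 -> 0 < ev2 g p v v].

(* Vector fields are raw functions, so the Koszul axioms are only required of
   smooth arguments. *)
Definition linear_connection (D : vfield -> vfield -> vfield) : Prop :=
  [/\ forall X Y, smooth_vec X -> smooth_vec Y -> smooth_vec (D X Y),
      forall f X X' Y, smooth_fun f ->
        smooth_vec X -> smooth_vec X' -> smooth_vec Y ->
        forall p, D (fun q => f q *: X q + X' q) Y p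
                  = f p *: D X Y p + D X' Y p,
      forall (r : R) X Y Y',
        smooth_vec X -> smooth_vec Y -> smooth_vec Y' ->
        forall p, D X (fun q => r *: Y q + Y' q) p = r *: D X Y p + D X Y' p
    & forall f X Y, smooth_fun f -> smooth_vec X -> smooth_vec Y ->
        forall p, D X (fun q => f q *: Y q) p
                  = vder X f p *: Y p + f p *: D X Y p].

Definition torsion_free (D : vfield -> vfield -> vfield) : Prop :=
  forall X Y, smooth_vec X -> smooth_vec Y ->
  forall p, D X Y p - D Y X p - lie_bracket X Y p = 0.

Definition dual_connections (g : bifield)
    (D D' : vfield -> vfield -> vfield) : Prop :=
  forall X Y Z, smooth_vec X -> smooth_vec Y -> smooth_vec Z ->
  forall p, vder X (fun q => ev2 g q (Y q) (Z q)) p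
            = ev2 g p (D X Y p) (Z p) + ev2 g p (Y p) (D' X Z p).

(* Statistical manifold admitting torsion: only D is torsion-free. *)
Definition smat (g : bifield) (D D' : vfield -> vfield -> vfield) : Prop :=
  [/\ riemannian g, linear_connection D, linear_connection D',
      dual_connections g D D' & torsion_free D].

Definition parallel (H : M -> set 'rV[R]_n)
    (D : vfield -> vfield -> vfield) : Prop :=
  forall Y S, smooth_vec Y -> smooth_vec S ->
  (forall p, H p (S p)) -> forall p, H p (D Y S p).

End Tensors.

Section Wedge.
Variables (R : realType) (V : Type).

Definition form (k : nat) := ('I_k -> V) -> R.

(* Normalized so that the wedge product of k one-forms is their determinant. *)
Definition wedge (k l : nat) (a : form k) (b : form l) : form (k + l) :=
  fun v => (k`!%:R * l`!%:R)^-1 *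
    \sum_(s : 'S_(k + l)) (-1) ^+ s *
      (a (fun i => v (s (lshift l i))) * b (fun j => v (s (rshift k j)))).

Fixpoint wedge_pow2 (b : form 2) (d : nat) : form d.*2 :=
  match d return form d.*2 with
  | 0%N => fun=> 1
  | e.+1 => wedge b (@wedge_pow2 b e)
  end.

End Wedge.
Arguments wedge_pow2 {R V} b d.

Section StableHamiltonian.
Variables (R : realType) (d : nat) (M : smooth_manifold R d.*2.+1).

Definition cov_form (a : covfield M) (p : M) : form R 'rV[R]_d.*2.+1 1 :=
  fun v => ev1 a p (v ord0).
Definition bi_form (B : bifield M) (p : M) : form R 'rV[R]_d.*2.+1 2 :=
  fun v => ev2 B p (v ord0) (v ord_max).

Definition stable_hamiltonian (Omega : bifield M) (alpha : covfield M) : Prop :=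
  [/\ closed_two_form Omega,
      one_form alpha,
      forall p, exists v : 'I_(1 + d.*2) -> 'rV[R]_d.*2.+1,
        wedge (cov_form alpha p) (wedge_pow2 (bi_form Omega p) d) v != 0
    & forall p, ker2 Omega p `<=` ker2 (ext_d1 alpha) p].

(* The Reeb field is unique when it exists, which makes its existential
   quantification in [co_hermitian] harmless. *)
Definition reeb_field (Omega : bifield M) (alpha : covfield M)
    (E : vfield M) : Prop :=
  [/\ smooth_vec E, forall p w, ev2 Omega p (E p) w = 0
    & forall p, ev1 alpha p (E p) = 1].

Definition co_hermitian (Omega : bifield M) (alpha : covfield M)
    (g : bifield M) : Prop :=
  riemannian g /\
  exists (E : vfield M) (Theta : endfield M),
    [/\ reeb_field Omega alpha E, smooth_end Theta &
        forall p,
        [/\ forall v, v *m Theta p *m Theta p = - v + ev1 alpha p v *: E p,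
            E p *m Theta p = 0,
            forall v, ev1 alpha p (v *m Theta p) = 0,
            forall v, ev1 alpha p v = ev2 g p v (E p)
          & forall v w, ev2 g p v w
              = ev2 Omega p v (w *m Theta p) + ev1 alpha p v * ev1 alpha p w]].

End StableHamiltonian.

(* Main.v *)
From HB Require Import structures.
From mathcomp Require Import all_boot all_order all_algebra all_fingroup.
From mathcomp Require Import all_classical all_reals all_analysis.
From mathcomp Require complex spectral.
From mathcomp Require Import ring lra.
Require Import Defs.
(** Let E be the Reeb field. Tangent vectors are row vectors, bilinear forms and
endomorphisms are matrices, and alpha is a column.

Connections. In a chart, let d be the flat connection of the coordinates. The
connection d_X Y + S(X, Y) with the symmetric tensor
  S(X, Y) = alpha(X) alpha(Y) d_E E - alpha(X) d_Y E - alpha(Y) d_X E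
is torsion-free, and it annihilates E because alpha(E) = 1 ([reeb_form_sym],
[loc_conn_reeb]). Both properties are preserved by convex combinations with
variable weights, so a partition of unity ([exists_pou]) glues these local
connections into a global torsion-free D with D E = 0. A section of ker Omega is
a multiple s E, and D_Y (s E) = (Y s) E: the kernel of Omega is parallel
([parallel_ker2]). The dual D' is glued from the local duals ([dual_glued]). As
alpha = g(., E), differentiating g(E, S) = 0 for a section S of ker alpha gives
  0 = g(D_Y E, S) + g(E, D'_Y S) = alpha(D'_Y S),
so ker alpha is parallel for D' ([parallel_ker1]).

Metric. The wedge condition says that Omega is nondegenerate on ker alpha
([shs_transverse]). A compatible metric is a positive definite G with
  G = Omega G^-1 Omega^T + alpha alpha^T, and then Theta = Omega G^-1
([co_hermitian_vec_theta]). Take any metric H, corrected so that alpha =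
H(., E), and let Q = Omega H^-1 Omega^T + alpha alpha^T. The geometric mean of H
and Q, which is the only positive definite solution of G H^-1 G = Q, has this
property: Omega G^-1 Omega^T + alpha alpha^T is a second positive definite
solution of the same equation ([cometricP]). Uniqueness also makes G independent
of the chart ([cometric_congr]).

Smoothness. The geometric mean is a rational expression in matrices and square
roots of positive definite matrices. Differentiating F F = A gives the Sylvester
equation F dF + dF F = dA, which determines dF rationally from F and dA. So if A
is smooth and F is C^k, then F is C^(k+1) ([Ckm_sqrtm]). The torsion is
chart-independent because second derivatives of the transition maps commute
([partial_comm], [bracket_chart]). *)

Set Implicit Arguments.
Unset Strict Implicit.
Unset Printing Implicit Defensive.
Import Order.TTheory GRing.Theory Num.Theory.
Import numFieldNormedType.Exports.

Local Open Scope classical_set_scope.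
Local Open Scope ring_scope.

(** * Mean values and differentiability from partial derivatives *)

Section MeanValue.
Variable R : realType.

Lemma cvg_sumR (T I : Type) (F : set_system T) {FF : Filter F} (r : seq I)
    (f : I -> T -> R) (a : I -> R) :
  (forall i, f i x @[x --> F] --> a i) ->
  \sum_(i <- r) f i x @[x --> F] --> \sum_(i <- r) a i.
Proof. by move=> H; apply: cvg_big => //; exact: add_continuous. Qed.

Lemma is_derive_line (V : normedModType R) (f : V -> R) (a v : V) (t : R) :
  derivable f (t *: v + a) v ->
  is_derive t 1 (fun u : R => f (u *: v + a)) ('D_v f (t *: v + a)).
Proof.
have E : (fun h : R => h^-1 *: (((fun u : R => f (u *: v + a)) \o shift t) (h *: 1) - f (t *: v + a)))
   = (fun h : R => h^-1 *: ((f \o shift (t *: v + a)) (h *: v) - f (t *: v + a))).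
  by apply/funext => h /=; rewrite [h *: 1]mulr1 scalerDl addrA.
move=> df; split.
  by rewrite /derivable E.
by rewrite /derive E.
Qed.

Lemma is_derive_scale (V : normedModType R) (f : V -> R) (a v : V) (s : R) :
  derivable f a v -> is_derive a (s *: v) f (s * 'D_v f a).
Proof.
move=> df.
have df0 : derivable f (0 *: v + a) v by rewrite scale0r add0r.
have [/= dg gE] := is_derive_line df0.
set g := (fun u => _) in dg gE.
have dg' := (derivable1_diffP g 0).1 dg.
have E : (fun h : R => h^-1 *: ((f \o shift a) (h *: (s *: v)) - f a))
  = (fun h : R => h^-1 *: ((g \o shift 0) (h *: s) - g 0)).
  by apply/funext => h /=; rewrite /g addr0 scale0r add0r scalerA.
split.
  rewrite /derivable E.
  exact: diff_derivable.
have -> : 'D_(s *: v) f a = 'D_s g 0 by rewrite /derive E.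
rewrite scale0r add0r in gE.
by rewrite -gE !(deriveE _ dg') -[s in LHS]mulr1 linearZ.
Qed.

Lemma line_mvt (V : normedModType R) (f : V -> R) (a v : V) :
  (forall t : R, 0 <= t <= 1 -> derivable f (t *: v + a) v) ->
  exists2 t : R, 0 <= t <= 1 & f (v + a) - f a = 'D_v f (t *: v + a).
Proof.
move=> df; pose g := (fun u : R => f (u *: v + a)).
have dg (t : R) : 0 <= t <= 1 -> is_derive t 1 g ('D_v f (t *: v + a)).
  by move=> t01; apply: is_derive_line; apply: df.
have [|||c c01] := @MVT_segment R g (fun t => 'D_v f (t *: v + a)) 0 1.
- exact: ler01.
- move=> t; rewrite in_itv/= => /andP[t0 t1]; apply: dg; by rewrite !ltW.
- apply: derivable_within_continuous => t; rewrite in_itv/= => t01.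
  by have [] := dg t t01.
rewrite /g scale1r scale0r add0r subr0 mulr1 => ->; exists c => //.
Qed.

Lemma differentiable_intro (V W : normedModType R) (f : V -> W)
    (df : {linear V -> W}) (a : V) :
  continuous df ->
  (forall e : R, 0 < e -> \forall h \near (0 : V),
     `|f (h + a) - f a - df h| <= e * `|h|) ->
  differentiable f a /\ 'd f a = df :> (V -> W).
Proof.
move=> cdf H.
have key : f \o shift a = cst (f a) + df +o_ (0 : V) id.
  by apply/eqaddoP => e e0; apply: filterS (H e e0) => h; rewrite /= opprD addrA.
have dl := diff_unique cdf key.
by split => //; apply/diff_locallyP; rewrite dl.
Qed.

End MeanValue.

Section MxNorm.
Variable R : realType.

Lemma mx_norm_le m n (x : 'M[R]_(m, n)) (M : R) : 0 <= M ->
  (forall i j, `|x i j| <= M) -> `|x| <= M.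
Proof.
move=> M0 H; rewrite /Num.norm/= mx_normrE.
by apply/bigmax_leP; split => // -[i j] _; apply: H.
Qed.

Lemma entry_le_norm m n (x : 'M[R]_(m, n)) i j : `|x i j| <= `|x|.
Proof.
rewrite [leRHS]/Num.norm/= mx_normrE.
exact: (le_bigmax _ _ (i, j)).
Qed.

End MxNorm.

Section DotRow.
Variables (R : realType) (n : nat).

(** A candidate differential has to come with a [linear] structure; this
is the one given by a column of partial derivatives. *)
Definition dotrow (c : 'cV[R]_n) (v : 'rV[R]_n) : R := (v *m c) 0 0.

Lemma dotrow_is_linear c : linear (dotrow c).
Proof. by move=> k u v; rewrite /dotrow mulmxDl -scalemxAl !mxE. Qed.
HB.instance Definition _ c :=
  GRing.isLinear.Build R 'rV[R]_n R _ (dotrow c) (dotrow_is_linear c).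

Lemma dotrow_continuous c : continuous (dotrow c).
Proof.
rewrite (_ : dotrow c = fun x => \sum_j x 0 j * c j 0); last first.
  by apply/funext => x; rewrite /dotrow mxE.
move=> x; apply: (@cvg_sumR _ _ _ (nbhs x)) => i; apply: cvgM; last exact: cvg_cst.
exact: coord_continuous.
Qed.

(** The increment f (h + a) - f a telescopes along a broken line that
changes one coordinate at a time. On each edge the mean value theorem produces
h_j times a partial derivative at a point no farther from a than h, hence close
to its value at a. *)
Lemma differentiable_of_partials (f : 'rV[R]_n -> R) (a : 'rV[R]_n) :
  (forall i : 'I_n, \forall x \near a, derivable f x (delta_mx 0 i)) ->
  (forall i : 'I_n, {for a, continuous (fun x => 'D_(delta_mx 0 i) f x)}) ->
  differentiable f a /\
  forall v, 'd f a v = \sum_i v 0 i * 'D_(delta_mx 0 i) f a.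
Proof.
move=> df cf.
pose c : 'cV[R]_n := \col_i 'D_(delta_mx 0 i) f a.
have dE v : dotrow c v = \sum_i v 0 i * 'D_(delta_mx 0 i) f a.
  by rewrite /dotrow mxE; apply: eq_bigr => i _; rewrite mxE.
have key (e : R) : 0 < e -> \forall h \near (0 : 'rV[R]_n),
     `|f (h + a) - f a - dotrow c h| <= e * `|h|.
  move=> e0.
  (* The dimension n may be 0, whence n.+1. *)
  pose e' := e / n.+1%:R.
  have e'0 : 0 < e' by rewrite divr_gt0.
  have Hn (i : 'I_n) : \forall x \near a, derivable f x (delta_mx 0 i) /\
      `|'D_(delta_mx 0 i) f x - 'D_(delta_mx 0 i) f a| <= e'.
    near=> x; split; first by near: x; apply: df.
    rewrite distrC; near: x.
    have /cvgrPdist_le := cf i; exact.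
  have /nbhs_ballP [r /= r0 H] := filter_forall (nbhs_filter a) Hn.
  near=> h.
  have hr : `|h| < r.
    near: h; apply/nbhs_ballP; exists r => // y.
    by rewrite -ball_normE /= sub0r normrN.
  pose tr (j : nat) : 'rV[R]_n := \row_i (if (i < j)%N then h 0 i else 0).
  have trS (j : 'I_n) : tr j.+1 = h 0 j *: delta_mx 0 j + tr j.
    apply/rowP => i; rewrite !mxE eqxx /= ltnS leq_eqVlt.
    have [->|ij] := eqVneq i j; first by rewrite eqxx ltnn mulr1 addr0.
    by rewrite val_eqE (negPf ij) mulr0 add0r.
  have tr0 : tr 0%N = 0 by apply/rowP => i; rewrite !mxE.
  have trn : tr n = h by apply/rowP => i; rewrite !mxE ltn_ord.
  have step (j : 'I_n) : exists2 x, ball a r x &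
     f (tr j.+1 + a) - f (tr j + a) = h 0 j * 'D_(delta_mx 0 j) f x.
    have inb (t : R) : 0 <= t <= 1 -> ball a r (t *: (h 0 j *: delta_mx 0 j) + (tr j + a)).
      case/andP => t0 t1.
      rewrite -ball_normE /= distrC addrA addrK; apply: le_lt_trans hr.
      apply: mx_norm_le => // i k; rewrite ord1 !mxE eqxx /=.
      have [->|ij] := eqVneq k j.
        rewrite ltnn mulr1 addr0 normrM ger0_norm//.
        apply: le_trans (entry_le_norm h 0 j).
        by rewrite ler_piMl.
      rewrite !mulr0 add0r; case: ifP => _; first exact: entry_le_norm.
      by rewrite normr0.
    have dd (t : R) : 0 <= t <= 1 -> is_derive (t *: (h 0 j *: delta_mx 0 j) + (tr j + a))
        (h 0 j *: delta_mx 0 j) f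
        (h 0 j * 'D_(delta_mx 0 j) f (t *: (h 0 j *: delta_mx 0 j) + (tr j + a))).
      by move=> /inb /H /(_ j)[? _]; apply: is_derive_scale.
    have [|t t01] := @line_mvt R _ f (tr j + a) (h 0 j *: delta_mx 0 j).
      by move=> t /dd[].
    rewrite addrA -trS => ->; exists (t *: (h 0 j *: delta_mx 0 j) + (tr j + a)).
      exact: inb.
    by have [_ ->] := dd t t01.
  have tele : f (h + a) - f a = \sum_(j < n) (f (tr j.+1 + a) - f (tr j + a)).
    rewrite -(big_mkord xpredT (fun j => f (tr j.+1 + a) - f (tr j + a))).
    by rewrite (telescope_sumr (fun j => f (tr j + a)))// trn tr0 add0r.
  rewrite tele dE -sumrB.
  apply: le_trans (ler_norm_sum _ _ _) _.
  apply: (@le_trans _ _ (\sum_(i < n) e' * `|h|)).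
    apply: ler_sum => j _; have [x xb ->] := step j.
    rewrite -mulrBr normrM mulrC; apply: ler_pM => //.
      by have [_] := H x xb j.
    exact: entry_le_norm.
  rewrite sumr_const card_ord -mulr_natr mulrAC ler_wpM2r//.
  rewrite /e' -mulrA ler_piMr ?(ltW e0)// ler_pdivrMl// mulr1 ler_nat//.
have [? dl] := differentiable_intro (@dotrow_continuous c) key.
by split => // v; rewrite dl -dE.
Unshelve. all: by end_near.
Qed.

End DotRow.

(** * Functions of class C^k on a subset of R^n *)

Section Ck.
Variables (R : realType) (n : nat).
Implicit Types (U V : set 'rV[R]_n) (f g : 'rV[R]_n -> R).

Definition partial (i : 'I_n) f : 'rV[R]_n -> R := fun x => 'D_(delta_mx 0 i) f x.

(** The recursion on k makes closure properties, and the bootstrap for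
square roots, inductions on k. *)
Fixpoint Ck (k : nat) U f : Prop :=
  (forall x, U x -> {for x, continuous f}) /\
  if k is k'.+1 then
    forall i, (forall x, U x -> derivable f x (delta_mx 0 i)) /\ Ck k' U (partial i f)
  else True.

Lemma Ck_cont k U f : Ck k U f -> forall x, U x -> {for x, continuous f}.
Proof. by case: k => [|k] []. Qed.

Lemma Ck_derivable k U f i x : Ck k.+1 U f -> U x -> derivable f x (delta_mx 0 i).
Proof. by move=> [_ /(_ i)[+ _]] => /(_ x). Qed.

Lemma Ck_partial k U f i : Ck k.+1 U f -> Ck k U (partial i f).
Proof. by move=> [_ /(_ i)[]]. Qed.

Lemma Ck_le k l U f : (k <= l)%N -> Ck l U f -> Ck k U f.
Proof.
elim: k l f => [|k IH] l f kl H; first by split => //; exact: Ck_cont H.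
case: l kl H => // l kl H; split; first exact: Ck_cont H.
move=> i; split; first by move=> x; apply: Ck_derivable H.
by apply: (IH l) => //; apply: Ck_partial.
Qed.

(** All clauses of [Ck] are conditions at single points of U, so the
sets V are arbitrary. *)
Lemma Ck_local k U f :
  (forall x, U x -> exists2 V, V x & Ck k V f) -> Ck k U f.
Proof.
elim: k f => [|k IH] f H.
  by split => // x /H[V Vx /Ck_cont]; exact.
split; first by move=> x /H[V Vx /Ck_cont]; exact.
move=> i; split; first by move=> x /H[V Vx /Ck_derivable]; exact.
by apply: IH => x /H[V Vx VC]; exists V => //; exact: Ck_partial.
Qed.

Lemma Ck_sub k U V f : V `<=` U -> Ck k U f -> Ck k V f.
Proof. by move=> VU H; apply: Ck_local => x /VU Ux; exists U. Qed.

Lemma near_open_eq U f g x : open U -> U x -> (forall y, U y -> f y = g y) ->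
  {near x, f =1 g}.
Proof.
move=> oU Ux fg; near=> y; apply: fg; near: y.
exact: open_nbhs_nbhs.
Unshelve. all: by end_near. Qed.

Lemma derive_ext U f g x v : open U -> U x -> (forall y, U y -> f y = g y) ->
  'D_v f x = 'D_v g x.
Proof.
by move=> oU Ux fg; apply: near_eq_derive; apply: near_open_eq Ux fg.
Qed.

Lemma cont_ext U f g x : open U -> U x -> (forall y, U y -> f y = g y) ->
  {for x, continuous f} -> {for x, continuous g}.
Proof.
move=> oU Ux fg cf.
have cf' : f @ x --> g x by rewrite -(fg _ Ux); exact: cf.
apply: (cvg_trans _ cf'); apply: (@near_eq_cvg _ _ (nbhs x)).
exact: near_open_eq oU Ux fg.
Qed.

Lemma Ck_ext k U f g : open U -> (forall y, U y -> f y = g y) ->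
  Ck k U f -> Ck k U g.
Proof.
move=> oU; elim: k f g => [|k IH] f g fg H.
  by split=> // x Ux; apply: (cont_ext oU Ux fg); exact: Ck_cont H _ Ux.
split; first by move=> x Ux; apply: (cont_ext oU Ux fg); exact: Ck_cont H _ Ux.
move=> i; split.
  move=> x Ux; apply: (near_eq_derivable (near_open_eq oU Ux fg)).
  exact: Ck_derivable H Ux.
apply: (IH (partial i f)); last exact: Ck_partial.
by move=> y Uy; apply: derive_ext oU Uy fg.
Qed.

(** Partial derivatives are usually computed on U only, whereas
[partial i f] is a function on the whole space. *)
Lemma Ck_intro k U f (df : 'I_n -> 'rV[R]_n -> R) : open U ->
  (forall x, U x -> {for x, continuous f}) ->
  (forall i x, U x -> is_derive x (delta_mx 0 i) f (df i x)) ->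
  (forall i, Ck k U (df i)) -> Ck k.+1 U f.
Proof.
move=> oU cf dfE dfC; split => // i; split; first by move=> x /(dfE i)[].
apply: (Ck_ext oU _ (dfC i)) => x Ux.
by have [_ <-] := dfE i x Ux.
Qed.

Lemma smooth_onP U f : smooth_on U f <-> forall k, Ck k U f.
Proof.
split.
  move=> sf k; elim: k f sf => [|k IH] f sf.
    by split => // x Ux; have [+ _] := sf [::] x Ux.
  split; first by move=> x Ux; have [+ _] := sf [::] x Ux.
  move=> i; split; first by move=> x Ux; have [_ +] := sf [::] x Ux.
  apply: IH => s x Ux; have := sf (rcons s i) x Ux.
  by rewrite /iter_partial foldr_rcons.
move=> H s; elim/last_ind: s f H => [|s i IH] f H x Ux.
  split; first exact: (Ck_cont (H 0%N)).
  by move=> i; apply: Ck_derivable (H 1%N) Ux.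
have := IH (partial i f) _ x Ux; rewrite /iter_partial foldr_rcons; apply.
by move=> k; apply: Ck_partial (H k.+1).
Qed.

Lemma C1_differentiable k U f x : open U -> Ck k.+1 U f -> U x ->
  differentiable f x /\ forall v, 'd f x v = \sum_i v 0 i * partial i f x.
Proof.
move=> oU H Ux; apply: differentiable_of_partials => i.
  near=> y; apply: (Ck_derivable H); near: y.
  exact: open_nbhs_nbhs.
by have := Ck_cont (Ck_partial i H) Ux.
Unshelve. all: by end_near. Qed.

Lemma Ck_differentiable k U f x : open U -> Ck k.+1 U f -> U x ->
  differentiable f x.
Proof.
move=> oU H Ux; apply: (proj1 (C1_differentiable oU H Ux)).
Qed.

Lemma Ck_derive k U f x v : open U -> Ck k.+1 U f -> U x ->
  'D_v f x = \sum_i v 0 i * partial i f x.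
Proof.
move=> oU H Ux; have [df dE] := C1_differentiable oU H Ux.
by rewrite deriveE// dE.
Qed.

Lemma Ck_is_derive k U f x i : Ck k.+1 U f -> U x ->
  is_derive x (delta_mx 0 i) f (partial i f x).
Proof. by move=> H Ux; apply: derivableP; apply: Ck_derivable H Ux. Qed.

Lemma Ck_cst k U c : Ck k U (fun=> c).
Proof.
elim: k c => [|k IH] c; first by split => // x _; exact: cst_continuous.
split; first by move=> x _; exact: cst_continuous.
move=> i; split; first by move=> x _; exact: derivable_cst.
rewrite (_ : partial i _ = fun=> 0)//; apply/funext => x.
exact: derive_cst.
Qed.

Lemma Ck_coord k U i0 i : open U -> Ck k U (fun x => x i0 i).
Proof.
move=> oU; have cf x : U x -> {for x, continuous (fun x : 'rV[R]_n => x i0 i)}.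
  by move=> _; exact: coord_continuous.
case: k => [|k]; first by split.
apply: (Ck_intro (df := fun j _ => (delta_mx 0 j : 'rV[R]_n) i0 i)) => //; last first.
  by move=> j; exact: Ck_cst.
move=> j x Ux; rewrite ord1.
pose c : 'cV[R]_n := delta_mx i 0.
have E (y : 'rV[R]_n) : y 0 i = dotrow c y.
  rewrite /dotrow mxE (bigD1 i)//= big1 ?addr0; first by rewrite mxE !eqxx mulr1.
  by move=> l li; rewrite mxE (negPf li) mulr0.
rewrite [X in is_derive _ _ X](_ : _ = dotrow c); last by apply/funext => y; rewrite E.
have dc : differentiable (dotrow c) x by apply: linear_differentiable; exact: dotrow_continuous.
split; first exact: diff_derivable.
by rewrite deriveE// diff_lin ?E//; exact: dotrow_continuous.
Qed.

Lemma Ck_add k U f g : open U -> Ck k U f -> Ck k U g ->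
  Ck k U (fun x => f x + g x).
Proof.
move=> oU; elim: k f g => [|k IH] f g Hf Hg.
  by split=> // x Ux; apply: continuousD; [exact: Ck_cont Hf _ Ux|exact: Ck_cont Hg _ Ux].
apply: (Ck_intro (df := fun i x => partial i f x + partial i g x)) => //.
- by move=> x Ux; apply: continuousD; [exact: Ck_cont Hf _ Ux|exact: Ck_cont Hg _ Ux].
- move=> i x Ux.
  by apply: is_deriveD; [exact: Ck_is_derive Hf Ux|exact: Ck_is_derive Hg Ux].
- by move=> i; apply: IH; exact: Ck_partial.
Qed.

Lemma Ck_mul k U f g : open U -> Ck k U f -> Ck k U g ->
  Ck k U (fun x => f x * g x).
Proof.
move=> oU; elim: k f g => [|k IH] f g Hf Hg.
  by split=> // x Ux; apply: continuousM; [exact: Ck_cont Hf _ Ux|exact: Ck_cont Hg _ Ux].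
apply: (Ck_intro (df := fun i x => f x * partial i g x + g x * partial i f x)) => //.
- by move=> x Ux; apply: continuousM; [exact: Ck_cont Hf _ Ux|exact: Ck_cont Hg _ Ux].
- move=> i x Ux.
  by apply: is_deriveM; [exact: Ck_is_derive Hf Ux|exact: Ck_is_derive Hg Ux].
- move=> i; have Hf' := Ck_le (leqnSn _) Hf; have Hg' := Ck_le (leqnSn _) Hg.
  by apply: Ck_add => //; apply: IH => //; exact: Ck_partial.
Qed.

Lemma Ck_scale k U (c : R) f : open U -> Ck k U f -> Ck k U (fun x => c * f x).
Proof. by move=> oU Hf; apply: Ck_mul => //; exact: Ck_cst. Qed.

Lemma Ck_opp k U f : open U -> Ck k U f -> Ck k U (fun x => - f x).
Proof.
move=> oU Hf; have := Ck_scale (-1) oU Hf.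
by rewrite (_ : (fun x => _) = fun x => - f x)//; apply/funext => x; rewrite mulN1r.
Qed.

Lemma Ck_sub_fun k U f g : open U -> Ck k U f -> Ck k U g ->
  Ck k U (fun x => f x - g x).
Proof. by move=> oU Hf Hg; apply: Ck_add => //; apply: Ck_opp. Qed.

Lemma Ck_sum k U (I : Type) (r : seq I) (P : pred I) (F : I -> 'rV[R]_n -> R) : open U ->
  (forall i, Ck k U (F i)) -> Ck k U (fun x => \sum_(i <- r | P i) F i x).
Proof.
move=> oU H; elim: r => [|i r IH].
  rewrite (_ : (fun x => _) = fun=> 0); first exact: Ck_cst.
  by apply/funext => x; rewrite big_nil.
have [Pi|Pi] := boolP (P i).
  rewrite (_ : (fun x => _) = fun x => F i x + \sum_(j <- r | P j) F j x).
    by apply: Ck_add.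
  by apply/funext => x; rewrite big_cons Pi.
rewrite (_ : (fun x => _) = fun x => \sum_(j <- r | P j) F j x)//.
by apply/funext => x; rewrite big_cons (negPf Pi).
Qed.

Lemma Ck_prod k U (I : Type) (r : seq I) (P : pred I) (F : I -> 'rV[R]_n -> R) : open U ->
  (forall i, Ck k U (F i)) -> Ck k U (fun x => \prod_(i <- r | P i) F i x).
Proof.
move=> oU H; elim: r => [|i r IH].
  rewrite (_ : (fun x => _) = fun=> 1); first exact: Ck_cst.
  by apply/funext => x; rewrite big_nil.
have [Pi|Pi] := boolP (P i).
  rewrite (_ : (fun x => _) = fun x => F i x * \prod_(j <- r | P j) F j x).
    by apply: Ck_mul.
  by apply/funext => x; rewrite big_cons Pi.
rewrite (_ : (fun x => _) = fun x => \prod_(j <- r | P j) F j x)//.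
by apply/funext => x; rewrite big_cons (negPf Pi).
Qed.

Lemma Ck_inv k U f : open U -> (forall x, U x -> f x != 0) -> Ck k U f ->
  Ck k U (fun x => (f x)^-1).
Proof.
move=> oU f0; elim: k => [|k IH] Hf.
  by split=> // x Ux; apply: continuousV; [exact: f0|exact: Ck_cont Hf _ Ux].
have Hf' := Ck_le (leqnSn _) Hf.
apply: (Ck_intro (df := fun i x => - ((f x)^-1 * (f x)^-1 * partial i f x))) => //.
- by move=> x Ux; apply: continuousV; [exact: f0|exact: Ck_cont Hf _ Ux].
- move=> i x Ux; have [d1 d2] := Ck_is_derive i Hf Ux.
  split; first exact: (derivableV (f0 _ Ux)).
  by rewrite (deriveV (f0 _ Ux))// d2 expr2 invfM scaleNr.
- move=> i; apply: Ck_opp => //; apply: Ck_mul => //; last exact: Ck_partial.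
  by apply: Ck_mul => //; apply: IH.
Qed.

End Ck.

(** * Composition and symmetry of second derivatives *)

Section Comp.
Variable R : realType.

Lemma cvg_mx (T : Type) (G : set_system T) {FF : Filter G} m n
    (F : T -> 'M[R]_(m, n)) (A : 'M[R]_(m, n)) :
  (forall i j, F x i j @[x --> G] --> A i j) -> F @ G --> A.
Proof.
move=> H P [Q HQ QP].
have : \forall x \near G, forall ij : 'I_m * 'I_n, Q ij.1 ij.2 (F x ij.1 ij.2).
  apply: filter_forall => -[i j] /=; exact: (H i j _ (HQ i j)).
apply: filterS => x Hx; apply: QP => i j; exact: (Hx (i, j)).
Qed.

(** Through the expansion of F y in the canonical basis. *)
Lemma differentiable_rV n m (F : 'rV[R]_n -> 'rV[R]_m) x :
  (forall j, differentiable (fun y => F y 0 j) x) -> differentiable F x.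
Proof.
move=> H.
rewrite (_ : F = \sum_(j < m) (fun y => F y 0 j *: (delta_mx 0 j : 'rV[R]_m))).
  by apply: differentiable_sum => j; apply: differentiableZl; exact: H.
apply/funext => y; rewrite fct_sumE [LHS]row_sum_delta.
by apply: eq_bigr.
Qed.

Lemma derive_comp (U V W : normedModType R) (F : U -> V) (f : V -> W) (x v : U) :
  differentiable F x -> differentiable f (F x) ->
  'D_v (f \o F) x = 'D_('D_v F x) f (F x).
Proof.
move=> dF df; rewrite !deriveE//; last exact: differentiable_comp.
by rewrite diff_comp.
Qed.

(** By induction on k: the chain rule writes the partial derivatives of
the composite as sums of products of functions of class C^k. *)
Lemma Ck_comp n m k (U : set 'rV[R]_n) (V : set 'rV[R]_m) f F :
  open U -> open V -> (forall x, U x -> V (F x)) ->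
  Ck k V f -> (forall j, Ck k U (fun x => F x 0 j)) ->
  Ck k U (fun x => f (F x)).
Proof.
move=> oU oV UV.
have cc l (g : 'rV[R]_m -> R) : Ck l V g -> (forall j, Ck l U (fun x => F x 0 j)) ->
  forall x, U x -> {for x, continuous (fun x => g (F x))}.
  move=> Hg HF x Ux; apply: (@continuous_comp _ _ _ F g).
    apply: (@cvg_mx _ (nbhs x)) => i j; rewrite ord1; exact: Ck_cont (HF j) x Ux.
  exact: Ck_cont Hg _ (UV _ Ux).
elim: k f => [|k IH] f Hf HF; first by split => //; exact: cc Hf HF.
apply: (@Ck_intro _ _ _ _ _ (fun i x => \sum_j partial j f (F x) * partial i (fun x => F x 0 j) x)) => //.
- exact: cc Hf HF.
- move=> i x Ux.
  have dFj j : differentiable (fun y => F y 0 j) x := Ck_differentiable oU (HF j) Ux.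
  have dF := differentiable_rV dFj.
  have df := Ck_differentiable oV Hf (UV _ Ux).
  split; first by apply: diff_derivable; apply: differentiable_comp.
  rewrite derive_comp// (Ck_derive _ oV Hf (UV _ Ux)).
  apply: eq_bigr => j _; rewrite mulrC; congr (_ * _).
  by rewrite derive_mx ?mxE//; apply: diff_derivable.
- move=> i; apply: Ck_sum => // j; apply: Ck_mul => //; last exact: Ck_partial.
  by apply: IH => [|j']; [exact: Ck_partial|exact: Ck_le (leqnSn _) (HF j')].
Qed.

End Comp.

Section Schwarz.
Variables (R : realType) (n : nat).

(** Both segments share the parameter t: this is the mean value theorem
for the difference of the restrictions of f, as needed for two opposite sides of
a square. *)
Lemma line_mvt_diff (V : normedModType R) (f : V -> R) (a b v : V) :
  (forall t : R, 0 <= t <= 1 -> derivable f (t *: v + a) v) ->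
  (forall t : R, 0 <= t <= 1 -> derivable f (t *: v + b) v) ->
  exists2 t : R, 0 <= t <= 1 & (f (v + a) - f (v + b)) - (f a - f b) =
     'D_v f (t *: v + a) - 'D_v f (t *: v + b).
Proof.
move=> da db; pose g := (fun u : R => f (u *: v + a)) - (fun u : R => f (u *: v + b)).
have dg (t : R) : 0 <= t <= 1 -> is_derive t 1 g ('D_v f (t *: v + a) - 'D_v f (t *: v + b)).
  by move=> t01; apply: is_deriveB; apply: is_derive_line; [exact: da|exact: db].
have [|||c c01] := @MVT_segment R g (fun t => 'D_v f (t *: v + a) - 'D_v f (t *: v + b)) 0 1.
- exact: ler01.
- move=> t; rewrite in_itv/= => /andP[t0 t1]; apply: dg; by rewrite !ltW.
- apply: derivable_within_continuous => t; rewrite in_itv/= => t01.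
  by have [] := dg t t01.
have gE u : g u = f (u *: v + a) - f (u *: v + b) by [].
by rewrite !gE !scale1r !scale0r !add0r subr0 mulr1 => ->; exists c => //.
Qed.

(** The mean value theorem is applied in direction i to a pair of
opposite sides of the square, and then in direction j. *)
Lemma second_difference (U : set 'rV[R]_n) f (x : 'rV[R]_n) (r s : R) i j :
  Ck 2 U f -> ball x r `<=` U -> 0 < s -> s + s < r ->
  exists2 xi, ball x r xi &
   (f (s *: delta_mx 0 i + (s *: delta_mx 0 j + x)) - f (s *: delta_mx 0 i + x))
   - (f (s *: delta_mx 0 j + x) - f x) = s * s * partial j (partial i f) xi.
Proof.
move=> Hf BU s0 sr; set ei := delta_mx 0 i; set ej := delta_mx 0 j.
have nd (k : 'I_n) : `|delta_mx 0 k : 'rV[R]_n| <= 1.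
  apply: mx_norm_le => // a b; rewrite mxE.
  by case: (_ && _); rewrite /= ?normr1 ?normr0.
have inb (t u : R) : 0 <= t <= 1 -> 0 <= u <= 1 ->
    ball x r (t *: (s *: ei) + (u *: (s *: ej) + x)).
  move=> /andP[t0 t1] /andP[u0 u1].
  rewrite -ball_normE /= distrC addrA addrK; apply: le_lt_trans sr.
  have hh (w : R) (k : 'I_n) : 0 <= w -> w <= 1 -> `|w *: (s *: (delta_mx 0 k : 'rV[R]_n))| <= s.
    move=> w0 w1; rewrite !normrZ (ger0_norm w0) (gtr0_norm s0).
    rewrite -[leRHS]mul1r ler_pM ?mulr_ge0 ?(ltW s0)//.
    by rewrite -[leRHS]mulr1 ler_pM ?(ltW s0).
  by apply: le_trans (ler_normD _ _) _; rewrite lerD ?hh.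
have i01 : 0 <= (1 : R) <= 1 by rewrite ler01 lexx.
have i00 : 0 <= (0 : R) <= 1 by rewrite ler01 lexx.
have dd (g : 'rV[R]_n -> R) (k : 'I_n) (y : 'rV[R]_n) : Ck 1 U g -> ball x r y ->
    is_derive y (s *: delta_mx 0 k) g (s * partial k g y).
  by move=> Hg /BU Uy; apply: is_derive_scale; apply: Ck_derivable Hg Uy.
have Hf1 : Ck 1 U f := Ck_le (leqnSn _) Hf.
have Hfi : Ck 1 U (partial i f) := Ck_partial i Hf.
have [t t01|t t01|t t01 ->] := @line_mvt_diff _ f (s *: ej + x) x (s *: ei).
- have [+ _] := dd f i (t *: (s *: ei) + (1 *: (s *: ej) + x)) Hf1 (inb _ _ t01 i01).
  by rewrite scale1r.
- have [+ _] := dd f i (t *: (s *: ei) + (0 *: (s *: ej) + x)) Hf1 (inb _ _ t01 i00).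
  by rewrite scale0r add0r.
have B1 := inb _ _ t01 i01; have B0 := inb _ _ t01 i00.
rewrite scale1r in B1; rewrite scale0r add0r in B0.
have [_ ->] := dd f i _ Hf1 B1; have [_ ->] := dd f i _ Hf1 B0.
rewrite -mulrBr addrCA.
have [u u01|u u01 ->] := @line_mvt _ _ (partial i f) (t *: (s *: ei) + x) (s *: ej).
  by rewrite addrCA; have [] := dd (partial i f) j _ Hfi (inb _ _ t01 u01).
exists (u *: (s *: ej) + (t *: (s *: ei) + x)); first by rewrite addrCA; exact: inb.
have B := inb _ _ t01 u01; rewrite addrCA in B.
by have [_ ->] := dd (partial i f) j _ Hfi B; rewrite mulrA.
Qed.

(** The second difference over a square of side s is symmetric in i and
j; it equals s * s times either mixed derivative at some point of the square, and
both are continuous at x. *)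
Lemma partial_comm (U : set 'rV[R]_n) f x i j : open U -> Ck 2 U f -> U x ->
  partial i (partial j f) x = partial j (partial i f) x.
Proof.
move=> oU Hf Ux.
apply/eqP; rewrite -subr_eq0 -normr_le0; apply/ler_addgt0Pr => e e0.
rewrite add0r.
pose e2 := e / 2.
have e20 : 0 < e2 by rewrite divr_gt0.
have cA := Ck_cont (Ck_partial j (Ck_partial i Hf)) Ux.
have cB := Ck_cont (Ck_partial i (Ck_partial j Hf)) Ux.
have SA := second_difference i j Hf; have SB := second_difference j i Hf.
move: (partial j (partial i f)) (partial i (partial j f)) cA cB SA SB => A B cA cB SA SB.
have : \forall y \near x, [/\ U y, `|A x - A y| <= e2 & `|B x - B y| <= e2].
  have nA : \forall y \near x, `|A x - A y| <= e2.
    by move/cvgrPdist_le : cA => /(_ _ e20).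
  have nB : \forall y \near x, `|B x - B y| <= e2.
    by move/cvgrPdist_le : cB => /(_ _ e20).
  have nU : \forall y \near x, U y by exact: open_nbhs_nbhs.
  by apply: filterS3 nA nB nU => y *; split.
case/nbhs_ballP => r /= r0 H.
pose s := r / 3.
have s0 : 0 < s by rewrite divr_gt0.
have sr : s + s < r by rewrite /s; lra.
have BU : ball x r `<=` U by move=> y /H[].
have [xi Bxi E1] := SA _ _ _ BU s0 sr; have [et Bet E2] := SB _ _ _ BU s0 sr.
have swap (a b c d : R) : a - b - (c - d) = a - c - (b - d) by ring.
have E : A xi = B et.
  apply: (@mulfI _ (s * s)); first by rewrite mulf_neq0// gt_eqF.
  by rewrite -E1 -E2 [s *: delta_mx 0 i + (_ + _)]addrCA swap.
have [_ h1 _] := H _ Bxi; have [_ _ h2] := H _ Bet.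
apply: (@le_trans _ _ (`|(B x - B et) - (A x - A xi)|)).
  by rewrite E swap subrr subr0.
by rewrite [e]splitr; apply: le_trans (ler_normB _ _) _; apply: lerD.
Qed.

End Schwarz.

(** * Matrix-valued functions *)

Section Ckm.
Variables (R : realType) (n : nat).
Implicit Types (U V : set 'rV[R]_n).

Definition Ckm k U p q (F : 'rV[R]_n -> 'M[R]_(p, q)) :=
  forall i j, Ck k U (fun x => F x i j).

Lemma smooth_mx_onP U p q (F : 'rV[R]_n -> 'M[R]_(p, q)) :
  smooth_mx_on U F <-> forall k, Ckm k U F.
Proof.
split=> [H k i j|H i j]; first exact: (smooth_onP _ _).1 (H i j) k.
by apply/smooth_onP => k; exact: H.
Qed.

Lemma Ckm_ext k U p q (F G : 'rV[R]_n -> 'M[R]_(p, q)) : open U ->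
  (forall x, U x -> F x = G x) -> Ckm k U F -> Ckm k U G.
Proof.
by move=> oU FG HF i j; apply: Ck_ext oU _ (HF i j) => x /FG ->.
Qed.

Lemma Ckm_sub k U V p q (F : 'rV[R]_n -> 'M[R]_(p, q)) : V `<=` U ->
  Ckm k U F -> Ckm k V F.
Proof. by move=> VU H i j; apply: Ck_sub VU (H i j). Qed.

Lemma Ckm_le k l U p q (F : 'rV[R]_n -> 'M[R]_(p, q)) : (k <= l)%N ->
  Ckm l U F -> Ckm k U F.
Proof. by move=> kl H i j; apply: Ck_le kl (H i j). Qed.

Lemma Ckm_local k U p q (F : 'rV[R]_n -> 'M[R]_(p, q)) :
  (forall x, U x -> exists2 V, V x & Ckm k V F) -> Ckm k U F.
Proof.
by move=> H i j; apply: Ck_local => x /H[V Vx HV]; exists V.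
Qed.

Lemma Ckm_cst k U p q (A : 'M[R]_(p, q)) : Ckm k U (fun=> A).
Proof. by move=> i j; exact: Ck_cst. Qed.

Lemma Ckm_add k U p q (F G : 'rV[R]_n -> 'M[R]_(p, q)) : open U ->
  Ckm k U F -> Ckm k U G -> Ckm k U (fun x => F x + G x).
Proof.
move=> oU HF HG i j.
apply: (Ck_ext oU _ (Ck_add oU (HF i j) (HG i j))) => x _; by rewrite mxE.
Qed.

Lemma Ckm_opp k U p q (F : 'rV[R]_n -> 'M[R]_(p, q)) : open U ->
  Ckm k U F -> Ckm k U (fun x => - F x).
Proof.
move=> oU HF i j.
apply: (Ck_ext oU _ (Ck_opp oU (HF i j))) => x _; by rewrite mxE.
Qed.

Lemma Ckm_subf k U p q (F G : 'rV[R]_n -> 'M[R]_(p, q)) : open U ->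
  Ckm k U F -> Ckm k U G -> Ckm k U (fun x => F x - G x).
Proof. by move=> oU HF HG; apply: Ckm_add => //; apply: Ckm_opp. Qed.

Lemma Ckm_tr k U p q (F : 'rV[R]_n -> 'M[R]_(p, q)) : open U ->
  Ckm k U F -> Ckm k U (fun x => (F x)^T).
Proof.
by move=> oU HF i j; apply: (Ck_ext oU _ (HF j i)) => x _; rewrite mxE.
Qed.

Lemma Ckm_scale k U p q f (F : 'rV[R]_n -> 'M[R]_(p, q)) : open U ->
  Ck k U f -> Ckm k U F -> Ckm k U (fun x => f x *: F x).
Proof.
move=> oU Hf HF i j.
apply: (Ck_ext oU _ (Ck_mul oU Hf (HF i j))) => x _; by rewrite mxE.
Qed.

Lemma Ckm_mul k U p q r (F : 'rV[R]_n -> 'M[R]_(p, q)) (G : 'rV[R]_n -> 'M[R]_(q, r)) :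
  open U -> Ckm k U F -> Ckm k U G -> Ckm k U (fun x => F x *m G x).
Proof.
move=> oU HF HG i j.
apply: (@Ck_ext _ _ _ _ (fun x => \sum_l F x i l * G x l j)) => //.
  by move=> x _; rewrite mxE.
by apply: Ck_sum => // l; apply: Ck_mul.
Qed.

Lemma Ckm_sum k U p q (I : Type) (r : seq I) (P : pred I)
   (F : I -> 'rV[R]_n -> 'M[R]_(p, q)) : open U ->
  (forall l, Ckm k U (F l)) -> Ckm k U (fun x => \sum_(l <- r | P l) F l x).
Proof.
move=> oU HF i j.
apply: (@Ck_ext _ _ _ _ (fun x => \sum_(l <- r | P l) F l x i j)) => //.
  by move=> x _; rewrite summxE.
by apply: Ck_sum => // l; apply: HF.
Qed.

Lemma Ck_det k U p (F : 'rV[R]_n -> 'M[R]_p) : open U ->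
  Ckm k U F -> Ck k U (fun x => \det (F x)).
Proof.
move=> oU HF; rewrite /determinant; apply: Ck_sum => // s.
by apply: Ck_scale => //; apply: Ck_prod => // i; exact: HF.
Qed.

Lemma Ckm_inv k U p (F : 'rV[R]_n -> 'M[R]_p) : open U ->
  (forall x, U x -> F x \in unitmx) ->
  Ckm k U F -> Ckm k U (fun x => invmx (F x)).
Proof.
move=> oU uF HF i j.
apply: (@Ck_ext _ _ _ _ (fun x => (\det (F x))^-1 *
   ((-1) ^+ (j + i) * \det (row' j (col' i (F x)))))) => //.
  by move=> x /uF; rewrite /invmx => ->; rewrite !mxE.
apply: Ck_mul => //.
  apply: Ck_inv => //; last exact: Ck_det.
  by move=> x /uF; rewrite unitmxE unitfE.
apply: Ck_scale => //; apply: Ck_det => // a b.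
by apply: Ck_ext oU _ (HF (lift j a) (lift i b)) => x _; rewrite !mxE.
Qed.

Lemma Ckm_differentiable k U m (F : 'rV[R]_n -> 'rV[R]_m) x : open U -> Ckm k.+1 U F ->
  U x -> differentiable F x.
Proof.
move=> oU HF Ux; apply: differentiable_rV => j.
exact: Ck_differentiable oU (HF 0 j) Ux.
Qed.

Lemma jacobianE k U m (F : 'rV[R]_n -> 'rV[R]_m) x i j : open U -> Ckm k.+1 U F ->
  U x -> ('J F x) i j = partial i (fun y => F y 0 j) x.
Proof.
move=> oU HF Ux; have dF := Ckm_differentiable oU HF Ux.
have := deriveEjacobian (delta_mx 0 i) dF; rewrite -rowE => /(congr1 (fun M : 'rV[R]_m => M 0 j)).
rewrite [in RHS]mxE => <-.
by rewrite derive_mx ?mxE//; apply: diff_derivable.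
Qed.

Lemma Ckm_jacobian k U m (F : 'rV[R]_n -> 'rV[R]_m) : open U -> Ckm k.+1 U F ->
  Ckm k U (fun x => 'J F x).
Proof.
move=> oU HF i j; apply: (Ck_ext oU _ (Ck_partial i (HF 0 j))) => x Ux.
by rewrite (jacobianE i j oU HF Ux).
Qed.

Lemma derive_mxE k U p q (F : 'rV[R]_n -> 'M[R]_(p, q)) x v : open U ->
  Ckm k.+1 U F -> U x -> is_derive x v F (\matrix_(i, j) 'D_v (fun y => F y i j) x).
Proof.
move=> oU HF Ux.
have dF : derivable F x v.
  by apply/derivable_mxP => i j; apply: diff_derivable; exact: Ck_differentiable oU (HF i j) Ux.
by split => //; rewrite derive_mx.
Qed.

Lemma derive_mx_sum k U p q (F : 'rV[R]_n -> 'M[R]_(p, q)) x v : open U ->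
  Ckm k.+1 U F -> U x -> 'D_v F x = \sum_i v 0 i *: 'D_(delta_mx 0 i) F x.
Proof.
move=> oU HF Ux; have [_ ->] := derive_mxE v oU HF Ux.
apply/matrixP => a b; rewrite mxE summxE (Ck_derive _ oU (HF a b) Ux).
apply: eq_bigr => i _; have [_ ->] := derive_mxE (delta_mx 0 i) oU HF Ux.
by rewrite !mxE.
Qed.

Lemma Ckm_derive k U p q (F : 'rV[R]_n -> 'M[R]_(p, q)) (X : 'rV[R]_n -> 'rV[R]_n) :
  open U -> Ckm k.+1 U F -> Ckm k U X -> Ckm k U (fun x => 'D_(X x) F x).
Proof.
move=> oU HF HX.
apply: (@Ckm_ext _ _ _ _ (fun x => \sum_i X x 0 i *: (\matrix_(a, b) partial i (fun y => F y a b) x))) => //.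
  move=> x Ux; rewrite (derive_mx_sum _ oU HF Ux); apply: eq_bigr => i _.
  by have [_ ->] := derive_mxE (delta_mx 0 i) oU HF Ux.
apply: Ckm_sum => // i; apply: Ckm_scale => // a b.
by apply: (Ck_ext oU _ (Ck_partial i (HF a b))) => x _; rewrite mxE.
Qed.

Lemma derive_mulmx k U p q r (F : 'rV[R]_n -> 'M[R]_(p, q)) (G : 'rV[R]_n -> 'M[R]_(q, r)) x v :
  open U -> Ckm k.+1 U F -> Ckm k.+1 U G -> U x ->
  'D_v (fun y => F y *m G y) x = 'D_v F x *m G x + F x *m 'D_v G x.
Proof.
move=> oU HF HG Ux.
have [_ ->] := derive_mxE v oU (Ckm_mul oU HF HG) Ux.
have [_ ->] := derive_mxE v oU HF Ux; have [_ ->] := derive_mxE v oU HG Ux.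
apply/matrixP => a b; rewrite !mxE -big_split /=.
have dF l : derivable (fun y => F y a l) x v.
  by apply: diff_derivable; exact: Ck_differentiable oU (HF _ _) Ux.
have dG l : derivable (fun y => G y l b) x v.
  by apply: diff_derivable; exact: Ck_differentiable oU (HG _ _) Ux.
rewrite (_ : (fun y => _) = \sum_(l < q) (fun y => F y a l * G y l b)); last first.
  by apply/funext => y; rewrite fct_sumE mxE.
rewrite derive_sum; last by move=> l; apply: derivableM.
apply: eq_bigr => l _; rewrite deriveM// !mxE /= addrC; congr (_ + _).
by rewrite [LHS]mulrC.
Qed.

Lemma derive_lin k U p q (F : 'rV[R]_n -> 'M[R]_(p, q)) x (c : R) (u v : 'rV[R]_n) : open U ->
  Ckm k.+1 U F -> U x -> 'D_(c *: u + v) F x = c *: 'D_u F x + 'D_v F x.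
Proof.
move=> oU HF Ux; rewrite !(derive_mx_sum _ oU HF Ux) scaler_sumr -big_split /=.
by apply: eq_bigr => i _; rewrite !mxE scalerDl scalerA.
Qed.

Lemma derive_scalemx k U p q f (F : 'rV[R]_n -> 'M[R]_(p, q)) x v : open U ->
  Ck k.+1 U f -> Ckm k.+1 U F -> U x ->
  'D_v (fun y => f y *: F y) x = 'D_v f x *: F x + f x *: 'D_v F x.
Proof.
move=> oU Hf HF Ux.
have [_ ->] := derive_mxE v oU (Ckm_scale oU Hf HF) Ux.
have [_ ->] := derive_mxE v oU HF Ux.
apply/matrixP => a b; rewrite !mxE.
have dF : derivable (fun y => F y a b) x v.
  by apply: diff_derivable; exact: Ck_differentiable oU (HF _ _) Ux.
have df : derivable f x v.
  by apply: diff_derivable; exact: Ck_differentiable oU Hf Ux.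
rewrite (_ : (fun y => _) = f * (fun y => F y a b)); last first.
  by apply/funext => y; rewrite mxE.
by rewrite deriveM//= addrC; congr (_ + _); exact: mulrC.
Qed.

Lemma derive_trmx k U p q (F : 'rV[R]_n -> 'M[R]_(p, q)) x v : open U ->
  Ckm k.+1 U F -> U x -> 'D_v (fun y => (F y)^T) x = ('D_v F x)^T.
Proof.
move=> oU HF Ux.
have [_ ->] := derive_mxE v oU (Ckm_tr oU HF) Ux.
have [_ ->] := derive_mxE v oU HF Ux.
apply/matrixP => a b; rewrite !mxE.
by congr ('D_v _ x); apply/funext => y; rewrite mxE.
Qed.

End Ckm.

Lemma Ckm_comp (R : realType) n k m (U : set 'rV[R]_n) (V : set 'rV[R]_m) p q (G : 'rV[R]_m -> 'M[R]_(p, q)) F :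
  open U -> open V -> (forall x, U x -> V (F x)) ->
  Ckm k V G -> Ckm k U F -> Ckm k U (fun x => G (F x)).
Proof.
move=> oU oV UV HG HF i j.
by apply: (Ck_comp oU oV UV (HG i j)) => l; exact: HF.
Qed.

(** * The flat function exp(-1/t) *)

Section Flat.
Variable R : realType.
Implicit Types (t : R) (m : nat).

(** The functions t^-m exp(-1/t), extended by 0. The derivative of each
is a combination of two others ([is_derive_flat]), which is why all m are needed
to see that [flat 0] is smooth. *)
Definition flat m t : R := if 0 < t then (t^-1) ^+ m * expR (- t^-1) else 0.

Lemma flat_gt0 t : (0 < flat 0 t) = (0 < t).
Proof. by rewrite /flat; case: ifP; rewrite ?ltxx// expr0 mul1r expR_gt0. Qed.

Lemma flat_ge0 t : 0 <= flat 0 t.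
Proof. by rewrite /flat; case: ifP => // _; rewrite expr0 mul1r expR_ge0. Qed.

Lemma flat_le0 m t : t <= 0 -> flat m t = 0.
Proof. by rewrite /flat; case: ltP. Qed.

(** With s = 1/t this is s^(m+1) / (m+1)! <= exp s. Applied to m+1, it
gives the vanishing of the difference quotient of [flat m] at 0. *)
Lemma flat_bound m t : 0 < t -> `|flat m t| <= m.+1`!%:R * t.
Proof.
move=> t0; rewrite /flat t0; set s := t^-1.
have s0 : 0 < s by rewrite invr_gt0.
have nn : 0 <= s ^+ m * expR (- s) by rewrite mulr_ge0 ?exprn_ge0 ?expR_ge0 ?(ltW s0).
rewrite (ger0_norm nn) expRN ler_pdivrMr ?expR_gt0//.
have H := expR_ge1Dxn m (ltW s0).
have {}H : s ^+ m.+1 / m.+1`!%:R <= expR s by apply: le_trans H; rewrite lerDr.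
have f0 : 0 < m.+1`!%:R :> R by rewrite ltr0n fact_gt0.
rewrite ler_pdivrMr// in H.
have -> : s ^+ m = s ^+ m.+1 * t by rewrite exprSr -mulrA mulVf ?mulr1// gt_eqF.
by rewrite mulrAC ler_pM2r// [leRHS]mulrC.
Qed.

Lemma is_derive_flat m t : is_derive t 1 (flat m) (flat m.+2 t - m%:R * flat m.+1 t).
Proof.
have [t0|t0|t0] := ltgtP t 0.
- rewrite !(flat_le0 _ (ltW t0)) mulr0 subrr.
  apply: (@near_eq_is_derive _ _ _ (cst 0)).
  near=> u; rewrite flat_le0//.
  by apply: ltW; near: u; exact: lt_nbhsl.
- have t0' : t != 0 by rewrite gt_eqF.
  have dV : is_derive t 1 (fun u : R => u^-1) (- (t^-1 ^+ 2)).
    have [d1 d2] := is_derive_id t (1 : R).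
    split; first exact: (derivableV t0' d1).
    by rewrite (deriveV t0' d1) d2 exprVn; exact: mulr1.
  have dP := is_deriveX m dV.
  have dN := is_deriveN dV.
  have dE := @is_derive1_comp R expR (- (fun u : R => u^-1)) t _ _ (is_derive_expR (- t^-1)) dN.
  apply: near_eq_is_derive (is_derive_eq (is_deriveM dP dE) _).
    near=> u; rewrite /flat ifT; last by near: u; exact: lt_nbhsr.
    congr (_ * _); elim: (m) => // k IH.
    by rewrite [RHS]exprS -IH exprS.
  rewrite /flat t0 /=.
  rewrite opprK /GRing.scale /=; case: m {dP} => [|m].
    by rewrite !expr0 !mul0r mul1r mulr0 addr0 subr0 mulrC.
  rewrite [((fun _ => _) ^+ _) _]/=.
  have -> : ((fun u : R => u^-1) ^+ m.+1) t = t^-1 ^+ m.+1.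
    by elim: (m.+1) => //= k IH; rewrite exprS [RHS]exprS -IH.
  by rewrite !exprS; ring.
- subst t; rewrite !(flat_le0 _ (lexx 0)) mulr0 subrr.
  have H : (fun h : R => h^-1 *: ((flat m \o shift 0) (h *: 1) - flat m 0)) @ 0^' --> (0 : R).
    apply/cvgrPdist_le => e e0.
    pose C : R := m.+2`!%:R.
    have C0 : 0 < C by rewrite ltr0n fact_gt0.
    near=> h.
    have h0 : h != 0 by near: h; exact: nbhs_dnbhs_neq.
    rewrite sub0r normrN /= addr0 [h *: 1]mulr1 (flat_le0 _ (lexx 0)) subr0.
    have [hp|hn] := ltP 0 h; last by rewrite flat_le0// scaler0 normr0 ltW.
    have -> : h^-1 *: flat m h = flat m.+1 h.
      by rewrite /flat hp /GRing.scale /= mulrA -exprS.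
    apply: le_trans (flat_bound _ hp) _.
    rewrite -ler_pdivlMl// -(gtr0_norm hp).
    near: h; apply: dnbhs0_le.
    by rewrite mulr_gt0// invr_gt0.
  by split; [apply/cvg_ex; exists 0|apply/cvg_lim].
Unshelve. all: by end_near.
Qed.

Lemma Ck_flat n k m (U : set 'rV[R]_n) f : open U -> Ck k U f ->
  Ck k U (fun x => flat m (f x)).
Proof.
move=> oU; elim: k m => [|k IH] m Hf.
  split => // x Ux; apply: (@continuous_comp _ _ _ f (flat m)).
    exact: Ck_cont Hf _ Ux.
  apply: differentiable_continuous; apply/derivable1_diffP.
  by have [] := is_derive_flat m (f x).
have Hf' := Ck_le (leqnSn _) Hf.
apply: (Ck_intro (df := fun i x => (flat m.+2 (f x) - m%:R * flat m.+1 (f x)) * partial i f x)) => //.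
- move=> x Ux; apply: (@continuous_comp _ _ _ f (flat m)).
    exact: Ck_cont Hf _ Ux.
  apply: differentiable_continuous; apply/derivable1_diffP.
  by have [] := is_derive_flat m (f x).
- move=> i x Ux; have [d1 d2] := is_derive_flat m (f x).
  have df := Ck_differentiable oU Hf Ux.
  have dg : differentiable (flat m) (f x) by apply/derivable1_diffP.
  split; first by apply: diff_derivable; apply: differentiable_comp.
  rewrite (derive_comp _ df dg) -d2 -[X in 'D_X _ _]mulr1.
  have := is_derive_scale ('D_(delta_mx 0 i) f x) d1.
  by case=> _ ->; rewrite mulrC.
- move=> i; apply: Ck_mul => //; last exact: Ck_partial.
  by apply: Ck_sub_fun => //; [exact: IH|apply: Ck_scale => //; exact: IH].
Qed.

End Flat.

(** * Positive definite matrices and their square roots *)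

Section QuadForm.
Variable R : realFieldType.

Definition qf n (A : 'M[R]_n) (v : 'rV[R]_n) : R := (v *m A *m v^T) 0 0.

Definition posdef n (A : 'M[R]_n) : Prop :=
  A^T = A /\ forall v, v != 0 -> 0 < qf A v.

Lemma qf0 n (A : 'M[R]_n) : qf A 0 = 0.
Proof. by rewrite /qf !mul0mx mxE. Qed.

Lemma posdef_ge0 n (A : 'M[R]_n) v : posdef A -> 0 <= qf A v.
Proof.
by move=> [_ H]; have [->|/H/ltW//] := eqVneq v 0; rewrite qf0.
Qed.

Lemma unitmx_of_inj n (A : 'M[R]_n) : (forall v : 'rV[R]_n, v *m A = 0 -> v = 0) ->
  A \in unitmx.
Proof.
move=> H; rewrite -row_free_unit -kermx_eq0; apply/eqP/row_matrixP => i.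
by rewrite row0; apply: H; rewrite -row_mul mulmx_ker row0.
Qed.

Lemma posdef_unit n (A : 'M[R]_n) : posdef A -> A \in unitmx.
Proof.
move=> [_ H]; apply: unitmx_of_inj => v vA; apply/eqP; apply: contraT => /H.
by rewrite /qf vA mul0mx mxE ltxx.
Qed.

Lemma qf_congr n m (T : 'M[R]_(n, m)) (A : 'M[R]_m) v :
  qf (T *m A *m T^T) v = qf A (v *m T).
Proof. by rewrite /qf trmx_mul !mulmxA. Qed.

Lemma qf_add n (A B : 'M[R]_n) v : qf (A + B) v = qf A v + qf B v.
Proof. by rewrite /qf mulmxDr mulmxDl mxE. Qed.

Lemma qf_rank1 n (a : 'cV[R]_n) v : qf (a *m a^T) v = ((v *m a) 0 0) ^+ 2.
Proof.
by rewrite /qf mulmxA -[_ *m a^T *m _]mulmxA -trmx_mul mxE big_ord1 [X in _ * X]mxE expr2.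
Qed.

Lemma posdef_congr n (T A : 'M[R]_n) : T \in unitmx -> posdef A ->
  posdef (T *m A *m T^T).
Proof.
move=> uT [sA pA]; split; first by rewrite !trmx_mul trmxK sA mulmxA.
move=> v v0; rewrite qf_congr; apply: pA; apply: contra_neq v0 => vT.
by rewrite -[v](mulmxK uT) vT mul0mx.
Qed.

Lemma posdef_inv n (A : 'M[R]_n) : posdef A -> posdef (invmx A).
Proof.
move=> pA; have uA := posdef_unit pA; have [sA _] := pA.
have -> : invmx A = invmx A *m A *m (invmx A)^T.
  by rewrite trmx_inv sA mulVmx// mul1mx.
by apply: posdef_congr => //; rewrite unitmx_inv.
Qed.

Lemma posdef_gram n (T : 'M[R]_n) : T \in unitmx -> posdef (T *m T^T).
Proof.
move=> uT; rewrite -[T in T *m _]mulmx1; apply: posdef_congr => //.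
split; first by rewrite trmx1.
move=> v v0; rewrite /qf mulmx1 mxE.
have nn i : true -> 0 <= v 0 i * v^T i 0 by rewrite mxE -expr2 sqr_ge0.
rewrite lt_neqAle sumr_ge0 ?andbT; last by move=> *; exact: nn.
rewrite eq_sym; apply: contra_neq v0 => /psumr_eq0P H.
apply/rowP => i; apply/eqP; have /eqP := H nn i isT.
by rewrite mxE mulf_eq0 orbb mxE.
Qed.

Lemma trace_qf n m (Z : 'M[R]_(m, n)) (A : 'M[R]_n) :
  \tr (Z *m A *m Z^T) = \sum_i qf A (row i Z).
Proof.
apply: eq_bigr => i _; rewrite /qf -row_mul tr_row !mxE.
by apply: eq_bigr => j _; rewrite !mxE.
Qed.

(** The trace of (P Z + Z Q) Z^T is the sum of two nonnegative terms,
the second of which is positive unless Z = 0. *)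
Lemma sylvester_inj n (P Q Z : 'M[R]_n) : posdef P -> posdef Q ->
  P *m Z + Z *m Q = 0 -> Z = 0.
Proof.
move=> pP pQ E.
have T0 : \tr (Z^T *m P *m Z^T^T) + \tr (Z *m Q *m Z^T) = 0.
  rewrite trmxK -mulmxA mxtrace_mulC -mxtraceD -mulmxDl.
  by rewrite E mul0mx mxtrace0.
have h1 : 0 <= \tr (Z^T *m P *m Z^T^T).
  by rewrite trace_qf sumr_ge0// => i _; exact: posdef_ge0.
have h2 : 0 <= \tr (Z *m Q *m Z^T).
  by rewrite trace_qf sumr_ge0// => i _; exact: posdef_ge0.
have /eqP : \tr (Z *m Q *m Z^T) = 0 by clear E; apply/eqP; lra.
rewrite trace_qf psumr_eq0; last by move=> i _; exact: posdef_ge0.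
move/allP => H; apply/row_matrixP => i; rewrite row0.
apply/eqP; apply: contraT => /pQ.2; rewrite lt0r.
by have /= -> := H i (mem_index_enum _).
Qed.

(** If S S = T T then Z = S - T satisfies S Z + Z T = 0. *)
Lemma sqrt_uniq n (S T : 'M[R]_n) : posdef S -> posdef T ->
  S *m S = T *m T -> S = T.
Proof.
move=> pS pT E; apply: subr0_eq; apply: (sylvester_inj pS pT).
by rewrite mulmxBr mulmxBl E addrC subrKA subrr.
Qed.

End QuadForm.

Section SqrtExists.
Import complex spectral.
Variable R : rcfType.
Local Notation C := R[i].
Local Open Scope sesquilinear_scope.
Local Notation toC := (real_complex R).
Local Notation cx := (map_mx toC).

Lemma toC_real (x : R) : toC x \is Num.real.
Proof. by rewrite complex_real. Qed.

Lemma cx_conj m n (A : 'M[R]_(m, n)) : (cx A) ^t* = cx A^T.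
Proof. by apply/matrixP => i j; rewrite !mxE conj_Creal ?toC_real. Qed.

Lemma cx_decomp m n (Z : 'M[C]_(m, n)) : exists X Y, Z = cx X + 'i *: cx Y.
Proof.
exists (map_mx (fun z => complex.Re ('Re z)) Z), (map_mx (fun z => complex.Re ('Im z)) Z).
apply/matrixP => i j; rewrite !mxE {1}[Z i j]Crect.
by rewrite !RRe_real ?Creal_Re ?Creal_Im.
Qed.

Lemma cx_rect_inj m n (X Y X' Y' : 'M[R]_(m, n)) :
  cx X + 'i *: cx Y = cx X' + 'i *: cx Y' -> X = X' /\ Y = Y'.
Proof.
move=> /matrixP E.
have H i j : X i j = X' i j /\ Y i j = Y' i j.
  have := E i j; rewrite !mxE => e.
  have e1 := congr1 (fun z : C => 'Re z) e; have e2 := congr1 (fun z : C => 'Im z) e.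
  move: e1 e2; rewrite !Re_rect ?Im_rect ?toC_real//.
  by move=> /complexI-> /complexI->.
by split; apply/matrixP => i j; have [] := H i j.
Qed.

(** For z = x + i y, symmetry of A cancels the cross terms and leaves
qf A x + qf A y. *)
Lemma herm_qf_real n (A : 'M[R]_n) (z : 'rV[C]_n) : posdef A -> z != 0 ->
  0 < (z *m cx A *m z ^t*) 0 0.
Proof.
move=> pA; have [sA _] := pA; have [X [Y ->]] := cx_decomp z => z0.
have E : (cx X + 'i *: cx Y) *m cx A *m (cx X + 'i *: cx Y) ^t* =
   cx (X *m A *m X^T + Y *m A *m Y^T).
  have -> : (cx X + 'i *: cx Y) ^t* = cx X^T - 'i *: cx Y^T.
    by rewrite -!cx_conj; apply/matrixP => i j; rewrite !mxE rmorphD rmorphM /= conjCi mulNr.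
  rewrite !mulmxDl !mulmxBr -!scalemxAl -!scalemxAr scalerA mulCii scaleN1r.
  rewrite map_mxD !map_mxM opprK.
  have -> : cx X *m cx A *m cx Y^T = cx Y *m cx A *m cx X^T.
    rewrite -!map_mxM; congr map_mx.
    have -> : X *m A *m Y^T = (Y *m A *m X^T)^T by rewrite !trmx_mul trmxK sA mulmxA.
    by apply/matrixP => i j; rewrite !ord1 [LHS]mxE.
  by rewrite addrA subrK.
rewrite E mxE; rewrite -[0]/(toC 0) ltcR mxE.
have [X0|X0] := eqVneq X 0; last first.
  by rewrite ltr_wpDr ?(posdef_ge0 _ pA)//; apply: pA.2.
rewrite X0 !mul0mx mxE add0r; apply: pA.2; apply: contra_neq z0 => ->.
by rewrite X0 !map_mx0 scaler0 addr0.
Qed.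

Lemma diag_qf_pos n (D : 'rV[C]_n) (P : 'M[C]_n) (z : 'rV[C]_n) :
  P \is unitarymx -> (forall i, 0 < D 0 i) -> z != 0 ->
  0 < (z *m (P ^t* *m diag_mx D *m P) *m z ^t*) 0 0.
Proof.
move=> uP D0 z0; pose w := z *m P ^t*.
have w0 : w != 0.
  apply: contra_neq z0 => w0; have := mulmxKtV z uP erefl.
  by rewrite -/w w0 mul0mx => <-.
have -> : z *m (P ^t* *m diag_mx D *m P) *m z ^t* = w *m diag_mx D *m w ^t*.
  by rewrite /w trmx_mul map_mxM trmxCK !mulmxA.
have E : (w *m diag_mx D *m w ^t*) 0 0 = \sum_i D 0 i * `|w 0 i| ^+ 2.
  rewrite mxE; apply: eq_bigr => i _; rewrite mul_mx_diag !mxE normCK.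
  by rewrite mulrAC mulrC.
rewrite E.
have nn i : true -> 0 <= D 0 i * `|w 0 i| ^+ 2.
  by move=> _; rewrite mulr_ge0 ?exprn_ge0// ltW.
rewrite lt_neqAle sumr_ge0// andbT eq_sym.
apply: contra_neq w0 => /psumr_eq0P H.
apply/rowP => i; have /eqP := H nn i isT.
by rewrite mulf_eq0 (gt_eqF (D0 i)) /= expf_eq0 /= normr_eq0 => /eqP ->; rewrite mxE.
Qed.

(** The spectral theorem over R[i] provides a positive hermitian root,
X + i Y say. The imaginary part of its square is X Y + Y X = 0, and X is
positive definite, so Y = 0 by [sylvester_inj]. *)
Lemma posdef_sqrt n (A : 'M[R]_n) : posdef A -> exists2 S, posdef S & S *m S = A.
Proof.
move=> pA; have [sA _] := pA.
have hA : cx A \is hermsymmx.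
  apply/is_hermitianmxP; rewrite expr0 scale1r; have := cx_conj A.
  by rewrite sA => ->.
have /orthomx_spectralP := hermitian_normalmx hA.
set P := spectralmx _; set sp := spectral_diag _ => AE.
have uP : P \is unitarymx by exact: spectral_unitarymx.
have sp0 i : 0 < sp 0 i.
  have Pi0 : row i P != 0.
    apply/eqP => /(congr1 (fun M => M *m P ^t*)); rewrite -row_mul (unitarymxP uP) mul0mx.
    by move=> /rowP /(_ i) /eqP; rewrite !mxE eqxx oner_eq0.
  have := herm_qf_real pA Pi0; rewrite {1}AE (invmx_unitary uP).
  rewrite rowE trmx_mul map_mxM !mulmxA !(mulmxtVK _ uP) mxE (bigD1 i)//= big1 ?addr0.
    by rewrite mul_mx_diag !mxE !eqxx mul1r rmorph1 mulr1.
  by move=> j ji; rewrite mul_mx_diag !mxE eqxx (negPf ji) mul0r mul0r.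
pose D := map_mx sqrtC sp.
have D0 i : 0 < D 0 i by rewrite mxE sqrtC_gt0.
pose S := P ^t* *m diag_mx D *m P.
have SS : S *m S = cx A.
  rewrite AE (invmx_unitary uP) /S !mulmxA (mulmxtVK _ uP); congr (_ *m _).
  rewrite -mulmxA; congr (_ *m _); rewrite mulmx_diag; congr diag_mx.
  by apply/rowP => i; rewrite !mxE -expr2 sqrtCK.
have hS : S ^t* = S.
  rewrite /S !trmx_mul !map_mxM trmxCK tr_diag_mx mulmxA; congr (_ *m _ *m _).
  rewrite map_diag_mx; congr diag_mx; apply/rowP => i; rewrite [LHS]mxE.
  by have /ltW/ger0_real/conj_Creal := D0 i.
have [X [Y SE]] := cx_decomp S.
have [sX sY] : X^T = X /\ - Y^T = Y.
  apply: (@cx_rect_inj _ _ X^T (- Y^T)); rewrite -SE -hS SE.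
  apply/matrixP => i j; rewrite !mxE rmorphD rmorphM /= conjCi.
  by rewrite !conj_Creal ?toC_real// rmorphN mulrN mulNr.
have pX : posdef X.
  split => // v v0.
  have cv0 : cx v != 0 by rewrite map_mx_eq0.
  have := diag_qf_pos uP D0 cv0; rewrite -/S cx_conj SE mulmxDr mulmxDl.
  rewrite -scalemxAr -scalemxAl -!map_mxM mxE [X in _ + X]mxE.
  have -> : v *m Y *m v^T = 0.
    have E : v *m Y *m v^T = - (v *m Y *m v^T).
      rewrite -{1}sY mulmxN mulNmx; congr (- _).
      have -> : v *m Y^T *m v^T = (v *m Y *m v^T)^T by rewrite !trmx_mul trmxK mulmxA.
      by apply/matrixP => i j; rewrite !ord1 [LHS]mxE.
    by apply/matrixP => i j; move/matrixP : E => /(_ i j); rewrite !mxE; lra.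
  by rewrite map_mx0 [X in _ + _ * X]mxE mulr0 addr0 mxE -[0]/(toC 0) ltcR.
have [E1 E2] : X *m X - Y *m Y = A /\ X *m Y + Y *m X = 0.
  apply: cx_rect_inj; rewrite map_mx0 scaler0 addr0 -SS SE.
  rewrite mulmxDl !mulmxDr -!scalemxAl -!scalemxAr scalerA mulCii scaleN1r.
  rewrite map_mxB map_mxD !map_mxM scalerDr -!addrA; congr (_ + _).
  by rewrite addrC -!addrA; congr (_ + _); rewrite addrC.
have Y0 := sylvester_inj pX pX E2.
by exists X => //; rewrite -E1 Y0 mul0mx subr0.
Qed.

End SqrtExists.

(** * Smoothness of the matrix square root *)

Section Sqrtm.
Variable R : realType.

Lemma cauchy_schwarz_sum (I : finType) (w t : I -> R) :
  (\sum_k w k * t k) ^+ 2 <= (\sum_k w k ^+ 2) * (\sum_k t k ^+ 2).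
Proof.
set A := \sum_k w k ^+ 2; set B := \sum_k t k ^+ 2; set C := \sum_k w k * t k.
have B0 : 0 <= B by rewrite sumr_ge0// => *; exact: sqr_ge0.
have H : 0 <= \sum_k (B * w k - C * t k) ^+ 2 by rewrite sumr_ge0// => *; exact: sqr_ge0.
have E : \sum_k (B * w k - C * t k) ^+ 2 = B * (A * B - C ^+ 2).
  transitivity (\sum_k (B ^+ 2 * (w k ^+ 2) + ((- (2 * B * C)) * (w k * t k) + C ^+ 2 * t k ^+ 2))).
    by apply: eq_bigr => k _; ring.
  rewrite !big_split /= -!mulr_sumr -/A -/B -/C; ring.
rewrite E in H; have [B1|B1] := eqVneq B 0.
  have t0 k : t k = 0.
    have nn i : true -> 0 <= t i ^+ 2 by move=> _; exact: sqr_ge0.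
    by have /psumr_eq0P -/(_ nn k isT) /eqP := B1; rewrite sqrf_eq0 => /eqP.
  rewrite B1 mulr0 /C big1 ?expr0n// => k _; by rewrite t0 mulr0.
have Bp : 0 < B by rewrite lt_neqAle eq_sym B1.
by rewrite -subr_ge0; move: H; rewrite pmulr_rge0.
Qed.

Definition frob2 m n (Z : 'M[R]_(m, n)) : R := \sum_i \sum_j Z i j ^+ 2.

Lemma frob2_ge0 m n (Z : 'M[R]_(m, n)) : 0 <= frob2 Z.
Proof. by apply: sumr_ge0 => i _; apply: sumr_ge0 => j _; exact: sqr_ge0. Qed.

Lemma entry_frob2 m n (Z : 'M[R]_(m, n)) i j : Z i j ^+ 2 <= frob2 Z.
Proof.
rewrite /frob2 (bigD1 i)//= (bigD1 j)//= -addrA lerDl addr_ge0//.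
  by apply: sumr_ge0 => k _; exact: sqr_ge0.
by apply: sumr_ge0 => i' _; apply: sumr_ge0 => k _; exact: sqr_ge0.
Qed.

Lemma qf1E n (v : 'rV[R]_n) : qf 1%:M v = \sum_j v 0 j ^+ 2.
Proof. by rewrite /qf mulmx1 mxE; apply: eq_bigr => j _; rewrite mxE expr2. Qed.

Lemma frob2_trace m n (Z : 'M[R]_(m, n)) : frob2 Z = \sum_i qf 1%:M (row i Z).
Proof. by apply: eq_bigr => i _; rewrite qf1E; apply: eq_bigr => j _; rewrite mxE. Qed.

(** Write A = S S. Then v = (v S) S^-1, so the norm of v is bounded by
the norm of v S times the Frobenius norm of S^-1. *)
Lemma posdef_coercive n (A : 'M[R]_n) : posdef A ->
  exists2 c : R, 0 < c & forall v, c * qf 1%:M v <= qf A v.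
Proof.
move=> pA; have [S pS <-] := posdef_sqrt pA.
have uS := posdef_unit pS; have [sS _] := pS.
(* The summand 1 keeps c positive in dimension 0. *)
pose T := invmx S; pose c := frob2 T + 1.
have c0 : 0 < c by rewrite ltr_wpDl// frob2_ge0.
exists c^-1; first by rewrite invr_gt0.
move=> v; rewrite ler_pdivrMl//.
have -> : qf (S *m S) v = qf 1%:M (v *m S).
  by rewrite -(qf_congr S) mulmx1 sS.
set w := v *m S; have -> : v = w *m T by rewrite /w mulmxK.
rewrite !qf1E.
apply: (@le_trans _ _ (\sum_j (\sum_k w 0 k ^+ 2) * (\sum_k T k j ^+ 2))).
  apply: ler_sum => j _; rewrite mxE; exact: cauchy_schwarz_sum.
rewrite -mulr_sumr mulrC; apply: ler_wpM2r.
  by rewrite sumr_ge0// => *; exact: sqr_ge0.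
by rewrite exchange_big /= /c lerDl.
Qed.

(** The trace of (P Z + Z Q) Z^T is at least c times the squared norm
of Z; the inequality 2 w z <= c z^2 + w^2 / c absorbs the factor Z on the other
side. *)
Lemma sylvester_bound n (P Q Z : 'M[R]_n) (c : R) : 0 < c -> posdef P ->
  (forall v, c * qf 1%:M v <= qf Q v) ->
  c ^+ 2 * frob2 Z <= frob2 (P *m Z + Z *m Q).
Proof.
move=> c0 pP cQ; set W := P *m Z + Z *m Q.
have E : \tr (Z^T *m P *m Z^T^T) + \tr (Z *m Q *m Z^T) = \sum_i \sum_j W i j * Z i j.
  rewrite trmxK -mulmxA mxtrace_mulC -mxtraceD -mulmxDl -/W.
  by apply: eq_bigr => i _; rewrite mxE; apply: eq_bigr => j _; rewrite [X in _ * X]mxE.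
have h1 : 0 <= \tr (Z^T *m P *m Z^T^T).
  by rewrite trace_qf sumr_ge0// => i _; exact: posdef_ge0.
have h2 : c * frob2 Z <= \tr (Z *m Q *m Z^T).
  by rewrite trace_qf frob2_trace mulr_sumr; apply: ler_sum => i _; exact: cQ.
have h3 : c * frob2 Z <= \sum_i \sum_j W i j * Z i j.
  by rewrite -E; apply: le_trans h2 _; rewrite lerDr.
have h4 : \sum_i \sum_j W i j * Z i j <= (c / 2) * frob2 Z + (2 * c)^-1 * frob2 W.
  rewrite /frob2 !mulr_sumr -big_split /=; apply: ler_sum => i _.
  rewrite !mulr_sumr -big_split /=; apply: ler_sum => j _.
  have := sqr_ge0 (c * Z i j - W i j).
  rewrite -subr_ge0; set z := Z i j; set w := W i j => H.
  have -> : c / 2 * z ^+ 2 + (2 * c)^-1 * w ^+ 2 - w * z = (2 * c)^-1 * (c * z - w) ^+ 2.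
    by field; rewrite gt_eqF.
  by rewrite mulr_ge0// invr_ge0 mulr_ge0// ltW.
have h5 := le_trans h3 h4.
have : (c / 2) * frob2 Z <= (2 * c)^-1 * frob2 W by clear -h5; lra.
have -> : c / 2 * frob2 Z = (2 * c)^-1 * (c ^+ 2 * frob2 Z) by field; rewrite gt_eqF.
by rewrite ler_pM2l// invr_gt0 mulr_gt0.
Qed.

Definition sqrtm n (A : 'M[R]_n) : 'M[R]_n :=
  xget 0 [set S | posdef S /\ S *m S = A].

Lemma sqrtmP n (A : 'M[R]_n) : posdef A -> posdef (sqrtm A) /\ sqrtm A *m sqrtm A = A.
Proof.
move=> /posdef_sqrt[S pS SS]; rewrite /sqrtm; case: xgetP => [y -> //|] /(_ S).
by case.
Qed.

(** The operator Z |-> P Z + Z P as a matrix acting on [mxvec Z]: its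
inverse is then a rational function of the entries of P. *)
Definition sylvester_mx n (P : 'M[R]_n) : 'M[R]_(n * n) := lin_mulmx P + lin_mulmxr P.

Lemma sylvester_mxE n (P Z : 'M[R]_n) : mxvec Z *m sylvester_mx P = mxvec (P *m Z + Z *m P).
Proof. by rewrite /sylvester_mx mulmxDr !mul_vec_lin /= linearD. Qed.

Lemma sylvester_mx_unit n (P : 'M[R]_n) : posdef P -> sylvester_mx P \in unitmx.
Proof.
move=> pP; apply: unitmx_of_inj => v; rewrite -[v]vec_mxK sylvester_mxE => /eqP.
rewrite mxvec_eq0 => /eqP /(sylvester_inj pP pP) ->.
by rewrite linear0.
Qed.

Definition sylvester_sol n (P B : 'M[R]_n) : 'M[R]_n := vec_mx (mxvec B *m invmx (sylvester_mx P)).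

Lemma sylvester_solP n (P B : 'M[R]_n) : posdef P ->
  P *m sylvester_sol P B + sylvester_sol P B *m P = B.
Proof.
move=> pP; apply: (can_inj mxvecK).
by rewrite -sylvester_mxE vec_mxK mulmxKV// sylvester_mx_unit.
Qed.

Lemma cvg_to0 (T : Type) (G : set_system T) {FF : Filter G} (f : T -> R) (l : R) :
  f t @[t --> G] --> l -> f t - l @[t --> G] --> 0.
Proof. by move=> fl; rewrite -(subrr l); apply: cvgB => //; exact: cvg_cst. Qed.

Lemma cvg_from0 (T : Type) (G : set_system T) {FF : Filter G} (f : T -> R) (l : R) :
  f t - l @[t --> G] --> 0 -> f t @[t --> G] --> l.
Proof.
move=> fl; have : f t - l + l @[t --> G] --> 0 + l by apply: cvgD => //; exact: cvg_cst.
rewrite add0r; apply: cvg_trans; apply: near_eq_cvg.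
by apply: nearW => t; rewrite subrK.
Qed.

Lemma sylvester_quot n (P S D Z : 'M[R]_n) (c : R) :
  P *m (c *: Z - D) + (c *: Z - D) *m S =
  c *: (P *m Z + Z *m S) - (S *m D + D *m S) - (P - S) *m D.
Proof.
rewrite mulmxBr !mulmxBl -scalemxAr -scalemxAl scalerDr.
move: (P *m D) (S *m D) (D *m S) (c *: (P *m Z)) (c *: (Z *m S)) => p q r s t.
by apply/matrixP => i j; rewrite !mxE; ring.
Qed.

Lemma entry_quot n (c : R) (A1 A0 B F1 F0 D : 'M[R]_n) a b :
  (c *: (A1 - A0) - B - (F1 - F0) *m D) a b =
  c * (A1 a b - A0 a b) - B a b - \sum_m (F1 a m - F0 a m) * D m b.
Proof. by rewrite !mxE; congr (_ - _); apply: eq_bigr => m _; rewrite !mxE. Qed.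

Section CkSqrt.
Variable d : nat.
Implicit Types (U : set 'rV[R]_d).

Lemma Ckm_mxvec k U p q (F : 'rV[R]_d -> 'M[R]_(p, q)) :
  Ckm k U F -> Ckm k U (fun x => mxvec (F x)).
Proof.
move=> HF i j; rewrite ord1; case/mxvec_indexP: j => a b.
rewrite (_ : (fun x => _) = fun x => F x a b); first exact: HF.
by apply/funext => x; rewrite mxvecE.
Qed.

Lemma Ckm_vec_mx k U p q (F : 'rV[R]_d -> 'rV[R]_(p * q)) :
  Ckm k U F -> Ckm k U (fun x => (vec_mx (F x) : 'M[R]_(p, q))).
Proof.
move=> HF i j.
rewrite (_ : (fun x => _) = fun x => F x 0 (mxvec_index i j)); first exact: HF.
by apply/funext => x; rewrite mxE.
Qed.

Lemma Ckm_sylvester_mx k U n (F : 'rV[R]_d -> 'M[R]_n) : open U ->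
  Ckm k U F -> Ckm k U (fun x => sylvester_mx (F x)).
Proof.
move=> oU HF; apply: Ckm_add => // i j.
  apply: (@Ck_ext _ _ _ _ (fun x => mxvec (F x *m vec_mx (delta_mx 0 i)) 0 j)) => //.
    by move=> x _; rewrite !mxE.
  by apply: Ckm_mxvec; apply: Ckm_mul => //; exact: Ckm_cst.
apply: (@Ck_ext _ _ _ _ (fun x => mxvec (vec_mx (delta_mx 0 i) *m F x) 0 j)) => //.
  by move=> x _; rewrite !mxE.
by apply: Ckm_mxvec; apply: Ckm_mul => //; exact: Ckm_cst.
Qed.

Lemma Ckm_sylvester_sol k U n (F B : 'rV[R]_d -> 'M[R]_n) : open U ->
  (forall x, U x -> posdef (F x)) ->
  Ckm k U F -> Ckm k U B -> Ckm k U (fun x => sylvester_sol (F x) (B x)).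
Proof.
move=> oU pF HF HB; apply: Ckm_vec_mx; apply: Ckm_mul => //; first exact: Ckm_mxvec.
apply: Ckm_inv => //; last exact: Ckm_sylvester_mx.
by move=> x /pF; exact: sylvester_mx_unit.
Qed.

(** Differences, and corrected difference quotients, of square roots
satisfy Sylvester equations with a right-hand side tending to 0; hence they tend
to 0 themselves. *)
Lemma sylvester_cvg0 (T : Type) (G : set_system T) {FF : Filter G} n
    (P Z : T -> 'M[R]_n) (Q : 'M[R]_n) :
  posdef Q -> (\forall t \near G, posdef (P t)) ->
  (forall i j, (P t *m Z t + Z t *m Q) i j @[t --> G] --> 0) ->
  forall i j, Z t i j @[t --> G] --> 0.
Proof.
move=> pQ pP HW i j.
have [c c0 cQ] := posdef_coercive pQ.
have W0 : frob2 (P t *m Z t + Z t *m Q) @[t --> G] --> (0 : R).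
  have -> : (0 : R) = \sum_(a < n) \sum_(b < n) 0 * 0.
    by rewrite big1// => a _; rewrite big1// => b _; rewrite mulr0.
  apply: (@cvg_sumR R) => a; apply: (@cvg_sumR R) => b.
  by apply: cvgM; exact: HW.
apply/cvgrPdist_le => e e0.
have ce0 : 0 < (c * e) ^+ 2 by rewrite exprn_gt0// mulr_gt0.
near=> t.
rewrite sub0r normrN -(ler_pM2l c0) -(@ler_pXn2r _ 2)//; last 2 first.
  by rewrite nnegrE mulr_ge0// ltW.
  by rewrite nnegrE mulr_ge0// ltW.
rewrite exprMn real_normK ?num_real//.
apply: (@le_trans _ _ (c ^+ 2 * frob2 (Z t))).
  by rewrite ler_wpM2l ?sqr_ge0// entry_frob2.
apply: (le_trans (@sylvester_bound _ (P t) _ _ _ c0 _ cQ)).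
  by near: t.
rewrite -[leLHS]ger0_norm ?frob2_ge0// -normrN -sub0r.
near: t; move/cvgrPdist_le : W0; exact.
Unshelve. all: by end_near. Qed.

(** Continuity and differentiability follow from [sylvester_cvg0]. The
derivative of F = sqrtm A in direction l is the solution of F D + D F = d_l A, a
function of class C^k as soon as F is. *)
Lemma Ckm_sqrtm k U n (A : 'rV[R]_d -> 'M[R]_n) : open U ->
  (forall x, U x -> posdef (A x)) -> Ckm k U A -> Ckm k U (fun x => sqrtm (A x)).
Proof.
move=> oU pA.
pose F x := sqrtm (A x).
have pF x : U x -> posdef (F x) by move=> /pA/sqrtmP[].
have FF x : U x -> F x *m F x = A x by move=> /pA/sqrtmP[].
have key x y : U x -> U y -> F y *m (F y - F x) + (F y - F x) *m F x = A y - A x.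
  by move=> Ux Uy; rewrite -!FF// mulmxBr mulmxBl addrA subrK.
have nU x : U x -> \forall y \near x, U y by move=> Ux; exact: open_nbhs_nbhs.
have cF : Ckm 0 U A -> forall x, U x -> forall i j, {for x, continuous (fun y => F y i j)}.
  move=> HA x Ux i j.
  have H0 : (F y - F x) i j @[y --> x] --> 0.
    apply: (@sylvester_cvg0 _ (nbhs x) _ _ F (fun y => F y - F x) (F x)).
    - exact: pF.
    - by apply: filterS (nU x Ux) => y; exact: pF.
    - move=> a b.
      have HAx : A y a b - A x a b @[y --> x] --> 0.
        apply: (@cvg_to0 _ (nbhs x)); exact: Ck_cont (HA a b) x Ux.
      apply: cvg_trans HAx; apply: (@near_eq_cvg _ _ (nbhs x)).
      by apply: filterS (nU x Ux) => y Uy; rewrite key// !mxE.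
  apply: (@cvg_from0 _ (nbhs x)); apply: cvg_trans H0.
  by apply: (@near_eq_cvg _ _ (nbhs x)); apply: nearW => y; rewrite !mxE.
elim: k => [|k IH] HA; first by move=> i j; split => // x Ux; exact: cF.
have HA' := Ckm_le (leqnSn _) HA.
have {}IH := IH HA'.
move=> i j.
pose dA l x : 'M[R]_n := \matrix_(a, b) partial l (fun y => A y a b) x.
have HdA l : Ckm k U (dA l).
  by move=> a b; apply: (Ck_ext oU _ (Ck_partial l (HA a b))) => x _; rewrite mxE.
apply: (@Ck_intro _ _ _ _ _ (fun l x => sylvester_sol (F x) (dA l x) i j)) => //.
- by move=> x Ux; apply: cF => //; exact: Ckm_le (leq0n _) HA.
- move=> l x Ux; set D := sylvester_sol _ _.
  have DE : F x *m D + D *m F x = dA l x by apply: sylvester_solP; exact: pF.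
  set e := delta_mx 0 l : 'rV[R]_d.
  have lim0 : (h *: e + x) @[h --> 0^'] --> x.
    rewrite -[X in _ --> X]add0r -(scale0r e); apply: cvgD; last exact: cvg_cst.
    by apply: cvgZr_tmp; apply: cvg_within; exact: cvg_id.
  have nUh : \forall h \near (0 : R)^', U (h *: e + x) by apply: lim0; exact: nU.
  (* The difference quotient of F minus its expected limit. *)
  pose Z (h : R) := h^-1 *: (F (h *: e + x) - F x) - D.
  have H0 : Z h i j @[h --> (0 : R)^'] --> 0.
    apply: (@sylvester_cvg0 _ _ _ _ (fun h => F (h *: e + x)) Z (F x)).
    - exact: pF.
    - by apply: filterS nUh => h; exact: pF.
    - move=> a b.
      have L1 : h^-1 *: (A (h *: e + x) a b - A x a b) - dA l x a b @[h --> (0 : R)^'] --> 0.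
        apply: cvg_to0; have [d1 d2] := Ck_is_derive l (HA a b) Ux.
        by move: d1; rewrite /derivable => d1; rewrite [X in _ --> X]mxE -d2; exact: d1.
      have L2 : \sum_m (F (h *: e + x) a m - F x a m) * D m b @[h --> (0 : R)^'] --> \sum_(m < n) 0 * D m b.
        apply: (@cvg_sumR R) => m; apply: cvgM; last exact: cvg_cst.
        apply: cvg_to0.
        apply: (@cvg_comp _ _ _ (fun h => h *: e + x) (fun y => F y a m)); first exact: lim0.
        by apply: cF => //; exact: Ckm_le (leq0n _) HA.
      have L3 := cvgB L1 L2.
      rewrite [X in _ --> _ - X]big1 ?subr0 in L3; last by move=> m _; rewrite mul0r.
      have {}L3 := L3 (dnbhs_filter 0); apply: cvg_trans L3.
      apply: (@near_eq_cvg _ _ (0 : R)^').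
      near=> h.
      have Uh : U (h *: e + x) by near: h.
      have E : F (h *: e + x) *m Z h + Z h *m F x =
          (h^-1 *: (A (h *: e + x) - A x) - dA l x) - (F (h *: e + x) - F x) *m D.
        by rewrite -(key _ _ Ux Uh) -DE /Z sylvester_quot.
      by rewrite E entry_quot.
  have lim : h^-1 *: (F (h *: e + x) i j - F x i j) @[h --> (0 : R)^'] --> D i j.
    apply: cvg_from0; apply: cvg_trans H0; apply: near_eq_cvg.
    by apply: nearW => h; rewrite !mxE.
  by split; [apply/cvg_ex; exists (D i j)|exact: cvg_lim].
- by move=> l; apply: Ckm_sylvester_sol.
Unshelve. all: by end_near. Qed.

End CkSqrt.
End Sqrtm.

(** * Geometric means and compatible metrics at a point *)

Section GeomMean.
Variables (R : realType) (n : nat).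
Implicit Types (H Q G T Om : 'M[R]_n) (a : 'cV[R]_n) (E : 'rV[R]_n).

Lemma invmx_uniq (A B : 'M[R]_n) : B *m A = 1%:M -> invmx A = B.
Proof.
move=> BA; have [_ uA] := mulmx1_unit BA.
by rewrite -[LHS]mul1mx -BA mulmxK.
Qed.

Lemma invmxM (A B : 'M[R]_n) : A \in unitmx -> B \in unitmx ->
  invmx (A *m B) = invmx B *m invmx A.
Proof.
move=> uA uB; apply: invmx_uniq.
by rewrite mulmxA -[_ *m invmx A *m A]mulmxA mulVmx// mulmx1 mulVmx.
Qed.

(** Congruence by the square root of H turns G H^-1 G = Q into an
equation for a square root. *)
Definition gmean H Q : 'M[R]_n :=
  let C := sqrtm H in
  C *m sqrtm (invmx C *m Q *m invmx C) *m C.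

Lemma gmeanP H Q : posdef H -> posdef Q ->
  posdef (gmean H Q) /\ gmean H Q *m invmx H *m gmean H Q = Q.
Proof.
move=> pH pQ; rewrite /gmean; set C := sqrtm H.
have [pC CC] := sqrtmP pH; rewrite -/C in pC CC.
have uC := posdef_unit pC; have [sC _] := pC.
have sV : (invmx C)^T = invmx C by rewrite trmx_inv sC.
have pP : posdef (invmx C *m Q *m invmx C).
  by rewrite -{2}sV; apply: posdef_congr => //; rewrite unitmx_inv.
have [pS SS] := sqrtmP pP; set S := sqrtm _ in pS SS *.
split; first by rewrite -{2}sC; exact: posdef_congr.
have -> : invmx H = invmx C *m invmx C by rewrite -CC invmxM.
rewrite !mulmxA mulmxK// -[C *m S *m _ *m C]mulmxA mulVmx// mulmx1.
rewrite -[C *m S *m S]mulmxA SS !mulmxA mulmxV// mul1mx -mulmxA mulVmx// mulmx1.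
by [].
Qed.

Lemma gmean_uniq H G G' : posdef H -> posdef G -> posdef G' ->
  G *m invmx H *m G = G' *m invmx H *m G' -> G = G'.
Proof.
move=> pH pG pG' EG; set C := sqrtm H.
have [pC CC] := sqrtmP pH; rewrite -/C in pC CC.
have uC := posdef_unit pC; have [sC _] := pC.
have sV : (invmx C)^T = invmx C by rewrite trmx_inv sC.
have HV : invmx H = invmx C *m invmx C by rewrite -CC invmxM.
pose f (X : 'M[R]_n) := invmx C *m X *m invmx C.
have pf X : posdef X -> posdef (f X).
  by move=> pX; rewrite /f -{2}sV; apply: posdef_congr => //; rewrite unitmx_inv.
have ff X : f X *m f X = f (X *m invmx H *m X) by rewrite HV /f !mulmxA.
have fE : f G = f G' by apply: sqrt_uniq; [exact: pf|exact: pf|rewrite !ff EG].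
have fK X : C *m f X *m C = X.
  by rewrite /f !mulmxA mulmxV// mul1mx -mulmxA mulVmx// mulmx1.
by rewrite -(fK G) fE fK.
Qed.

Lemma invmx_congr T H : T \in unitmx -> H \in unitmx ->
  invmx (T *m H *m T^T) = (invmx T)^T *m invmx H *m invmx T.
Proof.
move=> uT uH; have uT' : T^T \in unitmx by rewrite unitmx_tr.
by rewrite invmxM ?unitmx_mul ?uT// invmxM// trmx_inv mulmxA.
Qed.

Lemma gmean_congr T H Q : T \in unitmx -> posdef H -> posdef Q ->
  gmean (T *m H *m T^T) (T *m Q *m T^T) = T *m gmean H Q *m T^T.
Proof.
move=> uT pH pQ; have [pG GE] := gmeanP pH pQ.
have [pG' GE'] := gmeanP (posdef_congr uT pH) (posdef_congr uT pQ).
apply: (gmean_uniq (posdef_congr uT pH)) => //; first exact: posdef_congr.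
rewrite GE' (invmx_congr uT (posdef_unit pH)).
have uT' : T^T \in unitmx by rewrite unitmx_tr.
rewrite -{1}GE !mulmxA -[_ *m T^T *m (invmx T)^T]mulmxA trmx_inv mulmxV// mulmx1.
by rewrite -[_ *m invmx T *m T]mulmxA mulVmx// mulmx1.
Qed.

(** As E Om = 0 and E a = 1, the Reeb vector E solves
E (Om + a a^T) = a^T, and Om + a a^T is invertible. *)
Definition reebv Om a : 'rV[R]_n := a^T *m invmx (Om + a *m a^T).

(** This is what the wedge condition amounts to at a point in odd
dimension: Om is skew, its kernel is not zero and meets ker a only in 0. *)
Definition transverse Om a : Prop :=
  [/\ Om^T = - Om, forall v : 'rV[R]_n, v *m Om = 0 -> (v *m a) 0 0 = 0 -> v = 0
    & exists2 v : 'rV[R]_n, v != 0 & v *m Om = 0].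

Lemma qf_skew Om v : Om^T = - Om -> qf Om v = 0.
Proof.
move=> sO; have : qf Om v = - qf Om v.
  have -> : - qf Om v = (v *m - Om *m v^T) 0 0 by rewrite mulmxN mulNmx [RHS]mxE.
  rewrite -sO /qf.
  have -> : v *m Om^T *m v^T = (v *m Om *m v^T)^T by rewrite !trmx_mul trmxK mulmxA.
  by rewrite [RHS]mxE.
lra.
Qed.

Lemma mx11E (A : 'M[R]_1) : A = (A 0 0)%:M.
Proof. by apply/matrixP => i j; rewrite !ord1 mxE eqxx mulr1n. Qed.

Lemma mx11_eq0 (A : 'M[R]_1) : A 0 0 = 0 -> A = 0.
Proof. by move=> A0; apply/matrixP => i j; rewrite !ord1 A0 mxE. Qed.

(** If v (Om + a a^T) = 0, pairing with v removes the skew part and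
leaves (v a)^2 = 0; then v Om = 0 as well. *)
Lemma transverse_unit Om a : transverse Om a -> Om + a *m a^T \in unitmx.
Proof.
case=> sO H _; apply: unitmx_of_inj => v vN.
have va0 : (v *m a) 0 0 = 0.
  have : qf (Om + a *m a^T) v = 0 by rewrite /qf vN mul0mx mxE.
  by rewrite qf_add qf_skew// qf_rank1 add0r => /eqP; rewrite sqrf_eq0 => /eqP.
apply: H => //; rewrite mulmxDr mulmxA in vN.
by move: vN; rewrite (mx11_eq0 va0) mul0mx addr0.
Qed.

Lemma reebvP Om a : transverse Om a ->
  reebv Om a *m Om = 0 /\ reebv Om a *m a = 1%:M.
Proof.
move=> tr; have uN := transverse_unit tr; have [sO H [e e0 eO]] := tr.
have ea0 : (e *m a) 0 0 != 0.
  by apply: contra_neq e0; exact: H.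
set c := (e *m a) 0 0 in ea0.
have ea : e *m a = c%:M by exact: mx11E.
have eN : c^-1 *: e *m (Om + a *m a^T) = a^T.
  rewrite -scalemxAl mulmxDr eO add0r mulmxA ea mul_scalar_mx scalerA mulVf//.
  by rewrite scale1r.
have -> : reebv Om a = c^-1 *: e by rewrite -[RHS](mulmxK uN) eN.
by rewrite -!scalemxAl eO scaler0 ea -scalemx1 scalerA mulVf// scale1r.
Qed.

Lemma transverse_congr T Om a : T \in unitmx -> transverse Om a ->
  transverse (T *m Om *m T^T) (T *m a).
Proof.
move=> uT [sO H [e e0 eO]]; have uT' : T^T \in unitmx by rewrite unitmx_tr.
split.
- by rewrite !trmx_mul trmxK sO mulNmx mulmxN mulmxA.
- move=> v; rewrite !mulmxA => vO va.
  have vO' : v *m T *m Om = 0 by rewrite -[LHS](mulmxK uT') vO mul0mx.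
  by rewrite -[v](mulmxK uT) (H _ vO' va) mul0mx.
- exists (e *m invmx T); last by rewrite !mulmxA mulmxKV// eO mul0mx.
  by apply: contra_neq e0 => E; rewrite -[e](mulmxKV uT) E mul0mx.
Qed.

Lemma reebv_congr T Om a : T \in unitmx -> transverse Om a ->
  reebv (T *m Om *m T^T) (T *m a) = reebv Om a *m invmx T.
Proof.
move=> uT tr; rewrite /reebv.
have -> : T *m Om *m T^T + T *m a *m (T *m a)^T = T *m (Om + a *m a^T) *m T^T.
  by rewrite mulmxDr mulmxDl trmx_mul !mulmxA.
rewrite (invmx_congr uT (transverse_unit tr)) trmx_mul !mulmxA trmx_inv mulmxK//.
by rewrite unitmx_tr.
Qed.

(** The endomorphism 1 - a E is the projection onto ker a along the Reeb
vector E. So this is H on ker a, extended by making E a unit normal vector. *)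
Definition adapt Om a H : 'M[R]_n :=
  let p := 1%:M - a *m reebv Om a in p *m H *m p^T + a *m a^T.

Definition dualform Om a H : 'M[R]_n := Om *m H *m Om^T + a *m a^T.

Lemma posdef_dualform Om a H : transverse Om a -> posdef H ->
  posdef (dualform Om a H).
Proof.
move=> [_ tr _] pH; have [sH _] := pH; split.
  by rewrite /dualform raddfD /= !trmx_mul !trmxK sH mulmxA.
move=> v v0; rewrite /dualform qf_add qf_congr qf_rank1.
have h1 := posdef_ge0 (v *m Om) pH; have h2 := sqr_ge0 ((v *m a) 0 0).
rewrite lt_neqAle addr_ge0// andbT eq_sym; apply: contra_neq v0.
move=> /eqP; rewrite paddr_eq0// sqrf_eq0 => /andP[/eqP q0 /eqP]; apply: tr.
by apply/eqP; apply: contraT => /pH.2; rewrite q0 ltxx.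
Qed.

Lemma posdef_adapt Om a H : transverse Om a -> posdef H -> posdef (adapt Om a H).
Proof.
move=> tr pH; have [sH _] := pH; rewrite /adapt; set p := 1%:M - _; split.
  by rewrite raddfD /= !trmx_mul !trmxK sH mulmxA.
move=> v v0; rewrite qf_add qf_congr qf_rank1.
have h1 := posdef_ge0 (v *m p) pH; have h2 := sqr_ge0 ((v *m a) 0 0).
rewrite lt_neqAle addr_ge0// andbT eq_sym; apply: contra_neq v0.
move=> /eqP; rewrite paddr_eq0// sqrf_eq0 => /andP[/eqP q0 /eqP va].
have : v *m p = 0 by apply/eqP; apply: contraT => /pH.2; rewrite q0 ltxx.
by rewrite mulmxBr mulmx1 mulmxA (mx11_eq0 va) mul0mx subr0.
Qed.

Lemma adaptE Om a H : transverse Om a -> adapt Om a H *m (reebv Om a)^T = a.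
Proof.
move=> tr; have [_ Ea] := reebvP tr; rewrite /adapt.
set E := reebv Om a in Ea *; set p := 1%:M - a *m E.
have Ep : E *m p = 0 by rewrite mulmxBr mulmx1 mulmxA Ea mul1mx subrr.
rewrite mulmxDl -(mulmxA _ p^T) -trmx_mul Ep trmx0 mulmx0 add0r.
by rewrite -mulmxA -trmx_mul Ea trmx1 mulmx1.
Qed.

Definition cometric Om a H : 'M[R]_n :=
  let K := adapt Om a H in gmean K (dualform Om a (invmx K)).

(** Write K = adapt Om a H, Q = dualform Om a K^-1 and G = gmean K Q. From
K E^T = Q E^T = a one gets (G + K) K^-1 (G E^T - a) = 0, so G E^T = a. Then
Om G^-1 Om^T + a a^T is a positive solution of X K^-1 X = Q, because
Om^T K^-1 Om = Q - a a^T = G K^-1 G - a a^T and the cross terms contain E Om = 0.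
Uniqueness of the solution concludes. *)
Lemma cometricP Om a H (G := cometric Om a H) : transverse Om a -> posdef H ->
  [/\ posdef G, G *m (reebv Om a)^T = a & G = dualform Om a (invmx G)].
Proof.
move=> tr pH; have [sO _ _] := tr; have [EO Ea] := reebvP tr.
have pK := posdef_adapt tr pH; have KE := adaptE H tr.
set K := adapt Om a H in pK KE.
move: (reebv Om a) EO Ea KE => E EO Ea KE.
have uK := posdef_unit pK.
have pQ : posdef (dualform Om a (invmx K)) by apply: posdef_dualform => //; exact: posdef_inv.
have [pG GE] := gmeanP pK pQ; rewrite -/(cometric Om a H) -/G in pG GE.
clearbody G.
have uG := posdef_unit pG; have [sG _] := pG.
have OE : Om^T *m E^T = 0 by rewrite -trmx_mul EO trmx0.
have OE' : Om *m E^T = 0.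
  by rewrite -[Om]opprK -sO mulNmx OE oppr0.
have aE : a^T *m E^T = 1%:M by rewrite -trmx_mul Ea trmx1.
have KaE : invmx K *m a = E^T by rewrite -KE mulKmx.
have QE : dualform Om a (invmx K) *m E^T = a.
  by rewrite /dualform mulmxDl -mulmxA OE mulmx0 add0r -mulmxA aE mulmx1.
have GEa : G *m E^T = a.
  have h1 : G *m invmx K *m (G *m E^T) = a by rewrite mulmxA GE QE.
  have h2 : G *m invmx K *m a = G *m E^T by rewrite -mulmxA KaE.
  have h3 : (G + K) *m (invmx K *m (G *m E^T - a)) = 0.
    rewrite mulmxDl !mulmxA mulmxV// mul1mx mulmxBr h1 h2.
    by rewrite addrA subrK subrr.
  have pGK : posdef (G + K).
    split; first by rewrite raddfD /= sG; case: pK => ->.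
    by move=> v v0; rewrite qf_add addr_gt0//; [exact: pG.2|exact: pK.2].
  apply/eqP; rewrite -subr_eq0; apply/eqP.
  rewrite -[LHS](mulKVmx uK) -[invmx K *m _](mulKmx (posdef_unit pGK)) h3.
  by rewrite !mulmx0.
have GaE : invmx G *m a = E^T by rewrite -GEa mulKmx.
have aGE : a^T *m invmx G = E.
  by have := congr1 trmx GaE; rewrite trmx_mul trmx_inv sG trmxK.
split => //.
have pG' : posdef (dualform Om a (invmx G)) by apply: posdef_dualform => //; exact: posdef_inv.
apply: (gmean_uniq pK) => //; rewrite GE.
set G' := dualform _ _ (invmx G).
have OKO : Om^T *m invmx K *m Om = G *m invmx K *m G - a *m a^T.
  by rewrite GE /dualform addrK sO !mulNmx mulmxN.
have G'K : G' *m invmx K = Om *m invmx G *m Om^T *m invmx K + a *m E.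
  rewrite /G' /dualform mulmxDl; congr (_ + _).
  by rewrite -mulmxA; congr (_ *m _); have := congr1 trmx KaE;
    rewrite trmx_mul trmx_inv trmxK; case: pK => ->.
rewrite G'K [in RHS]/G' /dualform mulmxDl !mulmxDr.
have -> : a *m E *m (Om *m invmx G *m Om^T) = 0.
  by rewrite !mulmxA -(mulmxA a E) EO mulmx0 !mul0mx.
have -> : a *m E *m (a *m a^T) = a *m a^T.
  by rewrite !mulmxA -(mulmxA a E) Ea mulmx1.
have -> : Om *m invmx G *m Om^T *m invmx K *m (a *m a^T) = 0.
  by rewrite mulmxA -(mulmxA _ (invmx K) a) KaE -(mulmxA _ Om^T) OE mulmx0 mul0mx.
rewrite add0r addr0; congr (_ + _).
have -> : Om *m invmx G *m Om^T *m invmx K *m (Om *m invmx G *m Om^T) =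
   Om *m invmx G *m (Om^T *m invmx K *m Om) *m invmx G *m Om^T by rewrite !mulmxA.
rewrite OKO mulmxBr !mulmxBl.
have -> : Om *m invmx G *m (a *m a^T) = 0.
  by rewrite mulmxA -(mulmxA Om) GaE OE' mul0mx.
rewrite !mul0mx subr0 !mulmxA mulmxKV//.
by rewrite -[_ *m G *m invmx G]mulmxA mulmxV// mulmx1.
Qed.

Lemma dualform_congr T Om a H : T \in unitmx -> H \in unitmx ->
  dualform (T *m Om *m T^T) (T *m a) (invmx (T *m H *m T^T)) =
  T *m dualform Om a (invmx H) *m T^T.
Proof.
move=> uT uH; have uT' : T^T \in unitmx by rewrite unitmx_tr.
rewrite /dualform (invmx_congr uT uH) mulmxDr mulmxDl; congr (_ + _).
  rewrite !trmx_mul trmxK !mulmxA trmx_inv mulmxK//.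
  by rewrite -[_ *m invmx T *m T]mulmxA mulVmx// mulmx1.
by rewrite trmx_mul !mulmxA.
Qed.

Lemma cometric_congr T Om a H : T \in unitmx -> transverse Om a -> posdef H ->
  cometric (T *m Om *m T^T) (T *m a) (T *m H *m T^T) = T *m cometric Om a H *m T^T.
Proof.
move=> uT tr pH.
have aE : adapt (T *m Om *m T^T) (T *m a) (T *m H *m T^T) = T *m adapt Om a H *m T^T.
  rewrite /adapt reebv_congr//; set p := 1%:M - a *m _.
  rewrite [RHS](_ : _ = T *m (p *m H *m p^T) *m T^T + (T *m a) *m (T *m a)^T); last first.
    by rewrite mulmxDr mulmxDl trmx_mul !mulmxA.
  congr (_ + _).
  have -> : 1%:M - T *m a *m (reebv Om a *m invmx T) = T *m p *m invmx T.
    by rewrite mulmxBr mulmxBl mulmx1 mulmxV// !mulmxA.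
  have TT : invmx T *m T = 1%:M by rewrite mulVmx.
  rewrite !trmx_mul !mulmxA -[_ *m invmx T *m T]mulmxA TT mulmx1.
  by rewrite -[_ *m T^T *m (invmx T)^T]mulmxA -trmx_mul TT trmx1 mulmx1.
have pK := posdef_adapt tr pH.
rewrite /cometric aE /= (dualform_congr _ _ uT (posdef_unit pK)) gmean_congr//.
by apply: posdef_dualform => //; exact: posdef_inv.
Qed.

End GeomMean.

Section CkCometric.
Variables (R : realType) (d n k : nat) (U : set 'rV[R]_d) (oU : open U).

Lemma Ckm_reebv (Om : 'rV[R]_d -> 'M[R]_n) a :
  (forall x, U x -> transverse (Om x) (a x)) ->
  Ckm k U Om -> Ckm k U a -> Ckm k U (fun x => reebv (Om x) (a x)).
Proof.
move=> tr HO Ha; apply: Ckm_mul => //; first exact: Ckm_tr.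
apply: Ckm_inv => //; first by move=> x /tr; exact: transverse_unit.
by apply: Ckm_add => //; apply: Ckm_mul => //; exact: Ckm_tr.
Qed.

Lemma Ckm_gmean (H Q : 'rV[R]_d -> 'M[R]_n) :
  (forall x, U x -> posdef (H x)) -> (forall x, U x -> posdef (Q x)) ->
  Ckm k U H -> Ckm k U Q -> Ckm k U (fun x => gmean (H x) (Q x)).
Proof.
move=> pH pQ HH HQ.
have HC : Ckm k U (fun x => sqrtm (H x)) by exact: Ckm_sqrtm.
have pC x : U x -> posdef (sqrtm (H x)) by move=> /pH /sqrtmP[].
have HV : Ckm k U (fun x => invmx (sqrtm (H x))).
  by apply: Ckm_inv => // x /pC; exact: posdef_unit.
apply: Ckm_mul => //; apply: Ckm_mul => //; apply: Ckm_sqrtm => //; last first.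
  by apply: Ckm_mul => //; apply: Ckm_mul.
move=> x Ux; have [sC _] := pC x Ux.
have {2}-> : invmx (sqrtm (H x)) = (invmx (sqrtm (H x)))^T by rewrite trmx_inv sC.
by apply: posdef_congr; [rewrite unitmx_inv; apply: posdef_unit; exact: pC|exact: pQ].
Qed.

Lemma Ckm_dualform (Om H : 'rV[R]_d -> 'M[R]_n) a :
  Ckm k U Om -> Ckm k U a -> Ckm k U H ->
  Ckm k U (fun x => dualform (Om x) (a x) (H x)).
Proof.
move=> HO Ha HH; apply: Ckm_add => //; last by apply: Ckm_mul => //; exact: Ckm_tr.
by apply: Ckm_mul => //; [exact: Ckm_mul|exact: Ckm_tr].
Qed.

Lemma Ckm_cometric (Om H : 'rV[R]_d -> 'M[R]_n) a :
  (forall x, U x -> transverse (Om x) (a x)) ->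
  (forall x, U x -> posdef (H x)) ->
  Ckm k U Om -> Ckm k U a -> Ckm k U H ->
  Ckm k U (fun x => cometric (Om x) (a x) (H x)).
Proof.
move=> tr pH HO Ha HH.
have HK : Ckm k U (fun x => adapt (Om x) (a x) (H x)).
  have Hp : Ckm k U (fun x => 1%:M - a x *m reebv (Om x) (a x)).
    apply: Ckm_subf => //; first exact: Ckm_cst.
    by apply: Ckm_mul => //; exact: Ckm_reebv.
  apply: Ckm_add => //; last by apply: Ckm_mul => //; exact: Ckm_tr.
  by apply: Ckm_mul => //; [exact: Ckm_mul|exact: Ckm_tr].
have pK x : U x -> posdef (adapt (Om x) (a x) (H x)).
  by move=> Ux; apply: posdef_adapt; [exact: tr|exact: pH].
apply: Ckm_gmean => //.
- by move=> x Ux; apply: posdef_dualform; [exact: tr|apply: posdef_inv; exact: pK].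
- apply: Ckm_dualform => //; apply: Ckm_inv => // x /pK; exact: posdef_unit.
Qed.

End CkCometric.

(** * The wedge condition *)

Section Forms.
Variables (R : realType) (V : lmodType R).

Definition set_arg k (v : 'I_k -> V) (j : 'I_k) (w : V) : 'I_k -> V :=
  fun i => if i == j then w else v i.

Definition multilin k (f : form R V k) : Prop := forall v j c w w',
  f (set_arg v j (c *: w + w')) = c * f (set_arg v j w) + f (set_arg v j w').

(** Together with [kills_wedge], this carries the vanishing of the
interior products of u with alpha and Omega over to alpha /\ Omega^d. *)
Definition kills k (u : V) (f : form R V k) : Prop := forall v j, v j = u -> f v = 0.

Lemma set_arg_comp k l (v : 'I_k -> V) (j : 'I_k) (w : V) (g : 'I_l -> 'I_k) (i0 : 'I_l) :
  injective g -> g i0 = j -> (fun i => set_arg v j w (g i)) = set_arg (fun i => v (g i)) i0 w.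
Proof.
move=> ig gi; apply/funext => i; rewrite /set_arg.
by rewrite -gi (inj_eq ig).
Qed.

Lemma set_arg_out k l (v : 'I_k -> V) (j : 'I_k) (w : V) (g : 'I_l -> 'I_k) :
  (forall i, g i != j) -> (fun i => set_arg v j w (g i)) = (fun i => v (g i)).
Proof. by move=> gj; apply/funext => i; rewrite /set_arg (negPf (gj i)). Qed.

Section Wedge.
Variables (k l : nat) (a : form R V k) (b : form R V l).

Variant side_spec (s : 'S_(k + l)) (j : 'I_(k + l)) : Prop :=
| SideL i0 of s (lshift l i0) = j & (forall i, s (rshift k i) != j)
| SideR i0 of s (rshift k i0) = j & (forall i, s (lshift l i) != j).

(** A permutation of the k + l slots sends the j-th argument of the wedge
product to exactly one of the two factors. *)
Lemma sideP s j : side_spec s j.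
Proof.
have [i0 E|i0 E] := split_ordP ((s^-1)%g j).
- apply: (@SideL _ _ i0); first by rewrite -E permKV.
  move=> i; apply/eqP => E'; have : (s^-1)%g j = rshift k i by rewrite -E' permK.
  by rewrite E => /eqP; rewrite eq_lrshift.
- apply: (@SideR _ _ i0); first by rewrite -E permKV.
  move=> i; apply/eqP => E'; have : (s^-1)%g j = lshift l i by rewrite -E' permK.
  by rewrite E => /eqP; rewrite eq_rlshift.
Qed.

Lemma inj_l (s : 'S_(k + l)) : injective (fun i => s (lshift l i)).
Proof. by move=> i i' /perm_inj /lshift_inj. Qed.
Lemma inj_r (s : 'S_(k + l)) : injective (fun i => s (rshift k i)).
Proof. by move=> i i' /perm_inj /rshift_inj. Qed.

Lemma multilin_wedge : multilin a -> multilin b -> multilin (wedge a b).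
Proof.
move=> ma mb v j c w w'; rewrite /wedge /=; set K := (_)^-1; rewrite [c * (K * _)]mulrCA -mulrDr; congr (_ * _).
rewrite mulr_sumr -big_split /=; apply: eq_bigr => s _.
rewrite [c * (_ * _)]mulrCA -mulrDr; congr (_ * _).
case: (sideP s j) => i0 E out.
- by rewrite !(set_arg_comp _ _ (@inj_l s) E) !(set_arg_out _ _ out) ma mulrDl mulrA.
- rewrite !(set_arg_comp _ _ (@inj_r s) E) !(set_arg_out _ _ out) mb mulrDr; congr (_ + _).
  by rewrite mulrCA.
Qed.

Lemma kills_wedge u : kills u a -> kills u b -> kills u (wedge a b).
Proof.
move=> ka kb v j vj; rewrite /wedge big1 ?mulr0// => s _.
case: (sideP s j) => i0 E _.
- by rewrite (ka _ i0) ?mul0r ?mulr0// E.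
- by rewrite (kb _ i0) ?mulr0// E.
Qed.

(** Composing each permutation of the sum with the transposition of i and
j changes the sign of the term only. *)
Lemma alternating_wedge v i j : i != j -> v i = v j -> wedge a b v = 0.
Proof.
move=> ij vij; rewrite /wedge; set S := \sum_s _.
suff : S = - S by move=> /eqP; rewrite -subr_eq0 opprK -mulr2n mulrn_eq0 /= => /eqP->; rewrite mulr0.
rewrite {1}/S (reindex_inj (mulIg (tperm i j))) /= -sumrN; apply: eq_bigr => s _.
rewrite odd_permM odd_tperm ij addbT signrN mulNr; congr (- (_ * (a _ * b _)));
  apply/funext => x; rewrite permM; case: tpermP => // ->; rewrite ?vij// -vij//.
Qed.

End Wedge.

Lemma multilin_pow2 (b : form R V 2) d : multilin b -> multilin (wedge_pow2 b d).
Proof.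
move=> mb; elim: d => [|d IH]; first by move=> v [].
exact: (multilin_wedge mb IH).
Qed.

Lemma kills_pow2 (b : form R V 2) d u : kills u b -> kills u (wedge_pow2 b d).
Proof.
move=> mb; elim: d => [|d IH]; first by move=> v [].
exact: (kills_wedge mb IH).
Qed.

Lemma multilin_sum k (f : form R V k) v j (I : Type) (r : seq I) (c : I -> R) (w : I -> V) :
  multilin f ->
  f (set_arg v j (\sum_(i <- r) c i *: w i)) = \sum_(i <- r) c i * f (set_arg v j (w i)).
Proof.
move=> mf; elim: r => [|i r IH].
  have := mf v j 1 0 0; rewrite scaler0 addr0 mul1r !big_nil => /eqP.
  by rewrite -subr_eq0 opprD addNKr oppr_eq0 => /eqP.
by rewrite !big_cons mf IH.
Qed.

End Forms.

Section Transverse.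
Variables (R : realType) (n : nat).

(** Some combination of the v i with a nonzero coefficient c j is 0, if
the v i are dependent, or u, if they form a basis. Substituting it for v j makes f
vanish; by multilinearity and alternation, it also multiplies f v by c j. *)
Lemma top_form_kills (f : form R 'rV[R]_n n) (u : 'rV[R]_n) v : multilin f ->
  (forall v i j, i != j -> v i = v j -> f v = 0) ->
  kills u f -> kills 0 f -> u != 0 -> f v = 0.
Proof.
move=> mf af ku k0 u0.
pose A : 'M[R]_n := \matrix_i v i.
have [c [c0 kc]] : exists c : 'rV[R]_n, c != 0 /\ kills (c *m A) f.
  have [uA|nA] := boolP (A \in unitmx).
    exists (u *m invmx A); split; last by rewrite mulmxKV.
    by apply: contra_neq u0 => E; rewrite -[u](mulmxKV uA) E mul0mx.
  have /det0P [c c0 cA] : \det A == 0 by move: nA; rewrite unitmxE unitfE negbK.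
  by exists c; rewrite cA.
have /rV0Pn[j cj] := c0.
have E : c *m A = \sum_i c 0 i *: v i.
  by rewrite mulmx_sum_row; apply: eq_bigr => i _; rewrite rowK.
have H : f (set_arg v j (c *m A)) = 0 by apply: (kc _ j); rewrite /set_arg eqxx.
rewrite E multilin_sum// (bigD1 j)//= big1 ?addr0 in H; last first.
  move=> i ij; rewrite (af _ i j) ?mulr0// /set_arg eqxx.
  by rewrite (negPf ij).
have Ev : set_arg v j (v j) = v by apply/funext => i; rewrite /set_arg; case: eqP => [->|].
by apply: (mulfI cj); rewrite mulr0 -{1}Ev.
Qed.

End Transverse.

Section ShsTransverse.
Variables (R : realType) (d : nat) (M : smooth_manifold R d.*2.+1).
Variables (Om : bifield M) (al : covfield M).

Lemma skew_of_two_form (B : bifield M) p :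
  (forall v w, ev2 B p v w = - ev2 B p w v) -> (B p)^T = - B p.
Proof.
move=> H; apply/matrixP => i j; rewrite !mxE.
have E a b : ev2 B p (delta_mx 0 a) (delta_mx 0 b) = B p a b.
  rewrite /ev2 -rowE mxE (bigD1 b)//= !mxE !eqxx mulr1 big1 ?addr0//.
  by move=> k kb; rewrite !mxE eqxx /= (negPf kb) mulr0.
by have := H (delta_mx 0 j) (delta_mx 0 i); rewrite !E.
Qed.

(** A vector in ker Omega and ker alpha annihilates alpha /\ Omega^d, hence
is 0 by [top_form_kills]. A skew matrix of odd size is singular. *)
Lemma shs_transverse p : stable_hamiltonian Om al -> transverse (Om p) (al p).
Proof.
move=> [[[_ skew] _] _ W _].
have sO := skew_of_two_form (skew p); split => //.
- move=> u uO ua; apply/eqP; apply: contraT => u0.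
  have [v /eqP[]] := W p.
  have kO w : w *m Om p = 0 -> kills w (bi_form Om p).
    move=> wO x j xj; rewrite /bi_form /ev2.
    have [j0|j1] : j = ord0 \/ j = ord_max.
      by case: j {xj} => [[|[|]]]// ?; [left|right]; apply: val_inj.
    - by rewrite -j0 xj wO mul0mx mxE.
    - rewrite -j1 xj -[Om p]opprK -sO mulmxN mulNmx -mulmxA -trmx_mul wO.
      by rewrite trmx0 mulmx0 oppr0 mxE.
  have ka w : (w *m al p) 0 0 = 0 -> kills w (cov_form al p).
    by move=> wa x j; rewrite (ord1 j) => xj; rewrite /cov_form /ev1 xj.
  pose w : form R _ (1 + d.*2) := wedge (cov_form al p) (wedge_pow2 (bi_form Om p) d).
  have mw : multilin w.
    apply: multilin_wedge.
      by move=> x j c y y'; rewrite /cov_form /ev1 /set_arg (ord1 j) eqxx mulmxDl -scalemxAl !mxE.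
    apply: multilin_pow2 => x j c y y'; rewrite /bi_form /ev2 /set_arg.
    have [->|->] : j = ord0 \/ j = ord_max.
      by case: j => [[|[|]]]// ?; [left|right]; apply: val_inj.
    - by rewrite !eqxx /= !mulmxDl -!scalemxAl !mxE.
    - by rewrite !eqxx /= linearD linearZ /= mulmxDr -scalemxAr !mxE.
  have aw x i j : i != j -> x i = x j -> w x = 0 by exact: alternating_wedge.
  have kw y : y *m Om p = 0 -> (y *m al p) 0 0 = 0 -> kills y w.
    by move=> yO ya; apply: kills_wedge; [exact: ka|apply: kills_pow2; exact: kO].
  apply: (@top_form_kills R d.*2.+1 w u v mw aw _ _ u0); first exact: kw.
  by apply: kw; rewrite mul0mx ?mxE.
- have /det0P [v v0 vO] : \det (Om p) == 0.
    have := det_tr (Om p); rewrite sO -scaleN1r detZ exprS -signr_odd odd_double expr0.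
    rewrite mulr1 mulN1r => /eqP; rewrite -subr_eq0 -opprD oppr_eq0.
    by rewrite -mulr2n mulrn_eq0.
  by exists v.
Qed.

End ShsTransverse.

(** * Changes of chart *)

Section Charts.
Variables (R : realType) (n : nat) (M : smooth_manifold R n).
Implicit Types (c : chart_index M) (W : set M) (p q : M).

Lemma near_open (T : topologicalType) (U : set T) (P : T -> Prop) x :
  open U -> U x -> (forall y, U y -> P y) -> \forall y \near x, P y.
Proof. by move=> oU Ux UP; apply: (@filterS _ (nbhs x) _ U) => //; exact: open_nbhs_nbhs. Qed.

Definition chart_im c W : set 'rV[R]_n := phi c @` (dom c `&` W).

Lemma chart_imP c W p : dom c p -> W p -> chart_im c W (phi c p).
Proof. by move=> cp Wp; exists p. Qed.

Lemma chart_im_psi c W x : chart_im c W x ->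
  [/\ dom c (psi c x), W (psi c x) & phi c (psi c x) = x].
Proof. by case=> p [cp Wp] <-; rewrite phiK. Qed.

Lemma chart_imT c : chart_im c setT = chart_image c.
Proof. by rewrite /chart_im setIT. Qed.

Lemma open_chart_image c : open (chart_image c).
Proof. exact: phi_open. Qed.

Arguments open_chart_image : clear implicits.

(** Within the chart, this set is the preimage of W under [psi c]. *)
Lemma open_chart_im c W : open W -> open (chart_im c W).
Proof.
move=> oW; rewrite openE => x xW; have [cp Wp E] := chart_im_psi xW.
have Ix : chart_image c x by rewrite -E; exists (psi c x).
have h1 : \forall y \near x, chart_image c y by apply: open_nbhs_nbhs; split => //; exact: open_chart_image.
have h2 : \forall y \near x, W (psi c y).
  have := psi_continuous Ix; apply; exact: open_nbhs_nbhs.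
apply: filterS2 h1 h2 => y [q cq <-]; rewrite phiK// => Wq; by exists q.
Qed.

Arguments open_chart_im : clear implicits.

Lemma chart_im_sub c W W' : W `<=` W' -> chart_im c W `<=` chart_im c W'.
Proof. by move=> WW x [p [cp Wp] <-]; exists p; split => //; exact: WW. Qed.

Definition tau c c' : 'rV[R]_n -> 'rV[R]_n := phi c' \o psi c.

Lemma tau_phi c c' p : dom c p -> tau c c' (phi c p) = phi c' p.
Proof. by move=> cp; rewrite /tau /= phiK. Qed.

Lemma Ckm_tau k c c' : Ckm k (chart_im c (dom c')) (tau c c').
Proof. by move: k; apply/smooth_mx_onP; exact: transition_smooth. Qed.

Lemma tau_im0 c c' x : chart_im c (dom c') x -> chart_image c' (tau c c' x).
Proof. by move=> [p [cp Wp] <-]; rewrite tau_phi//; exists p. Qed.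

Lemma differentiable_tau c c' p : dom c p -> dom c' p ->
  differentiable (tau c c') (phi c p).
Proof.
move=> cp c'p; have oU := open_chart_im c _ (dom_open c').
by apply: (Ckm_differentiable oU (@Ckm_tau 1 c c')); exact: chart_imP.
Qed.

(** The matrices [tmx c c' p] are the jacobians [trans c c' p] with the
definition hidden: beyond [tmxJ], only the cocycle relations [tmx_comp] and
[tmx_id] matter. *)
Lemma tmx_sealed : {T : chart_index M -> chart_index M -> M -> 'M[R]_n |
  forall c c' p, trans c c' p = T c c' p}.
Proof. by exists (@trans R n M). Qed.

Definition tmx c c' p : 'M[R]_n := sval tmx_sealed c c' p.

Lemma tmxE c c' p : trans c c' p = tmx c c' p.
Proof. exact: (svalP tmx_sealed). Qed.

Lemma tmxJ c c' p : tmx c c' p = 'J (tau c c') (phi c p).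
Proof. by rewrite -tmxE. Qed.

Lemma tmx_derive c c' p v : dom c p -> dom c' p ->
  v *m tmx c c' p = 'D_v (tau c c') (phi c p).
Proof. by move=> cp c'p; rewrite tmxJ (deriveEjacobian _ (differentiable_tau cp c'p)). Qed.

Lemma mulmx_rV_inj m k (A B : 'M[R]_(m, k)) : (forall v : 'rV_m, v *m A = v *m B) -> A = B.
Proof. by move=> H; apply/row_matrixP => i; rewrite !rowE H. Qed.

Lemma tmx_id c p : dom c p -> tmx c c p = 1%:M.
Proof.
move=> cp; apply: mulmx_rV_inj => v; rewrite tmx_derive// mulmx1.
rewrite -[RHS](derive_id (phi c p) v); apply: near_eq_derive.
apply: (near_open (open_chart_image c)); first by exists p.
by move=> y [q cq <-]; rewrite tau_phi.
Qed.

Lemma tmx_comp c c' c'' p : dom c p -> dom c' p -> dom c'' p ->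
  tmx c c' p *m tmx c' c'' p = tmx c c'' p.
Proof.
move=> cp c'p c''p.
have d1 := differentiable_tau cp c'p.
have d2 := differentiable_tau c'p c''p.
have E1 v := tmx_derive v cp c'p.
have E2 v := tmx_derive v c'p c''p.
have E3 v := tmx_derive v cp c''p.
move: (tmx c c' p) (tmx c' c'' p) (tmx c c'' p) E1 E2 E3 => A B C E1 E2 E3.
apply: mulmx_rV_inj => v; rewrite mulmxA E2 E1 E3.
rewrite -(tau_phi c' cp) in d2 *; rewrite -(derive_comp _ d1 d2).
apply: near_eq_derive.
apply: (near_open (open_chart_im c _ (dom_open c'))); first exact: chart_imP.
by move=> y [q [cq c'q] <-]; rewrite /= !tau_phi.
Qed.

Lemma tmx_unit c c' p : dom c p -> dom c' p -> tmx c c' p \in unitmx.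
Proof.
move=> cp c'p; have := tmx_comp cp c'p cp; rewrite tmx_id// => /mulmx1_unit.
by case.
Qed.

Lemma tmx_inv c c' p : dom c p -> dom c' p -> invmx (tmx c c' p) = tmx c' c p.
Proof. by move=> cp c'p; apply: invmx_uniq; rewrite tmx_comp// tmx_id. Qed.

Lemma Ckm_transition k c c' : Ckm k (chart_im c (dom c')) (fun x => tmx c c' (psi c x)).
Proof.
have oU := open_chart_im c _ (dom_open c').
apply: (Ckm_ext oU _ (Ckm_jacobian oU (@Ckm_tau k.+1 c c'))) => x xU.
by rewrite tmxJ; have [_ _ ->] := chart_im_psi xU.
Qed.

Lemma Ckm_transition' k c c' : Ckm k (chart_im c (dom c')) (fun x => tmx c' c (psi c x)).
Proof.
have oU := open_chart_im c _ (dom_open c').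
apply: (Ckm_ext oU _ (Ckm_inv oU _ (@Ckm_transition k c c'))) => x /chart_im_psi[cp c'p _].
  by rewrite tmx_inv.
exact: tmx_unit.
Qed.

Let dc p := dom_chart_at p.

Lemma loc_vecE (X : vfield M) c p : dom c p ->
  loc_vec X c (phi c p) = X p *m tmx (chart_at p) c p.
Proof. by move=> cp; rewrite /loc_vec phiK// tmxE. Qed.

Lemma loc_vec_chart_at (X : vfield M) p : loc_vec X (chart_at p) (phi (chart_at p) p) = X p.
Proof. by rewrite loc_vecE ?tmx_id ?mulmx1//; exact: dc. Qed.

Lemma loc_vec_trans (X : vfield M) c c' p : dom c p -> dom c' p ->
  loc_vec X c' (phi c' p) = loc_vec X c (phi c p) *m tmx c c' p.
Proof. by move=> cp c'p; rewrite !loc_vecE// -mulmxA tmx_comp//; exact: dc. Qed.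

Lemma loc_covE (a : covfield M) c p : dom c p ->
  loc_cov a c (phi c p) = tmx c (chart_at p) p *m a p.
Proof. by move=> cp; rewrite /loc_cov phiK// tmxE. Qed.

Lemma loc_biE (B : bifield M) c p : dom c p ->
  loc_bi B c (phi c p) = tmx c (chart_at p) p *m B p *m (tmx c (chart_at p) p)^T.
Proof. by move=> cp; rewrite /loc_bi phiK// tmxE. Qed.

Lemma ev1E (a : covfield M) (X : vfield M) c p : dom c p ->
  ev1 a p (X p) = (loc_vec X c (phi c p) *m loc_cov a c (phi c p)) 0 0.
Proof.
move=> cp; rewrite loc_vecE// loc_covE// /ev1 mulmxA -(mulmxA (X p)).
by rewrite tmx_comp ?tmx_id ?mulmx1//; exact: dc.
Qed.

Lemma ev2E (B : bifield M) (X Y : vfield M) c p : dom c p ->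
  ev2 B p (X p) (Y p) =
  (loc_vec X c (phi c p) *m loc_bi B c (phi c p) *m (loc_vec Y c (phi c p))^T) 0 0.
Proof.
move=> cp; rewrite !loc_vecE// loc_biE// /ev2 trmx_mul !mulmxA.
have dp := dc p.
rewrite -[in RHS](mulmxA (X p)) tmx_comp// tmx_id// mulmx1.
rewrite -[in RHS](mulmxA _ (tmx c (chart_at p) p)^T) -trmx_mul tmx_comp// tmx_id// trmx1 mulmx1.
by [].
Qed.

Lemma Ck_loc_fun k (f : M -> R) c : smooth_fun f -> Ck k (chart_image c) (loc_fun f c).
Proof. by move=> /(_ c)/smooth_onP. Qed.

Lemma Ckm_loc_vec k (X : vfield M) c : smooth_vec X -> Ckm k (chart_image c) (loc_vec X c).
Proof. by move=> /(_ c)/smooth_mx_onP. Qed.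

Lemma Ckm_loc_cov k (a : covfield M) c : smooth_cov a -> Ckm k (chart_image c) (loc_cov a c).
Proof. by move=> /(_ c)/smooth_mx_onP. Qed.

Lemma Ckm_loc_bi k (B : bifield M) c : smooth_bi B -> Ckm k (chart_image c) (loc_bi B c).
Proof. by move=> /(_ c)/smooth_mx_onP. Qed.

Lemma smooth_continuous (f : M -> R) : smooth_fun f -> continuous f.
Proof.
move=> sf p; set c := chart_at p; have cp : dom c p by exact: dc.
have cf : {for phi c p, continuous (loc_fun f c)}.
  by apply: Ck_cont (Ck_loc_fun 0 c sf) _ _; exists p.
have h : (loc_fun f c \o phi c) @ p --> f p.
  rewrite -[f p](_ : (loc_fun f c \o phi c) p = _); last by rewrite /loc_fun /= phiK.
  by apply: continuous_comp => //; exact: phi_continuous.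
apply: cvg_trans h; apply: near_eq_cvg.
by apply: (near_open (dom_open c) cp) => q cq; rewrite /loc_fun /= phiK.
Qed.

Lemma vderE (X : vfield M) (f : M -> R) c p : smooth_fun f -> dom c p ->
  vder X f p = 'D_(loc_vec X c (phi c p)) (loc_fun f c) (phi c p).
Proof.
move=> sf cp; rewrite /vder; set c0 := chart_at p; have c0p : dom c0 p := dc p.
rewrite (loc_vecE _ cp) (tmx_derive _ c0p cp).
have d1 := differentiable_tau c0p cp.
have d2 : differentiable (loc_fun f c) (phi c p).
  by apply: (Ck_differentiable (open_chart_image c) (Ck_loc_fun 1 c sf)); exists p.
rewrite -(tau_phi c c0p) in d2 *; rewrite -(derive_comp _ d1 d2).
apply: near_eq_derive.
apply: (near_open (open_chart_im c0 _ (dom_open c))); first exact: chart_imP.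
by move=> y [q [cq c'q] <-]; rewrite /loc_fun /= !tau_phi// !phiK.
Qed.

(** With J the jacobian of the change of chart, the product rule adds
the term Y (d_X J) to the derivative of Y along X. It is symmetric in X and Y,
because the second derivatives of the change of chart are. *)
Lemma bracket_chart (X Y : vfield M) c c' p : smooth_vec X -> smooth_vec Y ->
  dom c p -> dom c' p ->
  'D_(loc_vec X c' (phi c' p)) (loc_vec Y c') (phi c' p)
  - 'D_(loc_vec Y c' (phi c' p)) (loc_vec X c') (phi c' p) =
  ('D_(loc_vec X c (phi c p)) (loc_vec Y c) (phi c p)
  - 'D_(loc_vec Y c (phi c p)) (loc_vec X c) (phi c p)) *m tmx c c' p.
Proof.
move=> sX sY cp c'p; set x := phi c p.
pose U := chart_im c (dom c').
have oU : open U := open_chart_im c _ (dom_open c').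
have Ux : U x by exact: chart_imP.
pose J (y : 'rV[R]_n) := 'J (tau c c') y.
have HJ k : Ckm k U J by exact: Ckm_jacobian oU (@Ckm_tau k.+1 c c').
have UI : U `<=` chart_image c by rewrite -chart_imT; apply: chart_im_sub => q _.
have HV (Z : vfield M) k : smooth_vec Z -> Ckm k U (loc_vec Z c).
  by move=> sZ; apply: Ckm_sub UI _; exact: Ckm_loc_vec.
have key (Z T : vfield M) : smooth_vec Z -> smooth_vec T ->
  'D_(loc_vec Z c' (phi c' p)) (loc_vec T c') (phi c' p) =
  'D_(loc_vec Z c x) (loc_vec T c) x *m tmx c c' p +
  loc_vec T c x *m 'D_(loc_vec Z c x) J x.
  move=> sZ sT.
  have d1 := differentiable_tau cp c'p.
  have d2 : differentiable (loc_vec T c') (tau c c' x).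
    rewrite (tau_phi c' cp).
    by apply: (Ckm_differentiable (open_chart_image c') (Ckm_loc_vec 1 c' sT)); exists p.
  have e1 : loc_vec Z c' (phi c' p) = 'D_(loc_vec Z c x) (tau c c') x.
    by rewrite (loc_vec_trans Z cp c'p) (tmx_derive _ cp c'p).
  have e2 : tmx c c' p = J x by exact: tmxJ.
  have e3 := derive_comp (loc_vec Z c x) d1 d2.
  rewrite (tau_phi c' cp) in e3.
  have e4 := derive_mulmx (loc_vec Z c x) oU (HV T 1%N sT) (HJ 1%N) Ux.
  rewrite e2; refine (etrans _ e4).
  rewrite e1; refine (etrans (esym e3) _).
  apply: near_eq_derive.
  apply: (near_open oU Ux) => y [q [cq c'q] <-].
  change (loc_vec T c' (tau c c' (phi c q)) = loc_vec T c (phi c q) *m J (phi c q)).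
  rewrite (tau_phi c' cq); refine (etrans (loc_vec_trans T cq c'q) _).
  by rewrite tmxJ.
have [P [sym symP]] : exists P : 'I_n -> 'I_n -> 'rV[R]_n,
    (forall u v : 'rV[R]_n, u *m 'D_v J x = \sum_i \sum_j (u 0 i * v 0 j) *: P i j)
    /\ forall i j, P i j = P j i.
  exists (fun i j => \row_l partial j (partial i (fun y => tau c c' y 0 l)) x); split.
    move=> u v.
    rewrite (derive_mx_sum _ oU (HJ 1%N) Ux) mulmx_sumr exchange_big /=.
    apply: eq_bigr => j _; rewrite -scalemxAr mulmx_sum_row scaler_sumr.
    apply: eq_bigr => i _; rewrite scalerA mulrC; congr (_ *: _).
    have [_ ->] := derive_mxE (delta_mx 0 j) oU (HJ 1%N) Ux.
    apply/rowP => l; rewrite !mxE; apply: (derive_ext _ oU Ux) => y Uy.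
    by rewrite /J (jacobianE _ _ oU (@Ckm_tau 1 c c') Uy).
  move=> i j; apply/rowP => l.
  have e := partial_comm j i oU (@Ckm_tau 2 c c' 0 l) Ux.
  exact: (etrans (mxE _ _ _ _) (etrans e (esym (mxE _ _ _ _)))).
have symC (u v : 'rV[R]_n) : u *m 'D_v J x = v *m 'D_u J x.
  rewrite !sym exchange_big /=; apply: eq_bigr => i _; apply: eq_bigr => j _.
  by rewrite mulrC symP.
have k1 := key X Y sX sY.
have k2 := etrans (key Y X sY sX) (congr1
  (fun z => 'D_(loc_vec Y c x) (loc_vec X c) x *m tmx c c' p + z) (symC _ _)).
refine (etrans (congr2 (fun a b => a - b) k1 k2) _).
have alg (a b s : 'rV[R]_n) (t : 'M[R]_n) : (a *m t + s) - (b *m t + s) = (a - b) *m t.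
  by rewrite mulmxBl opprD addrACA subrr addr0.
exact: alg.
Qed.

Lemma lie_bracketE (X Y : vfield M) c p : smooth_vec X -> smooth_vec Y -> dom c p ->
  lie_bracket X Y p = ('D_(loc_vec X c (phi c p)) (loc_vec Y c) (phi c p)
  - 'D_(loc_vec Y c (phi c p)) (loc_vec X c) (phi c p)) *m tmx c (chart_at p) p.
Proof.
move=> sX sY cp; rewrite -(bracket_chart sX sY cp (dc p)) !loc_vec_chart_at.
by [].
Qed.

End Charts.

Arguments open_chart_im {R n M} c W _.
Arguments open_chart_image {R n M} c.

(** * Bump functions and partitions of unity *)

Section SmoothFunctions.
Variables (R : realType) (n : nat) (M : smooth_manifold R n).
Implicit Types (c : chart_index M) (W : set M) (p q : M) (f g : M -> R).

Definition smooth_in W f : Prop := forall k c, Ck k (chart_im c W) (loc_fun f c).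

Lemma smooth_in_smooth f : smooth_in setT f <-> smooth_fun f.
Proof.
split=> [H c|H k c]; last by rewrite chart_imT; exact: Ck_loc_fun.
by apply/smooth_onP => k; have := H k c; rewrite chart_imT.
Qed.

(** The sets W need not be open, as in [Ck_local]. *)
Lemma smooth_in_local f : (forall p, exists2 W, W p & smooth_in W f) -> smooth_fun f.
Proof.
move=> H; apply/smooth_in_smooth => k c; apply: Ck_local => x /chart_im_psi[cx _ E].
have [W Wx HW] := H (psi c x); exists (chart_im c W); last exact: HW.
by rewrite -E; exact: chart_imP.
Qed.

Lemma smooth_in_sub W W' f : W `<=` W' -> smooth_in W' f -> smooth_in W f.
Proof. by move=> WW H k c; apply: Ck_sub (H k c); exact: chart_im_sub. Qed.

Lemma smooth_in_ext W f g : open W -> (forall p, W p -> f p = g p) -> smooth_in W f -> smooth_in W g.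
Proof.
move=> oW fg H k c; apply: (Ck_ext (open_chart_im c _ oW) _ (H k c)).
by move=> x /chart_im_psi[_ Wx _]; exact: fg.
Qed.

Lemma smooth_in_cst W (a : R) : smooth_in W (fun=> a).
Proof. by move=> k c; exact: Ck_cst. Qed.

Lemma smooth_in_sum W (I : Type) (r : seq I) (F : I -> M -> R) : open W ->
  (forall i, smooth_in W (F i)) -> smooth_in W (fun p => \sum_(i <- r) F i p).
Proof.
move=> oW H k c.
exact: (Ck_sum r xpredT (open_chart_im c _ oW) (fun i => H i k c)).
Qed.

Lemma smooth_in_prod W (I : Type) (r : seq I) (F : I -> M -> R) : open W ->
  (forall i, smooth_in W (F i)) -> smooth_in W (fun p => \prod_(i <- r) F i p).
Proof.
move=> oW H k c.
exact: (Ck_prod r xpredT (open_chart_im c _ oW) (fun i => H i k c)).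
Qed.

Lemma smooth_in_mul W f g : open W -> smooth_in W f -> smooth_in W g -> smooth_in W (fun p => f p * g p).
Proof. by move=> oW Hf Hg k c; exact: Ck_mul (open_chart_im c _ oW) (Hf k c) (Hg k c). Qed.

Lemma smooth_in_sub_fun W f g : open W -> smooth_in W f -> smooth_in W g -> smooth_in W (fun p => f p - g p).
Proof. by move=> oW Hf Hg k c; exact: Ck_sub_fun (open_chart_im c _ oW) (Hf k c) (Hg k c). Qed.

Lemma smooth_in_inv W f : open W -> (forall p, W p -> f p != 0) -> smooth_in W f ->
  smooth_in W (fun p => (f p)^-1).
Proof.
move=> oW f0 Hf k c; apply: Ck_inv (open_chart_im c _ oW) _ (Hf k c).
by move=> x /chart_im_psi[_ Wx _]; exact: f0.
Qed.

Lemma smooth_in_flat W f m : open W -> smooth_in W f -> smooth_in W (fun p => flat m (f p)).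
Proof. by move=> oW Hf k c; exact: Ck_flat (open_chart_im c _ oW) (Hf k c). Qed.

Lemma smooth_in_chart c0 (b : 'rV[R]_n -> R) : (forall k, Ck k setT b) ->
  smooth_in (dom c0) (fun q => b (phi c0 q)).
Proof.
move=> Hb k c.
apply: (Ck_comp (open_chart_im c _ (dom_open c0)) (@openT _) _ (Hb k)) => // j.
exact: Ckm_tau.
Qed.

End SmoothFunctions.

Section Bump.
Variables (R : realType) (n : nat).
Implicit Types (x y : 'rV[R]_n).

(** A product over the coordinates, so that the support is a cube: a ball
for the norm of row vectors, which is the maximum norm. *)
Definition bump x (r : R) y : R := \prod_i flat 0 (r ^+ 2 - (y 0 i - x 0 i) ^+ 2).

Lemma bump_ge0 x r y : 0 <= bump x r y.
Proof. by apply: prodr_ge0 => i _; exact: flat_ge0. Qed.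

Lemma bump_gt0 x r : 0 < r -> 0 < bump x r x.
Proof.
by move=> r0; apply: prodr_gt0 => i _; rewrite subrr expr0n subr0 flat_gt0 exprn_gt0.
Qed.

Lemma bump_out x r y : 0 < r -> bump x r y != 0 -> `|y - x| <= r.
Proof.
move=> r0 b0; apply: mx_norm_le; first exact: ltW.
move=> i j; rewrite ord1 !mxE leNgt; apply: contraNN b0 => rj.
rewrite /bump (bigD1 j)//= flat_le0 ?mul0r// subr_le0 -[leRHS]real_normK ?num_real//.
by rewrite ler_sqr ?nnegrE ?normr_ge0 ?(ltW r0)// ltW.
Qed.

Lemma Ck_bump k x r : Ck k setT (bump x r).
Proof.
have oT : open [set: 'rV[R]_n] by exact: openT.
apply: Ck_prod => // i; apply: Ck_flat => //; apply: Ck_sub_fun => //; first exact: Ck_cst.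
have H : Ck k setT (fun y : 'rV[R]_n => y 0 i - x 0 i).
  by apply: Ck_sub_fun => //; [exact: Ck_coord|exact: Ck_cst].
by apply: (Ck_ext oT _ (Ck_mul oT H H)) => y _; rewrite expr2.
Qed.

End Bump.

Section BumpOnManifold.
Variables (R : realType) (n : nat) (M : smooth_manifold R n).

Lemma compact_mx_ball (x : 'rV[R]_n) (r : R) : compact [set y | `|y - x| <= r].
Proof.
apply: bounded_closed_compact.
  exists (r + `|x|); split; first exact: num_real.
  move=> e re y /= yr; apply: le_trans (ltW re).
  by rewrite -[y](subrK x); apply: le_trans (ler_normD _ _) _; rewrite lerD2r.
rewrite (_ : [set y | _] = (fun y => `|y - x|) @^-1` [set t | t <= r])//.
apply: preimage_closed; last exact: closed_le.
move=> y _; have h : (y' - x) @[y' --> y] --> y - x.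
  by apply: (@cvgB _ _ _ (nbhs y)); [exact: cvg_id|exact: cvg_cst].
exact: (@cvg_norm _ _ _ (nbhs y) _ _ _ h).
Qed.

(** The support of the bump is the image of a compact cube in the chart.
It is compact, hence closed since M is Hausdorff, so the extension by 0 is
smooth. *)
Lemma exists_bump (p : M) : exists f : M -> R,
  [/\ smooth_fun f, forall q, 0 <= f q, 0 < f p &
   forall q, ~ dom (chart_at p) q -> exists2 W, open W /\ W q & forall q', W q' -> f q' = 0].
Proof.
pose c := chart_at p; pose x := phi c p.
have cp : dom c p by exact: dom_chart_at.
have Ix : chart_image c x by exists p.
have : nbhs x (chart_image c) by apply: open_nbhs_nbhs; split => //; exact: open_chart_image.
case/nbhs_ballP => e /= e0 He.
pose r := e / 2; have r0 : 0 < r by rewrite divr_gt0.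
pose K0 : set 'rV[R]_n := [set y | `|y - x| <= r].
have K0I : K0 `<=` chart_image c.
  move=> y yr; apply: He; rewrite -ball_normE /= distrC; apply: le_lt_trans yr _.
  by rewrite /r ltr_pdivrMr// ltr_pMr// ltr1n.
pose K : set M := psi c @` K0.
have cK : closed K.
  apply: compact_closed; first exact: manifold_hausdorff.
  apply: continuous_compact; last exact: compact_mx_ball.
  apply: continuous_in_subspaceT => y; rewrite inE => /K0I Iy.
  exact: psi_continuous Iy.
have Kc : K `<=` dom c by move=> q [y /K0I[q' cq' <-] <-]; rewrite phiK.
pose f q := if `[< dom c q >] then bump x r (phi c q) else 0.
have fc q : dom c q -> f q = bump x r (phi c q) by move=> cq; rewrite /f asboolT.
have fK q : ~ K q -> f q = 0.
  move=> nK; rewrite /f; case: asboolP => // cq; apply/eqP; apply: contrapT => /negP b0.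
  by apply: nK; exists (phi c q); [exact: bump_out b0|exact: phiK].
exists f; split.
- apply: smooth_in_local => q; have [cq|ncq] := pselect (dom c q).
    exists (dom c) => //; apply: smooth_in_ext (smooth_in_chart c (fun k => Ck_bump k x r)).
      exact: dom_open.
    by move=> q' cq'; rewrite fc.
  exists (~` K); first by move=> /Kc.
  apply: smooth_in_ext (@smooth_in_cst _ _ _ _ 0); first exact: closed_openC.
  by move=> q' /fK.
- by move=> q; rewrite /f; case: ifP => // _; exact: bump_ge0.
- by rewrite fc//; exact: bump_gt0.
- move=> q ncq; exists (~` K); last by move=> q' /fK.
  by split; [exact: closed_openC|move=> /Kc].
Qed.

End BumpOnManifold.

Section PartitionOfUnity.
Variables (R : realType) (n : nat) (M : smooth_manifold R n).

Definition locally_finite (w : nat -> M -> R) : Prop :=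
  forall p, exists N, exists2 W, open W /\ W p &
    forall q k, W q -> (N <= k)%N -> w k q = 0.

(** By second countability, countably many bumps F k suffice to be
positive somewhere at each point. Put g k = F k * prod_(j < k) flat 0 (1/(k+1) - F j).
Near a point where F m > t > 0, all g k with k > m and 1/(k+1) < t vanish, so the
family is locally finite. At any given point, g k > 0 for the first k with
F k > 0, as all factors are then flat 0 (1/(k+1)). Dividing by the sum ends the
construction. *)
Lemma exists_pou (p0 : M) : exists (w : nat -> M -> R) (ck : nat -> chart_index M),
  [/\ forall k, smooth_fun (w k), forall k p, 0 <= w k p,
      forall k q, ~ dom (ck k) q -> exists2 W, open W /\ W q & forall q', W q' -> w k q' = 0,
      locally_finite w
    & forall p N, (forall k, (N <= k)%N -> w k p = 0) -> \sum_(k < N) w k p = 1].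
Proof.
have [f Hf] := choice (@exists_bump R n M).
have sf p : smooth_fun (f p) by have [] := Hf p.
have f0 p q : 0 <= f p q by have [_ + _ _] := Hf p.
have fp p : 0 < f p p by have [_ _ + _] := Hf p.
have of_ p : open [set q | 0 < f p q].
  rewrite (_ : [set q | _] = f p @^-1` [set t | 0 < t])//.
  apply: open_comp; last exact: open_gt.
  by move=> q _; exact: smooth_continuous (sf _) q.
have [B cB [Bo Bb]] := @manifold_second_countable R n M.
have /countable_injP[e einj] := cB.
(* Countably many of the f p cover M: one is kept for each basic open set. *)
pose P k p := exists2 U, B U /\ e U = k & U `<=` [set q | 0 < f p q].
have [pk Hpk] : exists pk : nat -> M, forall k, (exists p, P k p) -> P k (pk k).
  exists (fun k => xget p0 (P k)) => k [p Pp]; case: xgetP => [y -> //|] /(_ p).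
  by [].
pose F k := f (pk k).
have cov q : exists k, 0 < F k q.
  have : nbhs q [set q' | 0 < f q q'] by apply: open_nbhs_nbhs; split; [exact: of_|exact: fp].
  case/Bb => U [BU Uq] UV; exists (e U).
  have [|U' [BU' eU'] U'V] := Hpk (e U).
    by exists q, U.
  have EU : U' = U by apply: einj; rewrite ?inE.
  by apply: U'V; rewrite EU.
pose g k q := F k q * \prod_(j < k) flat 0 (k.+1%:R^-1 - F j q).
have g0 k q : 0 <= g k q.
  by rewrite mulr_ge0 ?f0// prodr_ge0// => j _; exact: flat_ge0.
have sg k : smooth_in setT (g k).
  apply: smooth_in_mul; [exact: openT|exact: (smooth_in_smooth _).2 (sf _)|].
  apply: smooth_in_prod; first exact: openT.
  move=> j; apply: smooth_in_flat; first exact: openT.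
  by apply: smooth_in_sub_fun; [exact: openT|exact: smooth_in_cst|exact: (smooth_in_smooth _).2 (sf _)].
have lf : locally_finite g.
  move=> p; have [m Fm] := cov p.
  pose t := F m p / 2; have t0 : 0 < t by rewrite divr_gt0.
  have [N _ HN] := near_infty_natSinv_lt (PosNum t0).
  exists (maxn N m.+1), [set q | t < F m q].
    split; last by rewrite /t /= ltr_pdivrMr// ltr_pMr// ltr1n.
    rewrite (_ : [set q | _] = F m @^-1` [set u | t < u])//.
    apply: open_comp; last exact: open_gt.
    by move=> q _; exact: smooth_continuous (sf _) q.
  move=> q k /= tq; rewrite geq_max => /andP[Nk mk].
  rewrite /g (bigD1 (Ordinal mk))//= flat_le0 ?mul0r ?mulr0// subr_le0.
  apply: ltW; apply: lt_trans tq; exact: HN.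
have gpos q : exists k, 0 < g k q.
  have ex : exists k, 0 < F k q by exact: cov.
  case: (ex_minnP ex) => k Fk mink; exists k; rewrite mulr_gt0// prodr_gt0// => j _.
  have Fj : F j q = 0.
    apply/eqP; rewrite eq_le f0 andbT leNgt; apply/negP => /mink.
    by rewrite leqNgt ltn_ord.
  by rewrite Fj subr0 flat_gt0 invr_gt0.
have sumE q N N' : (forall k, (N <= k)%N -> g k q = 0) -> (forall k, (N' <= k)%N -> g k q = 0) ->
    \sum_(k < N) g k q = \sum_(k < N') g k q.
  wlog NN : N N' / (N <= N')%N => [th|] HN HN'.
    have [|/ltnW] := leqP N N' => h; first exact: th.
    by apply/esym; exact: th.
  rewrite -!(big_mkord xpredT (fun k => g k q)) (big_cat_nat _ NN)//= [X in _ + X]big1_seq ?addr0//.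
  by move=> k /andP[_]; rewrite mem_index_iota => /andP[Nk _]; exact: HN.
have exN q : exists N, forall k, (N <= k)%N -> g k q = 0.
  by have [N [W [_ Wq] HW]] := lf q; exists N => k; exact: HW.
have [Nf HNf] := choice exN.
pose S q := \sum_(k < Nf q) g k q.
have Spos q : 0 < S q.
  have [k gk] := gpos q.
  have kN : (k < Nf q)%N by rewrite ltnNge; apply/negP => /HNf gk0; rewrite gk0 ltxx in gk.
  rewrite /S (bigD1 (Ordinal kN))//= ltr_wpDr//.
  by apply: sumr_ge0 => j _; exact: g0.
have sS : smooth_in setT S.
  apply/smooth_in_smooth; apply: smooth_in_local => p; have [N [W [oW Wp] HW]] := lf p.
  exists W => //; apply: (@smooth_in_ext _ _ _ W (fun q => \sum_(k < N) g k q)) => //.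
    by move=> q Wq; apply: sumE => [k|]; [exact: HW|exact: HNf].
  by apply: smooth_in_sum => // k; apply: smooth_in_sub (sg k).
exists (fun k q => g k q / S q), (fun k => chart_at (pk k)); split.
- move=> k; apply/smooth_in_smooth; apply: smooth_in_mul => //; first exact: openT.
  apply: smooth_in_inv => //; first exact: openT.
  by move=> q _; rewrite gt_eqF.
- by move=> k q; rewrite divr_ge0// ltW.
- move=> k q ncq; have [_ _ _ /(_ q ncq)[W oW HW]] := Hf (pk k).
  by exists W => // q' /HW Fk; rewrite /g /F Fk !mul0r.
- move=> p; have [N [W oW HW]] := lf p; exists N, W => // q k Wq Nk.
  by rewrite HW// mul0r.
- move=> p N HN; rewrite -mulr_suml (sumE _ _ (Nf p)); first by rewrite -/(S p) mulfV// (gt_eqF (Spos p)).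
    move=> k /HN /eqP; rewrite mulf_eq0 invr_eq0 (gt_eqF (Spos p)) orbF.
    by move/eqP.
  exact: HNf.
Qed.

End PartitionOfUnity.

(** * Gluing metrics and connections *)

Section ConnAlgebra.
Variables (R : realType) (n : nat).
Implicit Types (a b y z : 'rV[R]_n) (A B : 'M[R]_n) (r s : R).

Lemma conn_alg_linl r a b y A B :
  r *: a + b + y *m (r *: A + B) = r *: (a + y *m A) + (b + y *m B).
Proof. by rewrite mulmxDr -scalemxAr scalerDr addrACA. Qed.

Lemma conn_alg_add r a b y z A :
  r *: a + b + (r *: y + z) *m A = r *: (a + y *m A) + (b + z *m A).
Proof. by rewrite mulmxDl -scalemxAl scalerDr addrACA. Qed.

Lemma conn_alg_leibniz r s a y A :
  s *: y + r *: a + r *: y *m A = s *: y + r *: (a + y *m A).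
Proof. by rewrite -scalemxAl scalerDr addrA. Qed.

Lemma conn_alg_torsion a b y : a + y - (b + y) = a - b.
Proof. by rewrite opprD addrACA subrr addr0. Qed.

End ConnAlgebra.

Section Glue.
Variables (R : realType) (n : nat) (M : smooth_manifold R n).
Variables (w : nat -> M -> R) (ck : nat -> chart_index M).
Implicit Types (c : chart_index M) (p q : M) (X Y Z : vfield M).

Definition is_pou : Prop :=
  [/\ forall k, smooth_fun (w k), forall k p, 0 <= w k p,
      forall k q, ~ dom (ck k) q -> exists2 W, open W /\ W q & forall q', W q' -> w k q' = 0,
      locally_finite w
    & forall p N, (forall k, (N <= k)%N -> w k p = 0) -> \sum_(k < N) w k p = 1].

(** Any bound N valid at p would do: see [glueE]. *)
Definition support_bound p : nat :=
  xget 0%N [set N | forall k, (N <= k)%N -> w k p = 0].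

Definition glue (V : lmodType R) (F : nat -> M -> V) p : V :=
  \sum_(k < support_bound p) w k p *: F k p.

Variable (pou : is_pou).

Lemma support_boundP p k : (support_bound p <= k)%N -> w k p = 0.
Proof.
rewrite /support_bound; case: xgetP => [N _ HN|noN _]; first exact: HN.
have [_ _ _ /(_ p)[N [W [_ Wp] HW]] _] := pou.
by case: (noN N) => k' Nk'; exact: HW.
Qed.

Lemma w_dom k p : w k p != 0 -> dom (ck k) p.
Proof.
move=> wk; apply: contrapT => nd; have [_ _ + _ _] := pou.
by move=> /(_ k p nd)[W [_ Wp] HW]; rewrite HW// eqxx in wk.
Qed.

Lemma glueE (V : lmodType R) (F : nat -> M -> V) p N :
  (forall k, (N <= k)%N -> w k p = 0) -> glue F p = \sum_(k < N) w k p *: F k p.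
Proof.
move=> HN; rewrite /glue; have HB := @support_boundP p.
move: (support_bound p) HB => B HB.
wlog BN : N B HN HB / (B <= N)%N => [th|].
  have [|/ltnW] := leqP B N => h; first exact: th.
  by apply/esym; exact: th.
rewrite -!(big_mkord xpredT (fun k => w k p *: F k p)) (big_cat_nat _ BN)//=.
rewrite [X in _ + X]big1_seq ?addr0//.
by move=> k /andP[_]; rewrite mem_index_iota => /andP[Nk _]; rewrite HB// scale0r.
Qed.

Lemma eq_glue (V : lmodType R) (F G : nat -> M -> V) p :
  (forall k, dom (ck k) p -> F k p = G k p) -> glue F p = glue G p.
Proof.
move=> FG; apply: eq_bigr => k _; have [->|/w_dom/FG->//] := eqVneq (w k p) 0.
by rewrite !scale0r.
Qed.

Lemma glue_cst (V : lmodType R) (v : V) p : glue (fun _ _ => v) p = v.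
Proof.
have [_ _ _ _ /(_ p _ (@support_boundP p)) S1] := pou.
by rewrite /glue -scaler_suml S1 scale1r.
Qed.

Lemma glueD (V : lmodType R) (F G : nat -> M -> V) p :
  glue (fun k q => F k q + G k q) p = glue F p + glue G p.
Proof. by rewrite /glue -big_split; apply: eq_bigr => k _; rewrite scalerDr. Qed.

Lemma glueZ (V : lmodType R) (a : R) (F : nat -> M -> V) p :
  glue (fun k q => a *: F k q) p = a *: glue F p.
Proof. by rewrite /glue scaler_sumr; apply: eq_bigr => k _; rewrite !scalerA mulrC. Qed.

Lemma glueB (V : lmodType R) (F G : nat -> M -> V) p :
  glue (fun k q => F k q - G k q) p = glue F p - glue G p.
Proof. by rewrite /glue -sumrB; apply: eq_bigr => k _; rewrite scalerBr. Qed.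

Lemma glue_mulr a b d (F : nat -> M -> 'M[R]_(a, b)) (T : 'M[R]_(b, d)) p :
  glue F p *m T = glue (fun k q => F k q *m T) p.
Proof. by rewrite mulmx_suml; apply: eq_bigr => k _; rewrite scalemxAl. Qed.

Lemma glue_mull a b d (F : nat -> M -> 'M[R]_(a, b)) (T : 'M[R]_(d, a)) p :
  T *m glue F p = glue (fun k q => T *m F k q) p.
Proof. by rewrite mulmx_sumr; apply: eq_bigr => k _; rewrite scalemxAr. Qed.

Lemma glue_entry a b (F : nat -> M -> 'M[R]_(a, b)) p i j :
  glue F p i j = glue (fun k q => F k q i j : R^o) p.
Proof. by rewrite summxE; apply: eq_bigr => k _; rewrite mxE. Qed.

Lemma Ckm_glue j a b (F : nat -> M -> 'M[R]_(a, b)) c :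
  (forall k, Ckm j (chart_im c (dom (ck k))) (fun x => F k (psi c x))) ->
  Ckm j (chart_image c) (fun x => glue F (psi c x)).
Proof.
move=> HF; rewrite -chart_imT; apply: Ckm_local => x /chart_im_psi[cp _ E].
set p := psi c x in cp E; have [sw _ zw lf _] := pou.
have [N [W [oW Wp] HW]] := lf p.
exists (chart_im c W); first by rewrite -E; exact: chart_imP.
have oU := open_chart_im c _ oW.
apply: (Ckm_ext (F := fun x => \sum_(k < N) w k (psi c x) *: F k (psi c x)) oU).
  by move=> y /chart_im_psi[_ Wy _]; rewrite (@glueE _ F _ N)// => k; exact: HW.
apply: Ckm_sum => // k; apply: Ckm_local => y /chart_im_psi[cq Wq Eq].
set q := psi c y in cq Wq Eq.
have [dq|ndq] := pselect (dom (ck k) q).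
  exists (chart_im c (dom (ck k))); first by rewrite -Eq; exact: chart_imP.
  have oV := open_chart_im c _ (dom_open (ck k)).
  have Hw : Ck j (chart_im c (dom (ck k))) (loc_fun (w k) c).
    apply: (Ck_sub _ (Ck_loc_fun j c (sw k))); rewrite -chart_imT.
    by apply: chart_im_sub => q' _.
  exact: Ckm_scale oV Hw (HF k).
have [W' [oW' Wq'] HW'] := zw k q ndq.
exists (chart_im c W'); first by rewrite -Eq; exact: chart_imP.
apply: (Ckm_ext (F := fun=> 0) (open_chart_im c _ oW')); last exact: Ckm_cst.
by move=> z /chart_im_psi[_ Wz _]; rewrite HW'// scale0r.
Qed.

(** In the chart [ck k], the Euclidean metric has the identity matrix; its
matrix in another chart is a product of a jacobian and its transpose. *)
Definition glued_metric : bifield M := fun p =>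
  glue (fun k q => tmx (chart_at q) (ck k) q *m (tmx (chart_at q) (ck k) q)^T) p.

Lemma loc_glued_metric c p : dom c p -> loc_bi glued_metric c (phi c p) =
  glue (fun k q => tmx c (ck k) q *m (tmx c (ck k) q)^T) p.
Proof.
move=> cp; rewrite loc_biE// glue_mull glue_mulr; apply: eq_glue => k kp.
have dp := dom_chart_at p.
by rewrite mulmxA tmx_comp// -mulmxA -trmx_mul tmx_comp.
Qed.

Lemma smooth_glued_metric : smooth_bi glued_metric.
Proof.
move=> c; apply/smooth_mx_onP => j.
apply: (Ckm_ext (open_chart_image c) _ (Ckm_glue
  (F := fun k q => tmx c (ck k) q *m (tmx c (ck k) q)^T) _)).
  by move=> x [p cp <-]; rewrite phiK// loc_glued_metric.
move=> k; have oU := open_chart_im c _ (dom_open (ck k)).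
by apply: Ckm_mul => //; [|apply: Ckm_tr => //]; exact: Ckm_transition.
Qed.

Lemma posdef_glued_metric p : posdef (glued_metric p).
Proof.
have [_ w0 _ _ s1] := pou; have SB := @support_boundP p; have {}s1 := s1 p _ SB.
have dp := dom_chart_at p.
split.
  by rewrite /glued_metric /glue raddf_sum; apply: eq_bigr => k _;
    rewrite /= linearZ /= trmx_mul trmxK.
move=> v v0.
have -> : qf (glued_metric p) v = \sum_(k < support_bound p)
    w k p * qf (tmx (chart_at p) (ck k) p *m (tmx (chart_at p) (ck k) p)^T) v.
  rewrite /qf /glued_metric glue_mull glue_mulr glue_entry; apply: eq_bigr => k _.
  by [].
have nn k : true -> 0 <= w k p * qf (tmx (chart_at p) (ck k) p *m (tmx (chart_at p) (ck k) p)^T) v.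
  move=> _; have [->|wk] := eqVneq (w k p) 0; first by rewrite mul0r.
  rewrite mulr_ge0//; apply: posdef_ge0; apply: posdef_gram.
  by apply: tmx_unit => //; exact: w_dom.
rewrite lt_neqAle eq_sym sumr_ge0 ?andbT; last by move=> k _; exact: nn.
apply/eqP => /(psumr_eq0P (fun (k : 'I_(support_bound p)) _ => nn k isT)) H.
have : \sum_(k < support_bound p) w k p = 0.
  apply: big1 => k _; have [//|wk] := eqVneq (w k p) 0.
  have /eqP := H k isT; rewrite mulf_eq0 (negPf wk) /=.
  have pk : posdef (tmx (chart_at p) (ck k) p *m (tmx (chart_at p) (ck k) p)^T).
    by apply: posdef_gram; apply: tmx_unit => //; exact: w_dom.
  by rewrite gt_eqF// pk.2.
by rewrite s1 => /eqP; rewrite oner_eq0.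
Qed.

(** Christoffel symbols on the chart c: [A x u] is the matrix of
Y |-> Gamma(u, Y) at x. Smoothness is stated through the vector fields V that are
plugged in. *)
Definition conn_form c (A : 'rV[R]_n -> 'rV[R]_n -> 'M[R]_n) : Prop :=
  (forall j V, Ckm j (chart_image c) V -> Ckm j (chart_image c) (fun x => A x (V x)))
  /\ forall x r u v, chart_image c x -> A x (r *: u + v) = r *: A x u + A x v.

Definition loc_conn c (A : 'rV[R]_n -> 'rV[R]_n -> 'M[R]_n) X Y (x : 'rV[R]_n) : 'rV[R]_n :=
  'D_(loc_vec X c x) (loc_vec Y c) x + loc_vec Y c x *m A x (loc_vec X c x).

Variable A : nat -> 'rV[R]_n -> 'rV[R]_n -> 'M[R]_n.
Variable (cA : forall k, conn_form (ck k) (A k)).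

Definition glued_conn X Y : vfield M := fun p =>
  glue (fun k q => loc_conn (ck k) (A k) X Y (phi (ck k) q) *m tmx (ck k) (chart_at q) q) p.

Lemma loc_glued_conn X Y c p : dom c p -> loc_vec (glued_conn X Y) c (phi c p) =
  glue (fun k q => loc_conn (ck k) (A k) X Y (phi (ck k) q) *m tmx (ck k) c q) p.
Proof.
move=> cp; rewrite loc_vecE// glue_mulr; apply: eq_glue => k kp.
by rewrite -mulmxA tmx_comp//; exact: dom_chart_at.
Qed.

Lemma Ckm_loc_conn j k X Y : smooth_vec X -> smooth_vec Y ->
  Ckm j (chart_image (ck k)) (loc_conn (ck k) (A k) X Y).
Proof.
move=> sX sY; have oU := open_chart_image (ck k).
have HX := Ckm_loc_vec j (ck k) sX; have HY := Ckm_loc_vec j (ck k) sY.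
apply: Ckm_add => //.
  exact: (Ckm_derive oU (Ckm_loc_vec j.+1 (ck k) sY) HX).
by apply: Ckm_mul => //; exact: (cA k).1.
Qed.

Lemma smooth_glued_conn X Y : smooth_vec X -> smooth_vec Y -> smooth_vec (glued_conn X Y).
Proof.
move=> sX sY c; apply/smooth_mx_onP => j.
apply: (Ckm_ext (open_chart_image c) _ (Ckm_glue
  (F := fun k q => loc_conn (ck k) (A k) X Y (phi (ck k) q) *m tmx (ck k) c q) _)).
  by move=> x [p cp <-]; rewrite phiK// loc_glued_conn.
move=> k; have oU := open_chart_im c _ (dom_open (ck k)).
apply: Ckm_mul => //; last exact: Ckm_transition'.
apply: (Ckm_comp oU (open_chart_image (ck k)) _ (Ckm_loc_conn j k sX sY) (@Ckm_tau _ _ _ j c (ck k))).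
by move=> x; exact: tau_im0.
Qed.

Let phi_im c p : dom c p -> chart_image c (phi c p).
Proof. by move=> cp; exists p. Qed.

(** The weights sum up to 1, so connections that agree on X and Y are
glued into one with the same value. *)
Lemma glued_conn_eq X Y p (v : 'rV[R]_n) :
  (forall k, dom (ck k) p -> loc_conn (ck k) (A k) X Y (phi (ck k) p) = v *m tmx (chart_at p) (ck k) p) ->
  glued_conn X Y p = v.
Proof.
move=> H; rewrite -[RHS](glue_cst v p); apply: eq_glue => k kp.
have dp := dom_chart_at p.
by rewrite H// -mulmxA tmx_comp// tmx_id// mulmx1.
Qed.

Lemma loc_vec_comb (f : M -> R) X X' c p : dom c p ->
  loc_vec (fun q => f q *: X q + X' q) c (phi c p) =
  f p *: loc_vec X c (phi c p) + loc_vec X' c (phi c p).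
Proof. by move=> cp; rewrite !loc_vecE// mulmxDl scalemxAl. Qed.

Lemma loc_conn_linl k (f : M -> R) X X' Y p : smooth_vec Y -> dom (ck k) p ->
  loc_conn (ck k) (A k) (fun q => f q *: X q + X' q) Y (phi (ck k) p) =
  f p *: loc_conn (ck k) (A k) X Y (phi (ck k) p) + loc_conn (ck k) (A k) X' Y (phi (ck k) p).
Proof.
move=> sY kp; rewrite /loc_conn (loc_vec_comb f X X' kp).
rewrite (derive_lin _ _ _ (open_chart_image (ck k)) (Ckm_loc_vec 1 (ck k) sY) (phi_im kp)).
rewrite (cA k).2; last exact: phi_im.
exact: conn_alg_linl.
Qed.

Lemma loc_conn_add k (r : R) X Y Y' p : smooth_vec Y -> smooth_vec Y' -> dom (ck k) p ->
  loc_conn (ck k) (A k) X (fun q => r *: Y q + Y' q) (phi (ck k) p) =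
  r *: loc_conn (ck k) (A k) X Y (phi (ck k) p) + loc_conn (ck k) (A k) X Y' (phi (ck k) p).
Proof.
move=> sY sY' kp; have oU := open_chart_image (ck k); have Ix := phi_im kp.
have HY := Ckm_loc_vec 1 (ck k) sY; have HY' := Ckm_loc_vec 1 (ck k) sY'.
rewrite /loc_conn; set x := phi (ck k) p in Ix *; set u := loc_vec X (ck k) x.
have -> : 'D_u (loc_vec (fun q => r *: Y q + Y' q) (ck k)) x =
    r *: 'D_u (loc_vec Y (ck k)) x + 'D_u (loc_vec Y' (ck k)) x.
  transitivity ('D_u (fun y => r *: loc_vec Y (ck k) y + loc_vec Y' (ck k) y) x).
    apply: near_eq_derive; apply: (near_open oU Ix) => y [q kq <-].
    exact: (loc_vec_comb (fun=> r)).
  have [d1 _] := derive_mxE u oU HY Ix; have [d2 _] := derive_mxE u oU HY' Ix.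
  refine (etrans (deriveD (@derivableZ _ _ _ _ r _ _ d1) d2) _).
  by refine (congr1 (fun z => z + _) _); exact: deriveZ.
rewrite (loc_vec_comb (fun=> r) Y Y' kp).
exact: conn_alg_add.
Qed.

Lemma loc_conn_leibniz k (f : M -> R) X Y p : smooth_fun f -> smooth_vec Y -> dom (ck k) p ->
  loc_conn (ck k) (A k) X (fun q => f q *: Y q) (phi (ck k) p) =
  vder X f p *: loc_vec Y (ck k) (phi (ck k) p) + f p *: loc_conn (ck k) (A k) X Y (phi (ck k) p).
Proof.
move=> sf sY kp; have oU := open_chart_image (ck k); have Ix := phi_im kp.
have HY := Ckm_loc_vec 1 (ck k) sY; have Hf := Ck_loc_fun 1 (ck k) sf.
have lv q : dom (ck k) q -> loc_vec (fun q => f q *: Y q) (ck k) (phi (ck k) q) =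
    f q *: loc_vec Y (ck k) (phi (ck k) q).
  by move=> kq; rewrite !loc_vecE// scalemxAl.
rewrite (vderE X sf kp) /loc_conn (lv p kp).
set x := phi (ck k) p in Ix *; set u := loc_vec X (ck k) x.
have -> : 'D_u (loc_vec (fun q => f q *: Y q) (ck k)) x =
    'D_u (loc_fun f (ck k)) x *: loc_vec Y (ck k) x + f p *: 'D_u (loc_vec Y (ck k)) x.
  transitivity ('D_u (fun y => loc_fun f (ck k) y *: loc_vec Y (ck k) y) x).
    apply: near_eq_derive; apply: (near_open oU Ix) => y [q kq <-].
    by rewrite lv// /loc_fun /= phiK.
  rewrite (derive_scalemx _ oU Hf HY Ix); congr (_ + _ *: _).
  by rewrite /loc_fun /= phiK.
exact: conn_alg_leibniz.
Qed.

Lemma linear_glued_conn : linear_connection glued_conn.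
Proof.
have dp := @dom_chart_at _ _ M.
split.
- exact: smooth_glued_conn.
- move=> f X X' Y sf sX sX' sY p; rewrite /glued_conn -glueZ -glueD.
  apply: eq_glue => k kp; rewrite loc_conn_linl// mulmxDl scalemxAl.
  by [].
- move=> r X Y Y' sX sY sY' p; rewrite /glued_conn -glueZ -glueD.
  apply: eq_glue => k kp; rewrite loc_conn_add// mulmxDl scalemxAl.
  by [].
- move=> f X Y sf sX sY p; rewrite /glued_conn -(glue_cst (vder X f p *: Y p) p) -glueZ -glueD.
  apply: eq_glue => k kp; rewrite loc_conn_leibniz// mulmxDl -!scalemxAl; congr (_ *: _ + _).
  by rewrite loc_vecE// -mulmxA tmx_comp// tmx_id// mulmx1.
Qed.

(** The difference of the two derivatives in a chart is the Lie bracket,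
which transforms as a vector ([lie_bracketE]); the sum of the weights is 1. *)
Lemma torsion_free_glued_conn :
  (forall k x u v, chart_image (ck k) x -> u *m A k x v = v *m A k x u) ->
  torsion_free glued_conn.
Proof.
move=> symA X Y sX sY p; apply/eqP; rewrite subr_eq0; apply/eqP.
rewrite /glued_conn -glueB -[RHS](glue_cst _ p); apply: eq_glue => k kp.
rewrite (lie_bracketE sX sY kp) -mulmxBl; congr (_ *m _).
rewrite /loc_conn (symA k _ _ _ (phi_im kp)).
exact: conn_alg_torsion.
Qed.

End Glue.

(** * Duality *)

Section DualGlue.
Variables (R : realType) (n : nat) (M : smooth_manifold R n).
Variables (w : nat -> M -> R) (ck : nat -> chart_index M).
Variable (pou : is_pou w ck).
Implicit Types (X Y Z : vfield M) (p q : M).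

Lemma smooth_ev2 (g : bifield M) Y Z : smooth_bi g -> smooth_vec Y -> smooth_vec Z ->
  smooth_fun (fun q => ev2 g q (Y q) (Z q)).
Proof.
move=> sg sY sZ c; apply/smooth_onP => k; have oU := open_chart_image c.
apply: (Ck_ext oU (f := fun x => (loc_vec Y c x *m loc_bi g c x *m (loc_vec Z c x)^T) 0 0)).
  by move=> x [p cp <-]; rewrite /loc_fun /= phiK// (ev2E _ _ _ cp).
suff : Ckm k (chart_image c) (fun x => loc_vec Y c x *m loc_bi g c x *m (loc_vec Z c x)^T) by [].
apply: Ckm_mul => //; last by apply: Ckm_tr => //; exact: Ckm_loc_vec.
by apply: Ckm_mul => //; [exact: Ckm_loc_vec|exact: Ckm_loc_bi].
Qed.

Lemma smooth_ev1 (a : covfield M) Y : smooth_cov a -> smooth_vec Y ->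
  smooth_fun (fun q => ev1 a q (Y q)).
Proof.
move=> sa sY c; apply/smooth_onP => k; have oU := open_chart_image c.
apply: (Ck_ext oU (f := fun x => (loc_vec Y c x *m loc_cov a c x) 0 0)).
  by move=> x [p cp <-]; rewrite /loc_fun /= phiK// (ev1E _ _ cp).
suff : Ckm k (chart_image c) (fun x => loc_vec Y c x *m loc_cov a c x) by [].
by apply: Ckm_mul => //; [exact: Ckm_loc_vec|exact: Ckm_loc_cov].
Qed.

(** The product rule for y G z^T, when dG = A G + G A'^T. *)
Lemma dual_alg (y z dy dz : 'rV[R]_n) (G dG A A' : 'M[R]_n) :
  G^T = G -> dG = A *m G + G *m A'^T ->
  ((dy *m G + y *m dG) *m z^T + y *m G *m dz^T) 0 0 =
  ((dy + y *m A) *m G *m z^T) 0 0 + ((dz + z *m A') *m G *m y^T) 0 0.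
Proof.
move=> sG ->.
have -> : ((dz + z *m A') *m G *m y^T) 0 0 = (y *m G *m (dz + z *m A')^T) 0 0.
  have -> : y *m G *m (dz + z *m A')^T = ((dz + z *m A') *m G *m y^T)^T.
    by rewrite !trmx_mul trmxK sG mulmxA.
  by rewrite [RHS]mxE.
have -> : (dz + z *m A')^T = dz^T + A'^T *m z^T by rewrite linearD /= trmx_mul.
rewrite !(mulmxDl, mulmxDr) !mulmxA.
move: (dy *m G *m z^T) (y *m A *m G *m z^T) (y *m G *m A'^T *m z^T) (y *m G *m dz^T).
by move=> a b c e; rewrite !mxE; ring.
Qed.

(** In each chart the hypothesis on A' is duality for the coordinate
vector fields. Both sides of the global identity are averages, with the same
weights, of the two sides of these local identities. *)
Lemma dual_glued (g : bifield M) (A A' : nat -> 'rV[R]_n -> 'rV[R]_n -> 'M[R]_n) :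
  smooth_bi g -> (forall p, (g p)^T = g p) ->
  (forall k x u, chart_image (ck k) x ->
     'D_u (loc_bi g (ck k)) x = A k x u *m loc_bi g (ck k) x
                              + loc_bi g (ck k) x *m (A' k x u)^T) ->
  dual_connections g (glued_conn w ck A) (glued_conn w ck A').
Proof.
move=> sg gs HA X Y Z sX sY sZ p.
have ev2C u v : ev2 g p u v = ev2 g p v u.
  rewrite /ev2; have -> : v *m g p *m u^T = (u *m g p *m v^T)^T.
    by rewrite !trmx_mul trmxK gs mulmxA.
  by rewrite [RHS]mxE.
have evg (F : nat -> M -> 'rV[R]_n) (v : 'rV[R]_n) :
    ev2 g p (glue w F p) v = glue w (fun k q => ev2 g p (F k q) v : R^o) p.
  by rewrite /ev2 !glue_mulr glue_entry.
rewrite [in X in _ + X]ev2C /glued_conn !evg -glueD.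
rewrite -[LHS](glue_cst pou (_ : R^o) p); apply: (eq_glue pou) => k kp.
have dp := dom_chart_at p.
set c := ck k in kp *; set x := phi c p.
have oU := open_chart_image c; have Ix : chart_image c x by exists p.
set T := tmx c (chart_at p) p.
have GE : loc_bi g c x = T *m g p *m T^T by rewrite loc_biE.
have evT (a : 'rV[R]_n) V : ev2 g p (a *m T) (V p) = (a *m loc_bi g c x *m (loc_vec V c x)^T) 0 0.
  rewrite /ev2 GE -{1}(loc_vec_chart_at V p) (loc_vec_trans V kp dp) -/T trmx_mul.
  by rewrite !mulmxA.
rewrite !evT (vderE X (smooth_ev2 sg sY sZ) kp) -/x /loc_conn -/x.
set u := loc_vec X c x.
have HY := Ckm_loc_vec 1 c sY; have HZ := Ckm_loc_vec 1 c sZ; have HG := Ckm_loc_bi 1 c sg.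
have HYG := Ckm_mul oU HY HG; have HZt := Ckm_tr oU HZ; have HYGZ := Ckm_mul oU HYG HZt.
have -> : 'D_u (loc_fun (fun q => ev2 g q (Y q) (Z q)) c) x =
   ('D_u (fun y => loc_vec Y c y *m loc_bi g c y *m (loc_vec Z c y)^T) x) 0 0.
  have [_ ->] := derive_mxE u oU HYGZ Ix; rewrite mxE.
  apply: (derive_ext _ oU Ix) => y [q cq <-].
  by rewrite /loc_fun /= phiK// (ev2E _ _ _ cq).
rewrite (derive_mulmx _ oU HYG HZt Ix) (derive_trmx _ oU HZ Ix) (derive_mulmx _ oU HY HG Ix).
apply: dual_alg; last exact: HA.
by rewrite GE !trmx_mul trmxK gs mulmxA.
Qed.

End DualGlue.

(** * The Reeb field, the compatible metric and the local connections *)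

Section Fields.
Variables (R : realType) (n : nat) (M : smooth_manifold R n).
Variables (Om : bifield M) (al : covfield M) (H0 : bifield M).
Variables (tv : forall p, transverse (Om p) (al p)) (pH0 : forall p, posdef (H0 p)).
Variables (sO : smooth_bi Om) (sa : smooth_cov al) (sH : smooth_bi H0).

Definition reeb_vec : vfield M := fun p => reebv (Om p) (al p).
Definition shs_metric : bifield M := fun p => cometric (Om p) (al p) (H0 p).
Definition shs_theta : endfield M := fun p => Om p *m invmx (shs_metric p).

Let dc (p : M) : dom (chart_at p) p := dom_chart_at p.

Lemma loc_transverse c p : dom c p ->
  transverse (loc_bi Om c (phi c p)) (loc_cov al c (phi c p)).
Proof. by move=> cp; rewrite loc_biE// loc_covE//; apply: transverse_congr => //; exact: tmx_unit. Qed.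

Lemma loc_posdef c p (B : bifield M) : (forall p, posdef (B p)) -> dom c p ->
  posdef (loc_bi B c (phi c p)).
Proof. by move=> pB cp; rewrite loc_biE//; apply: posdef_congr => //; exact: tmx_unit. Qed.

Lemma loc_reeb c p : dom c p -> loc_vec reeb_vec c (phi c p) =
  reebv (loc_bi Om c (phi c p)) (loc_cov al c (phi c p)).
Proof.
move=> cp; rewrite loc_biE// loc_covE// loc_vecE// reebv_congr//; last exact: tmx_unit.
by rewrite tmx_inv.
Qed.

Lemma loc_metric c p : dom c p -> loc_bi shs_metric c (phi c p) =
  cometric (loc_bi Om c (phi c p)) (loc_cov al c (phi c p)) (loc_bi H0 c (phi c p)).
Proof.
move=> cp; rewrite !loc_biE// loc_covE// cometric_congr//; exact: tmx_unit.
Qed.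

Lemma shs_metricP p : [/\ posdef (shs_metric p), shs_metric p *m (reeb_vec p)^T = al p
  & shs_metric p = dualform (Om p) (al p) (invmx (shs_metric p))].
Proof. exact: cometricP. Qed.

Lemma loc_theta c p : dom c p -> loc_end shs_theta c (phi c p) =
  loc_bi Om c (phi c p) *m invmx (loc_bi shs_metric c (phi c p)).
Proof.
move=> cp; have [pg _ _] := shs_metricP p; have ug := posdef_unit pg.
have uT := tmx_unit cp (dc p).
rewrite !loc_biE// invmx_congr// /loc_end phiK// !tmxE tmx_inv//.
have uT' : (tmx c (chart_at p) p)^T \in unitmx by rewrite unitmx_tr.
rewrite !mulmxA -[_ *m _^T *m _^T]mulmxA -trmx_mul.
have -> : tmx (chart_at p) c p *m tmx c (chart_at p) p = 1%:M by rewrite tmx_comp// tmx_id.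
by rewrite trmx1 mulmx1.
Qed.

Lemma smooth_reeb : smooth_vec reeb_vec.
Proof.
move=> c; apply/smooth_mx_onP => k; have oU := open_chart_image c.
apply: (Ckm_ext oU _ (Ckm_reebv oU _ (Ckm_loc_bi k c sO) (Ckm_loc_cov k c sa))).
  by move=> x [p cp <-]; rewrite loc_reeb.
by move=> x [p cp <-]; exact: loc_transverse.
Qed.

Lemma smooth_metric : smooth_bi shs_metric.
Proof.
move=> c; apply/smooth_mx_onP => k; have oU := open_chart_image c.
apply: (Ckm_ext oU _ (Ckm_cometric oU _ _ (Ckm_loc_bi k c sO) (Ckm_loc_cov k c sa) (Ckm_loc_bi k c sH))).
- by move=> x [p cp <-]; rewrite loc_metric.
- by move=> x [p cp <-]; exact: loc_transverse.
- by move=> x [p cp <-]; exact: loc_posdef.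
Qed.

Lemma posdef_metric p : posdef (shs_metric p).
Proof. by have [] := shs_metricP p. Qed.

Lemma smooth_theta : smooth_end shs_theta.
Proof.
move=> c; apply/smooth_mx_onP => k; have oU := open_chart_image c.
have Hg := Ckm_loc_bi k c smooth_metric.
apply: (Ckm_ext oU (F := fun x => loc_bi Om c x *m invmx (loc_bi shs_metric c x))).
  by move=> x [p cp <-]; rewrite loc_theta.
apply: Ckm_mul => //; first exact: Ckm_loc_bi.
apply: Ckm_inv => // x [p cp <-]; apply: posdef_unit; apply: loc_posdef => //.
exact: posdef_metric.
Qed.

Lemma riemannian_metric : riemannian shs_metric.
Proof.
split; first exact: smooth_metric.
- move=> p v u; have [sg _] := posdef_metric p.
  rewrite /ev2; move: (shs_metric p) sg => G sg.
  have -> : u *m G *m v^T = (v *m G *m u^T)^T.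
    by rewrite !trmx_mul trmxK sg mulmxA.
  by rewrite [RHS]mxE.
- by move=> p v v0; have [_] := posdef_metric p; apply.
Qed.

Lemma reeb_vecP p : reeb_vec p *m Om p = 0 /\ reeb_vec p *m al p = 1%:M.
Proof. exact: reebvP. Qed.

Lemma metric_reeb p v : ev2 shs_metric p v (reeb_vec p) = ev1 al p v.
Proof.
have [_ gE _] := shs_metricP p.
by rewrite /ev2 /ev1 -mulmxA gE.
Qed.

(** With Theta = Omega G^-1, the equation G = Omega G^-1 Omega^T + alpha
alpha^T reads g = Omega(., Theta .) + alpha (x) alpha; multiplied by G^-1 on the
right, it gives Theta^2 = -1 + alpha E. *)
Lemma co_hermitian_vec_theta p :
  [/\ forall v, v *m shs_theta p *m shs_theta p = - v + ev1 al p v *: reeb_vec p,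
      reeb_vec p *m shs_theta p = 0,
      forall v, ev1 al p (v *m shs_theta p) = 0,
      forall v, ev1 al p v = ev2 shs_metric p v (reeb_vec p)
    & forall v u, ev2 shs_metric p v u
        = ev2 Om p v (u *m shs_theta p) + ev1 al p v * ev1 al p u].
Proof.
have [pg gE gd] := shs_metricP p; have [EO Ea] := reeb_vecP p.
have [skew _ _] := tv p; have ug := posdef_unit pg; have [sg _] := pg.
have mr := metric_reeb p; rewrite /shs_theta; rewrite /ev1 /ev2 in mr *.
move: (shs_metric p) (reeb_vec p) mr gE gd EO Ea pg ug sg.
move: (Om p) (al p) skew => O a skew G E mr gE gd EO Ea pg ug sg.
have Ea' : a^T *m invmx G = E.
  have : invmx G *m a = E^T by rewrite -gE mulKmx.
  by move=> /(congr1 trmx); rewrite trmx_mul trmx_inv sg trmxK.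
have OE : O *m E^T = 0.
  by rewrite -(trmxK O) -trmx_mul skew mulmxN EO oppr0 trmx0.
split.
- move=> v; rewrite -!mulmxA; set th2 := O *m _.
  have -> : th2 = - 1%:M + a *m E.
    rewrite /th2 -Ea' mulmxA -[LHS]addr0.
    have := congr1 (fun X => X *m invmx G) gd; rewrite mulmxV// mulmxDl skew mulmxN mulNmx => ->.
    by rewrite opprD opprK !mulmxA subrK addr0.
  by rewrite mulmxDr mulmxN mulmx1 mulmxA {1}(mx11E (v *m a)) mul_scalar_mx.
- by rewrite mulmxA EO mul0mx.
- move=> v; rewrite -!mulmxA.
  have -> : invmx G *m a = E^T by rewrite -gE mulKmx.
  by rewrite OE mulmx0 mxE.
- by move=> v; rewrite mr.
- move=> v u.
  have -> : v *m G *m u^T = v *m (O *m invmx G *m O^T) *m u^T + v *m (a *m a^T) *m u^T.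
    by rewrite -mulmxDl -mulmxDr; congr (_ *m _ *m _); exact: gd.
  rewrite mxE; congr (_ + _).
    by rewrite !trmx_mul trmx_inv sg !mulmxA.
  have -> : v *m (a *m a^T) *m u^T = (v *m a) *m (u *m a)^T by rewrite trmx_mul !mulmxA.
  by rewrite mxE big_ord1 [X in _ * X]mxE.
Qed.

(** The matrix of Y |-> S(u, Y) for the symmetric tensor S(X, Y) =
alpha(X) alpha(Y) d_E E - alpha(X) d_Y E - alpha(Y) d_X E, where d is the flat
connection of the chart. *)
Definition reeb_form (c : chart_index M) (x u : 'rV[R]_n) : 'M[R]_n :=
  let e := loc_vec reeb_vec c in let a := loc_cov al c x in
  let J := 'J e x in let t := (u *m a) 0 0 in
  t *: (a *m (e x *m J)) - a *m (u *m J) - t *: J.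

(** The solution A' of d_u G = A G + G A'^T for A = [reeb_form c x u]. *)
Definition dual_form (c : chart_index M) (x u : 'rV[R]_n) : 'M[R]_n :=
  let G := loc_bi shs_metric c in
  ('D_u G x - reeb_form c x u *m G x)^T *m invmx (G x).

Lemma Ckm_reeb_form c j V : Ckm j (chart_image c) V ->
  Ckm j (chart_image c) (fun x => reeb_form c x (V x)).
Proof.
move=> HV; have oU := open_chart_image c.
have He := Ckm_loc_vec j c smooth_reeb; have Ha := Ckm_loc_cov j c sa.
have HJ := Ckm_jacobian oU (Ckm_loc_vec j.+1 c smooth_reeb).
have Ht : Ck j (chart_image c) (fun x => (V x *m loc_cov al c x) 0 0).
  exact: (Ckm_mul oU HV Ha).
have H1 := Ckm_scale oU Ht (Ckm_mul oU Ha (Ckm_mul oU He HJ)).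
have H2 := Ckm_mul oU Ha (Ckm_mul oU HV HJ).
exact: (Ckm_subf oU (Ckm_subf oU H1 H2) (Ckm_scale oU Ht HJ)).
Qed.

Lemma reeb_form_lin c x r u v :
  reeb_form c x (r *: u + v) = r *: reeb_form c x u + reeb_form c x v.
Proof.
rewrite /reeb_form; move: (loc_cov al c x) ('J _ x) (loc_vec _ c x) => a J e.
move: (a *m (e *m J)) => b.
rewrite mulmxDl -scalemxAl !mxE mulmxDl -scalemxAl mulmxDr -scalemxAr.
move: (a *m (u *m J)) (a *m (v *m J)) ((u *m a) 0 0) ((v *m a) 0 0) => p q s t.
by apply/matrixP => i k; rewrite !mxE; ring.
Qed.

Lemma conn_form_reeb c : conn_form c (reeb_form c).
Proof. by split=> [j V|x r u v _]; [exact: Ckm_reeb_form|exact: reeb_form_lin]. Qed.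

Lemma conn_form_dual c : conn_form c (dual_form c).
Proof.
have oU := open_chart_image c.
split=> [j V HV|x r u v Ix]; rewrite /dual_form.
- have HG := Ckm_loc_bi j c smooth_metric.
  have uG x : chart_image c x -> loc_bi shs_metric c x \in unitmx.
    by move=> [p cp <-]; apply: posdef_unit; apply: loc_posdef => //; exact: posdef_metric.
  have HD := Ckm_derive oU (Ckm_loc_bi j.+1 c smooth_metric) HV.
  have H1 := Ckm_tr oU (Ckm_subf oU HD (Ckm_mul oU (Ckm_reeb_form HV) HG)).
  exact: (Ckm_mul oU H1 (Ckm_inv oU uG HG)).
- rewrite (derive_lin r u v oU (Ckm_loc_bi 1 c smooth_metric) Ix) reeb_form_lin.
  move: ('D_u _ x) ('D_v _ x) (reeb_form c x u) (reeb_form c x v) (loc_bi _ c x) => a b A B G.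
  rewrite scalemxAl -mulmxDl; congr (_ *m _).
  rewrite -linearP /=; congr (_^T).
  by rewrite mulmxDl -scalemxAl scalerBr opprD addrACA.
Qed.

Lemma dual_formP c x u : chart_image c x ->
  'D_u (loc_bi shs_metric c) x = reeb_form c x u *m loc_bi shs_metric c x
    + loc_bi shs_metric c x *m (dual_form c x u)^T.
Proof.
move=> [p cp <-]; rewrite /dual_form.
have pG := loc_posdef posdef_metric cp; have [sG _] := pG; have uG := posdef_unit pG.
move: ('D_u _ _) (reeb_form _ _ _) (loc_bi _ _ _) pG sG uG => d A G pG sG uG.
rewrite trmx_mul trmxK trmx_inv sG mulKVmx//.
by rewrite addrC subrK.
Qed.

Lemma reeb_form_sym c x u v : u *m reeb_form c x v = v *m reeb_form c x u.
Proof.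
rewrite /reeb_form; move: (loc_cov al c x) ('J _ x) (loc_vec _ c x) => a J e0.
move: (e0 *m J) => e.
have E (y z : 'rV[R]_n) : y *m ((z *m a) 0 0 *: (a *m e) - a *m (z *m J) - (z *m a) 0 0 *: J) =
  ((z *m a) 0 0 * (y *m a) 0 0) *: e - ((y *m a) 0 0 *: (z *m J) + (z *m a) 0 0 *: (y *m J)).
  rewrite !mulmxBr -!scalemxAr !mulmxA -!(mulmxA (y *m a)) (mx11E (y *m a)) !mul_scalar_mx.
  by rewrite !mxE eqxx mulr1n scalerA opprD addrA.
by rewrite !E mulrC [X in _ - X]addrC.
Qed.

(** The covariant derivative of E along u is d_u E + S(u, E), and
S(u, E) = alpha(u) d_E E - alpha(u) d_E E - d_u E. *)
Lemma loc_conn_reeb c X p : dom c p ->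
  loc_conn c (reeb_form c) X reeb_vec (phi c p) = 0.
Proof.
move=> cp; rewrite /loc_conn; set x := phi c p; set u := loc_vec X c x.
have Ix : chart_image c x by exists p.
have dE : differentiable (loc_vec reeb_vec c) x.
  exact: (Ckm_differentiable (open_chart_image c) (Ckm_loc_vec 1 c smooth_reeb) Ix).
rewrite (deriveEjacobian _ dE) /reeb_form.
have ea : loc_vec reeb_vec c x *m loc_cov al c x = 1%:M.
  rewrite loc_reeb//; have [_ ->//] := reebvP (loc_transverse cp).
move: (loc_vec reeb_vec c x) (loc_cov al c x) ('J _ x) ea => e a J ea.
rewrite !mulmxBr -!scalemxAr !mulmxA ea !mul1mx.
move: (u *m J) ((u *m a) 0 0 *: (e *m J)) => y z.
by rewrite [z - y - z]addrAC subrr add0r subrr.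
Qed.

End Fields.

(** * Parallel distributions *)

Section Parallel.
Variables (R : realType) (n : nat) (M : smooth_manifold R n).
Variables (Om : bifield M) (al : covfield M) (g : bifield M) (E : vfield M).
Variables D D' : vfield M -> vfield M -> vfield M.

(** A section S of ker Omega is alpha(S) E, and by the Leibniz rule
D_Y S = (Y alpha(S)) E. *)
Lemma parallel_ker2 : linear_connection D -> smooth_cov al -> smooth_vec E ->
  (forall p, transverse (Om p) (al p)) ->
  (forall p, E p *m Om p = 0) -> (forall p, E p *m al p = 1%:M) ->
  (forall X, smooth_vec X -> forall p, D X E p = 0) ->
  parallel (ker2 Om) D.
Proof.
move=> [_ _ _ leib] sa sE tv EO Ea DE Y S sY sS kS p.
pose s q := ev1 al q (S q).
have ss : smooth_fun s by exact: smooth_ev1.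
have SE : S = fun q => s q *: E q.
  apply/funext => q; apply/eqP; rewrite -subr_eq0; apply/eqP.
  have [_ H _] := tv q; apply: H.
    rewrite mulmxBl -scalemxAl EO scaler0 subr0; apply/rowP => j.
    have := kS q (delta_mx 0 j); rewrite /ev2 trmx_delta => e.
    by rewrite [RHS]mxE -e -colE [RHS]mxE.
  by rewrite mulmxBl -scalemxAl Ea scalemx1 {1}(mx11E (S q *m al q)) subrr mxE.
rewrite {1}SE => w; rewrite (leib s Y E ss sY sE p) (DE Y sY) scaler0 addr0.
by rewrite /ev2 -scalemxAl EO scaler0 mul0mx mxE.
Qed.

(** Since g(E, S) = alpha(S) = 0, duality gives
0 = g(D_Y E, S) + g(E, D'_Y S) = alpha(D'_Y S). *)
Lemma parallel_ker1 : dual_connections g D D' -> smooth_vec E ->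
  (forall p v u, ev2 g p v u = ev2 g p u v) ->
  (forall p v, ev2 g p v (E p) = ev1 al p v) ->
  (forall X, smooth_vec X -> forall p, D X E p = 0) ->
  parallel (ker1 al) D'.
Proof.
move=> dual sE gs gE DE Y S sY sS kS p.
have := dual Y E S sY sE sS p.
have -> : (fun q => ev2 g q (E q) (S q)) = fun=> 0.
  by apply/funext => q; rewrite gs gE; exact: kS.
rewrite (DE Y sY) [ev2 g p (E p) _]gs gE /ker1 /= /vder => h.
have h0 : ev2 g p 0 (S p) = 0 by rewrite /ev2 !mul0mx mxE.
rewrite h0 add0r in h; rewrite -h.
exact: derive_cst.
Qed.

End Parallel.

(** * Existence of the adapted connections *)

Section Main.
Variables (R : realType) (d : nat) (M : smooth_manifold R d.*2.+1).
Variables (Om : bifield M) (al : covfield M).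

Definition has_adapted_smat : Prop :=
  exists (g : bifield M) (D D' : vfield M -> vfield M -> vfield M),
    [/\ co_hermitian Om al g, smat g D D', parallel (ker2 Om) D
      & parallel (ker1 al) D'].

(** The partition of unity is indexed by nat and so requires at least one
chart: the empty manifold is treated apart. *)
Lemma adapted_smat_empty : (M -> False) -> has_adapted_smat.
Proof.
move=> noM; have E (c : chart_index M) x : chart_image c x -> False by case=> p _ _; exact: (noM p).
have sv (X : vfield M) : smooth_vec X by move=> c i j s x /E[].
have sb (B : bifield M) : smooth_bi B by move=> c i j s x /E[].
have se (B : endfield M) : smooth_end B by move=> c i j s x /E[].
exists (fun=> 0), (fun _ _ _ => 0), (fun _ _ _ => 0).
have ri : riemannian (fun _ : M => 0 : 'M[R]_d.*2.+1) by split=> // p; case: (noM p).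
split.
- split=> //; exists (fun=> 0), (fun=> 0).
  split=> [||p]; [|exact: se|by case: (noM p)].
  by split=> [|p|p]; [exact: sv|case: (noM p)|case: (noM p)].
- have lc : linear_connection ((fun _ _ _ => 0) : vfield M -> vfield M -> vfield M).
    split=> [X Y _ _|f X X' Y _ _ _ _ p|r X Y Y' _ _ _ p|f X Y _ _ _ p].
    - exact: sv.
    - by case: (noM p).
    - by case: (noM p).
    - by case: (noM p).
  split=> [|||X Y Z _ _ _ p|X Y _ _ p].
  - exact: ri.
  - exact: lc.
  - exact: lc.
  - by case: (noM p).
  - by case: (noM p).
- by move=> Y S _ _ _ p; case: (noM p).
- by move=> Y S _ _ _ p; case: (noM p).
Qed.

Lemma adapted_smat_inhabited (p0 : M) : stable_hamiltonian Om al -> has_adapted_smat.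
Proof.
move=> shs; have tv p := shs_transverse p shs.
have [[[sO _] _] sa _ _] := shs.
have [w [ck pou]] := @exists_pou R _ M p0.
pose H0 := glued_metric w ck.
have pH0 p : posdef (H0 p) by exact: posdef_glued_metric.
have sH : smooth_bi H0 by exact: smooth_glued_metric.
pose g := shs_metric Om al H0; pose E := reeb_vec Om al.
pose A k := reeb_form Om al (ck k); pose A' k := dual_form Om al H0 (ck k).
have cA k : conn_form (ck k) (A k) by exact: conn_form_reeb.
have cA' k : conn_form (ck k) (A' k) by exact: conn_form_dual.
pose D := glued_conn w ck A; pose D' := glued_conn w ck A'.
have sg : smooth_bi g by exact: smooth_metric.
have sE : smooth_vec E by exact: smooth_reeb.
have rg : riemannian g by exact: riemannian_metric.
have EP p : E p *m Om p = 0 /\ E p *m al p = 1%:M by exact: reeb_vecP.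
have DE X : smooth_vec X -> forall p, D X E p = 0.
  move=> sX p; apply: (glued_conn_eq pou) => k kp.
  by rewrite mul0mx; exact: loc_conn_reeb.
have lD : linear_connection D by exact: linear_glued_conn.
have lD' : linear_connection D' by exact: linear_glued_conn.
have dD : dual_connections g D D'.
  apply: dual_glued => // [p|k x u Ix]; first by have [] := posdef_metric tv pH0 p.
  exact: dual_formP.
have tD : torsion_free D.
  by apply: (torsion_free_glued_conn pou) => // k x u v _; exact: reeb_form_sym.
exists g, D, D'; split.
- split=> //; exists E, (shs_theta Om al H0); split.
  + split=> // p; first by move=> v; rewrite /ev2 (EP p).1 mul0mx mxE.
    by rewrite /ev1 (EP p).2 mxE eqxx.
  + exact: smooth_theta.
  + exact: co_hermitian_vec_theta.
- by split.
- apply: (parallel_ker2 lD sa sE tv) => // p; by have [] := EP p.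
- apply: (parallel_ker1 dD sE) => //.
  + by case: rg.
  + by move=> p v; exact: metric_reeb.
Qed.

End Main.

Theorem proposition4p6 (R : realType) (d : nat)
    (M : smooth_manifold R d.*2.+1)
    (Omega : bifield M) (alpha : covfield M)
    (hshs : stable_hamiltonian Omega alpha) :
  exists (g : bifield M) (D D' : vfield M -> vfield M -> vfield M),
    [/\ co_hermitian Omega alpha g,
        smat g D D',
        parallel (ker2 Omega) D
      & parallel (ker1 alpha) D'].
Proof.
have [[p0]|noM] := pselect (inhabited M); first exact: adapted_smat_inhabited.
by apply: adapted_smat_empty => p; apply: noM; exists.
Qed.
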